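(* Let $X$ be a separable Hilbert space, $\nu$ a Borel probability measure on $X$ and $R\in\mathcal L(X)$. Assume that for every $z\in X$ there exists $v_z\in\bigcap_{1\le p<\infty}L^p(X,\nu)$ such that $$\int_X\langle RD\varphi,z\rangle\,d\nu=\int_X\varphi\,v_z\,d\nu\qquad\text{for all }\varphi\in C_b^1(X),$$ and that every real-valued Lipschitz function on $X$ is Gâteaux differentiable outside a $\nu$-null set. Let $O\subseteq X$ be an open set and let $f\in L^p(O,\nu)$ for some $p>1$. Then $f\in BV(O,\nu)$ if and only if $V_\nu(f,O)<+\infty$. In this case, $|D_\nu^Of|(O)=V_\nu(f,O)$.
   Context: $\langle\cdot,\cdot\rangle$ is the inner product of $X$. $C_b^1(X)$ is the space of bounded Fréchet differentiable functions $X\to\mathbb R$ with bounded Fréchet derivative $D\varphi$ (identified with a gradient in $X$). $\nabla$ denotes the Gâteaux derivative (gradient) of a Lipschitz function, defined $\nu$-a.e. For a Hilbert space $Y$, ${\rm Lip}_c(O,Y)$ is the set of bounded Lipschitz functions $G:X\to Y$ whose support is a bounded subset of $O$ with positive distance from $O^c=X\setminus O$; ${\rm Lip}_c(O)={\rm Lip}_c(O,\mathbb R)$. $\mathscr M(O,X)$ is the set of countably additive $X$-valued Borel measures $\mu$ on $O$ with finite total variation $|\mu|$. Let $f\in L^1(O,\nu)$ be such that $f v_z\in L^1(O,\nu)$ for every $z\in X$ (automatic if $f\in L^p(O,\nu)$, $p>1$). One says $f\in BV(O,\nu)$ if there is $\mu\in\mathscr M(O,X)$ such that, with $\mu_z(B)=\langle\mu(B),z\rangle$,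 $$\int_Of(\langle R\nabla\varphi,z\rangle-\varphi v_z)\,d\nu=-\int_O\varphi\,d\mu_z\qquad\text{for all }\varphi\in{\rm Lip}_c(O),\ z\in X;$$ then $D_\nu^Of:=\mu$. The variation is $$V_\nu(f,O)=\sup\Big\{\int_OfM^{*,F}\varphi\,d\nu:\ F\subseteq X\text{ finite dimensional},\ \varphi\in{\rm Lip}_c(O,F),\ \|\varphi\|_\infty\le1\Big\},$$ where, for an orthonormal basis $\{e_1,\dots,e_m\}$ of $F$ and $\varphi=\sum_{j=1}^m\varphi_je_j$, $M^{*,F}\varphi=\sum_{j=1}^m(\langle R\nabla\varphi_j,e_j\rangle-\varphi_jv_{e_j})$ and $\|\varphi\|_\infty=\sup_x\|\varphi(x)\|_X$. *)

(* Defs.v *)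
From HB Require Import structures.
From mathcomp Require Import all_boot all_order all_algebra.
From mathcomp Require Import ring.
From mathcomp Require Import all_classical all_reals all_analysis.

Set Implicit Arguments.
Unset Strict Implicit.
Unset Printing Implicit Defensive.

Import Order.TTheory GRing.Theory Num.Theory.
Import numFieldNormedType.Exports.

Local Open Scope classical_set_scope.
Local Open Scope ring_scope.

(* An inner product inducing the given norm: on a completeNormedModType over a
   realType, this is the structure of a real Hilbert space. *)
Record inner_product (K : realType) (X : normedModType K) := InnerProduct {
  ip_form :> {dot X for (@idfun K)} ;
  ip_normE : forall x : X, `|x| ^+ 2 = ip_form x x }.

Definition separable_space (T : topologicalType) :=
  exists2 D : set T, countable D & dense D.

Notation borel X := (g_sigma_algebraType (@open X)).

Lemma open_borel (X : ptopologicalType) (O : set X) :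
  open O -> measurable (O : set (borel X)).
Proof. exact: sub_sigma_algebra. Qed.

Section Differentiation.
Context (K : realType) (X : normedModType K) (ip : inner_product X).
Implicit Types (phi : X -> K) (x g h : X).

(* D phi x as a vector: meaningful only if phi is differentiable at x. *)
Definition frechet_grad phi x : X :=
  xget 0 [set g | forall h, 'd phi x h = ip g h].

Definition C1b phi := [/\ [bounded phi x | x in setT],
  forall x, differentiable phi x & [bounded frechet_grad phi x | x in setT]].

Definition gateaux_differentiable phi x :=
  exists g, forall h, is_derive x h phi (ip g h).

(* Equal to 0 where phi is not Gateaux differentiable. *)
Definition gateaux_grad phi x : X :=
  xget 0 [set g | forall h, is_derive x h phi (ip g h)].

End Differentiation.

Section LipschitzCompact.
Context (K : realType) (X Y : normedModType K).

Definition closed_support (G : X -> Y) := closure [set x | G x != 0].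

Definition Lipc (O : set X) (G : X -> Y) := [/\
  [bounded G x | x in setT], [lipschitz G x | x in setT],
  bounded_set (closed_support G), closed_support G `<=` O &
  exists2 e : K, 0 < e &
    forall x y, closed_support G x -> (~` O) y -> e <= `|x - y|].

End LipschitzCompact.

Section VectorMeasure.
Context d (T : measurableType d) (K : realType) (X : normedModType K).

Definition partition_of (B : set T) (A : (set T)^nat) := [/\
  forall n, measurable (A n), trivIset setT A & \bigcup_n A n = B].

Definition vm_variation (mu : set T -> X) (B : set T) : \bar K :=
  ereal_sup [set (\sum_(0 <= n <oo) `|mu (A n)|%:E)%E | A in partition_of B].

(* Only the values of mu on measurable subsets of O are relevant. *)
Record vmeasure (O : set T) := VMeasure {
  vmeasure_val :> set T -> X ;
  vmeasure_sigma_additive : forall (A : (set T)^nat) (B : set T), B `<=` O ->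
    partition_of B A ->
    series (fun n => vmeasure_val (A n)) @ \oo --> vmeasure_val B ;
  vmeasure_finite_variation : (vm_variation vmeasure_val O < +oo)%E }.

End VectorMeasure.

(* X-valued Borel measures of finite variation on O, with O : set X. *)
Notation borel_vmeasure X O := (@vmeasure _ (borel X) _ X O).

Section ChargeIntegral.
Context d (T : measurableType d) (K : realType).

(* Integral against a signed measure, through its Jordan decomposition; it does
   not depend on the Hahn decomposition that is chosen. *)
Definition charge_integral (nu : {charge set T -> \bar K}) (D : set T)
    (f : T -> K) : K :=
  let: exist _ exN := cid (Hahn_decomposition nu) in
  let: exist _ nuPN := cid exN in
  \int[jordan_pos nuPN]_(x in D) f x - \int[jordan_neg nuPN]_(x in D) f x.

End ChargeIntegral.

Section Coordinate.
Context d (T : measurableType d) (K : realType) (X : normedModType K).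
Context (ip : inner_product X) (O : set T) (mO : measurable O).
Context (mu : vmeasure X O) (z : X).

(* The real measure mu_z = <mu(.), z> on O, extended by 0 outside O.
   Measurability of O is what makes this a charge. *)
Definition coord_charge of measurable O := fun B : set T =>
  (ip (mu (B `&` O)) z)%:E.

Lemma ipC (x y : X) : ip x y = ip y x.
Proof. by rewrite (hermC ip) expr0 mul1r. Qed.

Lemma ipBl (x y w : X) : ip (x - y) w = ip x w - ip y w.
Proof. exact: (linearBl (ip_form ip) w). Qed.

Lemma ipZl (a : K) (x w : X) : ip (a *: x) w = a * ip x w.
Proof. exact: (linearZl_LR (ip_form ip) w). Qed.

Lemma ip_suml (s : seq nat) (F : nat -> X) (w : X) :
  ip (\sum_(i <- s) F i) w = \sum_(i <- s) ip (F i) w.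
Proof. exact: (linear_sumlz (ip_form ip) w). Qed.

Lemma ip0l (w : X) : ip 0 w = 0.
Proof. exact: (linear0l (ip_form ip) w). Qed.

Lemma ip_bound (x y : X) : `|ip x y| <= `|x| * `|y|.
Proof.
have [->|y0] := eqVneq y 0; first by rewrite ipC ip0l !normr0 mulr0.
have ny : 0 < `|y| by rewrite normr_gt0.
rewrite -ler_sqr ?nnegrE ?mulr_ge0// exprMn -normrX ger0_norm ?sqr_ge0//.
have : 0 <= `|(`|y| ^+ 2) *: x - ip x y *: y| ^+ 2 by rewrite sqr_ge0.
rewrite [X in 0 <= X](ip_normE ip) ipBl !ipZl ![ip _ (_ - _)]ipC !ipBl !ipZl.
rewrite (ipC y x) -!(ip_normE ip).
set a := `|y| in ny *; set b := `|x|; set c := ip x y => h.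
have {}h : 0 <= a ^+ 2 * (b ^+ 2 * a ^+ 2 - c ^+ 2).
  by apply: le_trans h _; rewrite le_eqVlt; apply/orP; left; apply/eqP; ring.
by rewrite -subr_ge0 -(pmulr_rge0 _ (exprn_gt0 2 ny)).
Qed.

Lemma vmeasure0 : mu set0 = 0.
Proof.
have P : partition_of set0 (fun _ : nat => set0 : set T).
  by split=> //; [exact: trivIset_set0|rewrite bigcup0].
have h := @vmeasure_sigma_additive _ _ _ _ _ mu _ _ (sub0set O) P.
have := @cvg_series_cvg_0 _ _ _ (cvgP _ h).
by move=> /cvg_lim <-//; rewrite lim_cst.
Qed.

Let coord0 : coord_charge mO set0 = 0%E.
Proof. by rewrite /coord_charge set0I vmeasure0 ip0l. Qed.

Let coord_finite B : measurable B -> coord_charge mO B \is a fin_num.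
Proof. by []. Qed.

Let coord_sigma_additive : semi_sigma_additive (coord_charge mO).
Proof.
move=> A mA tA mUA.
have P : partition_of (\bigcup_n A n `&` O) (fun n => A n `&` O).
  split; first by move=> n; exact: measurableI.
    exact: trivIset_setIr.
  by rewrite setI_bigcupl.
have h := @vmeasure_sigma_additive _ _ _ _ _ mu _ _ (@subIsetr _ _ _) P.
rewrite /coord_charge; under eq_fun do rewrite sumEFin.
apply: cvg_EFin; first exact: nearW.
apply/cvgrPdist_le => e e0.
have d0 : 0 < e / (`|z| + 1) by rewrite divr_gt0// ltr_wpDl.
move/cvgrPdist_le : h => /(_ _ d0); apply: filterS => n /= hn.
have -> : \sum_(0 <= i < n) ip (mu (A i `&` O)) z =
    ip (series (fun n => mu (A n `&` O)) n) z.
  by rewrite /series/= ip_suml.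
rewrite -ipBl; apply: le_trans (ip_bound _ _) _.
apply: (@le_trans _ _ (e / (`|z| + 1) * `|z|)); first by rewrite ler_wpM2r.
rewrite mulrAC ler_pdivrMr ?ltr_wpDl//.
by apply: ler_wpM2l; [exact: ltW|rewrite lerDl].
Qed.

HB.instance Definition _ := isCharge.Build _ T K (coord_charge mO)
  coord0 coord_finite coord_sigma_additive.

End Coordinate.

Section BV.
Context (K : realType) (X : completeNormedModType K) (ip : inner_product X).
Context (nu : probability (borel X) K) (R : X -> X) (v : X -> X -> K).
Context (O : set X) (oO : open O) (f : X -> K).
Implicit Types (z : X) (phi : X -> K) (F : set X).

Local Notation grad := (gateaux_grad ip).

Definition is_BV_derivative (mu : borel_vmeasure X O) :=
  forall phi z, Lipc O phi ->
    \int[nu]_(x in O) (f x * (ip (R (grad phi x)) z - phi x * v z x)) =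
    - charge_integral (coord_charge ip mu z (open_borel oO)) O phi.

Definition BV := [/\ nu.-integrable O (EFin \o f),
  forall z, nu.-integrable O (fun x => (f x * v z x)%:E) &
  exists mu, is_BV_derivative mu].

Definition orthonormal_basis m (e : 'I_m -> X) F :=
  (forall i j, ip (e i) (e j) = (i == j)%:R) /\
  F = [set \sum_i c i *: e i | c in [set: 'I_m -> K]].

(* M^{*,F} phi, for phi with values in the span F of the orthonormal family e,
   so that the j-th coordinate of phi is <phi(.), e_j>. *)
Definition Mstar m (e : 'I_m -> X) (phi : X -> X) (x : X) : K :=
  \sum_j (ip (R (grad (fun y => ip (phi y) (e j)) x)) (e j) -
          ip (phi x) (e j) * v (e j) x).

Definition nu_variation : \bar K := ereal_sup
  [set t | exists F m (e : 'I_m -> X) (phi : X -> X),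
    [/\ orthonormal_basis e F, Lipc O phi, forall x, F (phi x),
        forall x, `|phi x| <= 1 &
        t = (\int[nu]_(x in O) (f x * Mstar e phi x))%:E]].

End BV.

(* Main.v *)
From HB Require Import structures.
Require Import Defs.
From mathcomp Require Import all_boot all_order all_algebra.
From mathcomp Require Import ring lra.
From mathcomp Require Import all_classical all_reals all_analysis measurable_realfun.

Import Order.TTheory GRing.Theory Num.Theory.
Import numFieldNormedType.Exports.

Local Open Scope classical_set_scope.
Local Open Scope ring_scope.

Set Implicit Arguments.
Unset Strict Implicit.
Unset Printing Implicit Defensive.

(** For [phi] a test function on [O] and [z] a vector put
[T z phi = - \int_O f * (<R grad phi, z> - phi * v z)]. A vector measure [mu] is
the derivative of [f] exactly when every coordinate [<mu(.), z>] represents the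
functional [T z], and the variation of [f] is the supremum [V] of
[\sum_j T (e j) (phi j)] over orthonormal families [e] and test functions
[phi j] with [\sum_j phi j ^+ 2 <= 1]. The theorem is therefore a Riesz theorem
with values in [X], with equality of norms.

If [V] is finite, [|T z phi| <= |z| * V] when [0 <= phi <= 1]. This bound alone
does not give a countably additive measure, as [X] need not be locally compact.
What replaces compactness is a continuity property of [T z]: if test functions
that are uniformly bounded and uniformly Lipschitz tend to 0 pointwise, their
images under [T z] tend to 0 ([div_functional_cvg]). Indeed the directional
derivatives are bounded, and integration by parts against Lipschitz functions,
which are dense in [L^1], shows that they tend to 0 weakly. The hypothesis gives
integration by parts only for smooth functions; [smooth_approx] and
[lipschitz_parts] extend it to Lipschitz functions, whose derivatives exist
almost everywhere by assumption.

For any functional with this continuity and a one-sided bound on the order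
interval [0, 1], the supremum over test functions supported in an open set is
countably subadditive ([countable_subadd]): for every radius, test functions that
live away from a large finite set contribute little ([tight_along]), and near such
finite sets for many radii, an open cover reduces to a finite one because [X] is
complete ([ball_nets_exhaust]). The Caratheodory construction then yields a finite
measure, and the difference of the measures of [T z] and [- T z] represents [T z]
([lip_functional_repr]).

For a Borel subset [B] of [O] the value of the signed measure of [T z] is linear
in [z] and bounded by [V * |z|], so it is [<mu B, z>] for a vector [mu B]. Disjoint
sets [A k] are approximated by a partition of unity, whose combination with the
directions of [mu (A k)] is an admissible test field; hence [\sum_k |mu (A k)|] is
at most [V] ([sum_norm_le], [vector_sum_norm_le]). This gives countable additivity
of [mu] and shows that its total variation is at most [V]. The converse inequality
holds for every derivative [mu]: a test field is nearly constant on small sets, so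
its integral is nearly a sum of inner products with the values of [mu]
([field_integral_le_variation]). *)

(** * Hilbert spaces *)

Section Hilbert.
Context (K : realType) (X : completeNormedModType K) (ip : inner_product X).
Implicit Types (x y z w h : X).

Lemma ip_addl x y w : ip (x + y) w = ip x w + ip y w.
Proof. exact: (linearDl (ip_form ip) w). Qed.

Lemma ip_addr x y w : ip w (x + y) = ip w x + ip w y.
Proof. by rewrite !(ipC _ w) ip_addl. Qed.

Lemma ip_subr x y w : ip w (x - y) = ip w x - ip w y.
Proof. by rewrite !(ipC _ w) ipBl. Qed.

Lemma ip_scaler a x w : ip w (a *: x) = a * ip w x.
Proof. by rewrite !(ipC _ w) ipZl. Qed.

Lemma ip0r x : ip x 0 = 0.
Proof. by rewrite ipC ip0l. Qed.

Lemma ip_sumr I (s : seq I) (P : pred I) (F : I -> X) w :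
  ip w (\sum_(i <- s | P i) F i) = \sum_(i <- s | P i) ip w (F i).
Proof.
by apply: (big_morph (ip w)) => [x y|]; [exact: ip_addr|exact: ip0r].
Qed.

Lemma ip_suml' I (s : seq I) (P : pred I) (F : I -> X) w :
  ip (\sum_(i <- s | P i) F i) w = \sum_(i <- s | P i) ip (F i) w.
Proof. by rewrite ipC ip_sumr; apply: eq_bigr => i _; rewrite ipC. Qed.

Lemma ip_inj x y : (forall h, ip x h = ip y h) -> x = y.
Proof.
move=> xy; apply/eqP; rewrite -subr_eq0 -normr_eq0 -sqrf_eq0 (ip_normE ip).
by rewrite ipBl xy subrr.
Qed.

Lemma norm_add_sqr x y : `|x + y| ^+ 2 = `|x| ^+ 2 + 2 * ip x y + `|y| ^+ 2.
Proof.
by rewrite !(ip_normE ip) ip_addl !ip_addr (ipC _ y x); ring.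
Qed.

Lemma cvg_ip x (u : X^nat) w :
  u @ \oo --> x -> (fun n => ip (u n) w) @ \oo --> ip x w.
Proof.
move=> ux; apply/cvgrPdist_le => e e0.
have d0 : 0 < e / (`|w| + 1) by rewrite divr_gt0// ltr_wpDl.
move/cvgrPdist_le : ux => /(_ _ d0); apply: filterS => n hn.
rewrite -ipBl (le_trans (ip_bound _ _ _))//.
rewrite (@le_trans _ _ (e / (`|w| + 1) * `|w|)) ?ler_wpM2r//.
by rewrite mulrAC ler_pdivrMr ?ltr_wpDl// ler_wpM2l ?lerDl// ltW.
Qed.

Lemma separable_seq (T : ptopologicalType) : separable_space T ->
  exists d : nat -> T, forall U : set T, open U -> U !=set0 -> exists n, U (d n).
Proof.
move=> [D cD dD].
move/pfcard_geP : cD => [D0|[g]].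
  exfalso; have [x] : (setT `&` D) !=set0.
    by apply: dD; [by exists point|exact: openT].
  by rewrite D0 setI0.
exists g => U oU U0; have [x [Ux Dx]] := dD _ U0 oU.
by have [n _ gn] := 'surj_g Dx; exists n; rewrite gn.
Qed.

Section GramSchmidt.
Context (d : nat -> X).

(** Equal to 0 for [w = 0], so that vectors that depend linearly on the previous
ones give zero terms in the Gram-Schmidt sequence. *)
Definition normalize w := `|w|^-1 *: w.

Fixpoint gs_proj n : X -> X := if n is m.+1 then
    fun x => let u := normalize (d m - gs_proj m (d m)) in
             gs_proj m x + ip x u *: u
  else fun=> 0.

Definition gs n := locked (normalize (d n - gs_proj n (d n))).

Lemma gsE n : gs n = normalize (d n - gs_proj n (d n)).
Proof. by rewrite /gs -lock. Qed.

Lemma gs_projS n x : gs_proj n.+1 x = gs_proj n x + ip x (gs n) *: gs n.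
Proof. by rewrite gsE. Qed.

Lemma gs_projE n x : gs_proj n x = \sum_(i < n) ip x (gs i) *: gs i.
Proof.
by elim: n => [|n IH]; [rewrite big_ord0|rewrite gs_projS IH big_ord_recr].
Qed.

Lemma normalizeK w : `|w| *: normalize w = w.
Proof.
have [->|w0] := eqVneq w 0; first by rewrite /normalize !scaler0.
by rewrite scalerA divff ?scale1r// normr_eq0.
Qed.

Lemma normalize_sqr w : normalize w = 0 \/ `|normalize w| = 1.
Proof.
have [->|w0] := eqVneq w 0; first by left; rewrite /normalize scaler0.
by right; rewrite normrZ normfV normr_id mulVf// normr_eq0.
Qed.

Lemma gs01 n : gs n = 0 \/ `|gs n| = 1. Proof. by rewrite gsE; exact: normalize_sqr. Qed.

Lemma gs_ipZ n x : ip x (gs n) * ip (gs n) (gs n) = ip x (gs n).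
Proof.
have [->|h] := gs01 n; first by rewrite ip0r mul0r.
by rewrite -(ip_normE ip) h expr1n mulr1.
Qed.

Lemma gs_orth i j : i != j -> ip (gs i) (gs j) = 0.
Proof.
move=> ij; wlog {ij} lt_ij : i j / (i < j)%N.
    move=> H; have [||e] := ltngtP i j; [exact: H| |by rewrite e eqxx in ij].
  by rewrite ipC; apply: H; rewrite eq_sym.
elim/ltn_ind : j i lt_ij => j IH i ij.
have -> : gs j = `|d j - gs_proj j (d j)|^-1 *: (d j - gs_proj j (d j)) by rewrite gsE.
move: (`|_|^-1) => c; rewrite ip_scaler ip_subr gs_projE ip_sumr.
rewrite (bigD1 (Ordinal ij))//= big1 => [|k ki]; last first.
  rewrite ip_scaler (_ : ip (gs i) (gs k) = 0) ?mulr0//.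
  have [ik|ki'|e] := ltngtP i k; [exact: IH|by rewrite ipC; exact: IH|].
  by rewrite -val_eqE/= e eqxx in ki.
by rewrite addr0 ip_scaler gs_ipZ (ipC _ (gs i)) subrr mulr0.
Qed.

Lemma gs_proj_ip n x i : (i < n)%N -> ip (gs_proj n x) (gs i) = ip x (gs i).
Proof.
move=> ni; rewrite gs_projE ip_suml' (bigD1 (Ordinal ni))//= big1 => [|k ki].
  by rewrite addr0 ipZl gs_ipZ.
by rewrite ipZl gs_orth ?mulr0//; apply: contraNneq ki => e; apply/eqP/val_inj.
Qed.

Lemma gs_proj_ip_ge n x i : (n <= i)%N -> ip (gs_proj n x) (gs i) = 0.
Proof.
move=> ni; rewrite gs_projE ip_suml' big1// => k _.
by rewrite ipZl gs_orth ?mulr0// ltn_eqF// (leq_trans (ltn_ord k)).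
Qed.

Lemma gs_projB n x y : gs_proj n (x - y) = gs_proj n x - gs_proj n y.
Proof.
rewrite !gs_projE -sumrB; apply: eq_bigr => i _; rewrite -scalerBl.
by rewrite ipBl.
Qed.

Lemma gs_proj_pythagoras n x :
  `|x| ^+ 2 = `|x - gs_proj n x| ^+ 2 + `|gs_proj n x| ^+ 2.
Proof.
rewrite -[in LHS](subrK (gs_proj n x) x) [LHS]norm_add_sqr.
suff -> : ip (x - gs_proj n x) (gs_proj n x) = 0 by rewrite mulr0 addr0.
rewrite [X in ip _ X]gs_projE ip_sumr big1// => i _.
by rewrite ip_scaler ipBl gs_proj_ip// subrr mulr0.
Qed.

Lemma gs_proj_dist_le n x : `|x - gs_proj n x| <= `|x|.
Proof.
by rewrite -ler_sqr ?nnegrE// [leRHS](gs_proj_pythagoras n) lerDl sqr_ge0.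
Qed.

Lemma gs_proj_fix k n : (k < n)%N -> gs_proj n (d k) = d k.
Proof.
have base : gs_proj k.+1 (d k) = d k.
  have dk : d k = gs_proj k (d k) + `|d k - gs_proj k (d k)| *: gs k.
    by rewrite gsE normalizeK addrC subrK.
  rewrite gs_projS [in RHS]dk; congr (_ + _ *: _).
  rewrite {1}dk ip_addl gs_proj_ip_ge// add0r ipZl -(ip_normE ip).
  have [e|->] := gs01 k; last by rewrite expr1n mulr1.
  have -> : d k - gs_proj k (d k) = 0.
    by rewrite -[LHS]normalizeK -gsE e scaler0.
  by rewrite normr0 mul0r.
elim: n => // n IH; rewrite ltnS leq_eqVlt => /predU1P[<-//|kn].
rewrite gs_projS IH// -[X in ip X _]IH// gs_proj_ip_ge//.
by rewrite scale0r addr0.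
Qed.

(** The map [x - gs_proj n x] is a contraction that vanishes at [d k] for [k < n],
and some [d k] is close to [x]. *)
Lemma gs_proj_cvg x : (forall U, open U -> U !=set0 -> exists n, U (d n)) ->
  (fun n => gs_proj n x) @ \oo --> x.
Proof.
move=> dd; apply/cvgrPdist_le => e e0.
have [||k hk] := dd (ball x e); [exact: ball_open|by exists x; exact: ballxx|].
near=> n.
have kn : (k < n)%N by near: n; exact: nbhs_infty_gt.
have -> : x - gs_proj n x = (x - d k) - gs_proj n (x - d k).
  by rewrite gs_projB (gs_proj_fix kn) opprB addrA subrK.
apply: le_trans (gs_proj_dist_le _ _) _.
by move: hk; rewrite -ball_normE => /ltW.
Unshelve. all: by end_near. Qed.

End GramSchmidt.

(** The vectors [\sum_(i < n) l (b i) *: b i], for the Gram-Schmidt sequence [b],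
form a Cauchy sequence, because the bound on [l] makes the squares of the
coefficients summable; the limit represents [l] on the projections, hence on
[X]. *)
Lemma riesz (sepX : separable_space X) (l : X -> K) (C : K) : 0 <= C ->
  (forall x y, l (x + y) = l x + l y) -> (forall a x, l (a *: x) = a * l x) ->
  (forall x, `|l x| <= C * `|x|) -> exists g, forall x, l x = ip x g.
Proof.
move=> C0 lD lZ lC; have [d dd] := separable_seq sepX.
have l0 : l 0 = 0 by rewrite -(scale0r (0 : X)) lZ mul0r.
have lN x : l (- x) = - l x by rewrite -scaleN1r lZ mulN1r.
have lB x y : l (x - y) = l x - l y by rewrite lD lN.
pose b := gs d; pose s n := \sum_(i < n) l (b i) *: b i.
pose q n := \sum_(i < n) l (b i) ^+ 2.
have lsum n F : l (\sum_(i < n) F i) = \sum_(i < n) l (F i).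
  exact: (big_morph l lD l0).
have ls n x : ip x (s n) = l (gs_proj d n x).
  rewrite gs_projE lsum ip_sumr; apply: eq_bigr => i _.
  by rewrite ip_scaler lZ mulrC.
have sq n : l (s n) = q n.
  by rewrite lsum; apply: eq_bigr => i _; rewrite lZ.
have bsqr i : l (b i) ^+ 2 * `|b i| ^+ 2 = l (b i) ^+ 2.
  rewrite /b; have [->|->] := gs01 d i; first by rewrite l0 expr0n/= mul0r.
  by rewrite expr1n mulr1.
have sb n i : (n <= i)%N -> ip (s n) (b i) = 0.
  move=> ni; rewrite ip_suml' big1// => k _.
  by rewrite ipZl gs_orth ?mulr0// ltn_eqF// (leq_trans (ltn_ord k)).
have sS n : s n.+1 = s n + l (b n) *: b n by rewrite /s big_ord_recr.
have qS n : q n.+1 = q n + l (b n) ^+ 2 by rewrite /q big_ord_recr.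
have sdist m n : (m <= n)%N -> `|s n - s m| ^+ 2 = q n - q m.
  elim: n => [|n IH]; rewrite leq_eqVlt.
    by case/predU1P => [->|//]; rewrite !subrr normr0 expr0n.
  case/predU1P => [->|]; first by rewrite !subrr normr0 expr0n.
  rewrite ltnS => mn; rewrite sS qS addrAC norm_add_sqr IH// normrZ exprMn.
  rewrite real_normK ?num_real// bsqr ip_scaler ipBl (sb n n)// (sb m n)//.
  by rewrite subrr !mulr0 addr0 addrAC.
have s0 : s 0%N = 0 by rewrite /s big_ord0.
have q0 : q 0%N = 0 by rewrite /q big_ord0.
have sn n : `|s n| ^+ 2 = q n by rewrite -[in LHS](subr0 (s n)) -s0 sdist// q0 subr0.
have sC n : `|s n| <= C.
  have : `|s n| ^+ 2 <= C * `|s n|.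
    by rewrite sn -sq (le_trans (ler_norm _)).
  have [->//|sn0] := eqVneq `|s n| 0.
  by rewrite expr2 ler_pM2r// lt_def sn0 normr_ge0.
have qcvg : cvgn q.
  apply: nondecreasing_is_cvgn.
    apply/nondecreasing_seqP => n; rewrite /q big_ord_recr/= lerDl sqr_ge0//.
  exists (C ^+ 2) => _ [n _ <-]; rewrite -sn ler_sqr ?nnegrE//.
have scvg : cvgn s.
  apply/cauchy_cvgP/cauchyP => e e0.
  have /cvgrPdist_lt/(_ _ (exprn_gt0 2 e0))[N _ hN] := qcvg.
  exists (s N); exists N => // n /= Nn; rewrite -ball_normE /=.
  rewrite distrC -ltr_sqr ?nnegrE ?(ltW e0)// sdist//.
  apply: le_lt_trans (hN N (leqnn N)); rewrite ger0_norm ?lerD2r.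
    apply: nondecreasing_cvgn_le => //.
    by apply/nondecreasing_seqP => k; rewrite /q big_ord_recr/= lerDl sqr_ge0.
  rewrite subr_ge0; apply: nondecreasing_cvgn_le => //.
  by apply/nondecreasing_seqP => k; rewrite /q big_ord_recr/= lerDl sqr_ge0.
exists (limn s) => x.
have h1 : (fun n => ip (s n) x) @ \oo --> ip (limn s) x by exact: cvg_ip.
have h2 : (fun n => ip (s n) x) @ \oo --> l x.
  under eq_fun do rewrite ipC ls.
  apply/cvgrPdist_le => e e0.
  have d0 : 0 < e / (C + 1) by rewrite divr_gt0// ltr_wpDl.
  have /cvgrPdist_le/(_ _ d0) := gs_proj_cvg (x := x) dd.
  apply: filterS => n hn; rewrite -lB (le_trans (lC _))//.
  rewrite (@le_trans _ _ (C * (e / (C + 1))))// ?ler_wpM2l//.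
  rewrite mulrA ler_pdivrMr ?ltr_wpDl// mulrC ler_wpM2l ?lerDl//.
  exact: ltW.
by rewrite ipC -(cvg_lim _ h2)// -(cvg_lim _ h1).
Qed.

End Hilbert.

(** * Bounded Lipschitz functions and test functions *)

Section BoundedLipschitz.
Context (K : realType) (X : normedModType K).

Definition blip (Y : normedModType K) (M L : K) (g : X -> Y) :=
  (forall x, `|g x| <= M) /\ (forall x y, `|g x - g y| <= L * `|x - y|).

Section Target.
Context (Y : normedModType K).
Implicit Types (g : X -> Y).

Lemma blip_le M L M' L' g : M <= M' -> L <= L' -> blip M L g -> blip M' L' g.
Proof.
move=> MM LL [gM gL]; split=> [x|x y]; first exact: le_trans (gM x) MM.
by rewrite (le_trans (gL x y))// ler_wpM2r.
Qed.

Lemma blip_ge0 M L g : blip M L g -> 0 <= M.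
Proof. by move=> [gM _]; rewrite (le_trans _ (gM 0)). Qed.

Lemma boundedP T (V : normedModType K) (g : T -> V) (A : set T) :
  [bounded g x | x in A] <-> exists M, forall x, A x -> `|g x| <= M.
Proof.
split=> [[M [_ h]]|[M h]].
  by exists (M + 1) => x Ax; apply: (h (M + 1)) => //; rewrite ltrDl.
exists M; split=> [|N MN x Ax]; first exact: num_real.
exact: le_trans (h x Ax) (ltW MN).
Qed.

Lemma lipschitzP g : [lipschitz g x | x in setT] <->
  exists L, forall x y, `|g x - g y| <= L * `|x - y|.
Proof.
split=> [[M [_ h]]|[M h]].
  exists (M + 1) => x y; have /h : M < M + 1 by rewrite ltrDl.
  by move=> /(_ (x, y)); apply.
exists M; split=> [|N MN [x y] _ /=]; first exact: num_real.
by rewrite (le_trans (h x y))// ler_wpM2r// ltW.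
Qed.

Lemma blip_max M L g : blip M L g ->
  blip (Num.max 1 (Num.max M L)) (Num.max 1 (Num.max M L)) g.
Proof. by apply: blip_le; rewrite !le_max lexx ?orbT. Qed.

(** The support conditions in the definition of the test functions pass to the
closure, so they only need to be checked where the function does not vanish. *)
Lemma LipcP O g : Lipc O g <-> exists M r e, [/\ 0 < e, blip M M g,
    forall x, g x != 0 -> `|x| <= r &
    forall x y, g x != 0 -> ~ O y -> e <= `|x - y|].
Proof.
split.
  move=> [/boundedP[M gM] /lipschitzP[L gL] bs _ [e e0 ge]].
  have /(boundedP id)[r gr] := bs.
  exists (Num.max 1 (Num.max M L)), r, e; split => //.
  - by apply: blip_max; split=> // x; exact: gM.
  - by move=> x gx; apply: gr; exact: subset_closure.
  - by move=> x y gx; apply: ge; exact: subset_closure.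
move=> [M [r [e [e0 [gM gL] gr ge]]]].
have hd x y : closed_support g x -> ~ O y -> e <= `|x - y|.
  move=> sx Oy; apply/ler_addgt0Pr => d d0.
  have [z [/= gz]] := sx _ (nbhsx_ballx x d d0); rewrite -ball_normE/= => xz.
  apply: le_trans (ge _ _ gz Oy) _.
  have -> : z - y = (x - y) - (x - z) by rewrite opprB [RHS]addrC addrA subrK.
  by rewrite (le_trans (ler_normB _ _))// lerD2l ltW.
split=> //.
- by apply/boundedP; exists M.
- by apply/lipschitzP; exists M.
- apply/(boundedP id); exists (r + 1) => x sx.
  have [z [/= gz]] := sx _ (nbhsx_ballx x 1 ltr01); rewrite -ball_normE/= => xz.
  rewrite -(subrK z x) (le_trans (ler_normD _ _))// addrC lerD ?gr//.
  exact: ltW.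
- move=> x sx; apply: contrapT => Ox.
  by have := hd _ _ sx Ox; rewrite subrr normr0 leNgt e0.
- by exists e.
Qed.

Lemma Lipc_blip O g : Lipc O g -> exists2 M, 0 < M & blip M M g.
Proof.
move=> /LipcP[M [_ [_ [_ gM _ _]]]].
by exists (Num.max 1 (Num.max M M)); [rewrite lt_max ltr01|exact: blip_max].
Qed.

Lemma Lipc_notin O g x : Lipc O g -> ~ O x -> g x = 0.
Proof.
move=> [_ _ _ gO _] Ox; apply: contrapT => /eqP gx; apply: Ox; apply: gO.
exact: subset_closure.
Qed.

End Target.

(** Most operations on test functions keep them in the class because they do not
enlarge the set of nonzeros. *)
Lemma Lipc_dom (Y Z : normedModType K) O (f : X -> Z) (g : X -> Y) M :
  Lipc O f ->
  blip M M g -> (forall x, f x = 0 -> g x = 0) -> Lipc O g.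
Proof.
move=> /LipcP[N [r [e [e0 fN fr fe]]]] gM fg; apply/LipcP.
exists M, r, e; split=> // [x gx|x y gx].
  by apply: fr; apply: contra_neq gx; exact: fg.
by apply: fe; apply: contra_neq gx; exact: fg.
Qed.

Section Target.
Context (Y : normedModType K).
Implicit Types (g : X -> Y).

Lemma blipD M L M' L' g g' : blip M L g -> blip M' L' g' ->
  blip (M + M') (L + L') (fun x => g x + g' x).
Proof.
move=> [gM gL] [gM' gL']; split=> [x|x y].
  by rewrite (le_trans (ler_normD _ _))// lerD.
have -> : g x + g' x - (g y + g' y) = (g x - g y) + (g' x - g' y).
  by rewrite opprD addrACA.
by rewrite (le_trans (ler_normD _ _))// mulrDl lerD.
Qed.

Lemma LipcD O g g' : Lipc O g -> Lipc O g' -> Lipc O (fun x => g x + g' x).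
Proof.
move=> /LipcP[M [r [e [e0 gM gr ge]]]] /LipcP[M' [r' [e' [e0' gM' gr' ge']]]].
apply/LipcP; exists (M + M'), (Num.max r r'), (Num.min e e').
have or x : g x + g' x != 0 -> g x != 0 \/ g' x != 0.
  have [->|] := eqVneq (g x) 0; last by left.
  by rewrite add0r; right.
split; rewrite ?lt_min ?e0//; first exact: blipD.
  by move=> x /or[/gr|/gr']; rewrite le_max => ->; rewrite ?orbT.
by move=> x y /or[/ge h|/ge' h] /h; rewrite ge_min => ->; rewrite ?orbT.
Qed.

Lemma Lipc0 O : Lipc O (fun _ : X => 0 : Y).
Proof.
apply/LipcP; exists 0, 0, 1; split=> //; last by move=> ? ?; rewrite eqxx.
  by split=> [x|x y]; rewrite ?subrr normr0 ?mul0r.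
by move=> ?; rewrite eqxx.
Qed.

Lemma blip_cst (c : Y) : blip `|c| 0 (fun _ : X => c).
Proof. by split=> // x y; rewrite subrr normr0 mul0r. Qed.

End Target.

Lemma blipZ (Y : normedModType K) M L M' L' (f : X -> K) (g : X -> Y) :
  blip M L f -> blip M' L' g ->
  blip (M * M') (M * L' + L * M') (fun x => f x *: g x).
Proof.
move=> fb gb; have M0 := blip_ge0 fb; have M'0 := blip_ge0 gb.
move: fb gb => [fM fL] [gM gL]; split=> [x|x y].
  by rewrite normrZ ler_pM.
have -> : f x *: g x - f y *: g y = f x *: (g x - g y) + (f x - f y) *: g y.
  by rewrite scalerBr scalerBl addrA subrK.
rewrite (le_trans (ler_normD _ _))// mulrDl !normrZ; apply: lerD.
  by rewrite -mulrA ler_pM.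
by rewrite mulrAC ler_pM.
Qed.

Lemma blipM M L M' L' (f g : X -> K) : blip M L f -> blip M' L' g ->
  blip (M * M') (M * L' + L * M') (fun x => f x * g x).
Proof. exact: (@blipZ K^o). Qed.

Lemma LipcMr O M L (f g : X -> K) : Lipc O f -> blip M L g ->
  Lipc O (fun x => f x * g x).
Proof.
move=> fO gM; have [N _ fN] := Lipc_blip fO.
by apply: (Lipc_dom fO (blip_max (blipM fN gM))) => x ->; rewrite mul0r.
Qed.

Lemma LipcZ (Y : normedModType K) O (f : X -> Y) a : Lipc O f ->
  Lipc O (fun x => a *: f x).
Proof.
move=> fO; have [N _ fN] := Lipc_blip fO.
apply: (Lipc_dom fO (blip_max (blipZ (blip_cst (a : K^o)) fN))) => x ->.
by rewrite scaler0.
Qed.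

Lemma LipcMl O a (f : X -> K) : Lipc O f -> Lipc O (fun x => a * f x).
Proof. exact: (@LipcZ K^o). Qed.

Lemma Lipc_sum (Y : normedModType K) O I (s : seq I) (F : I -> X -> Y) :
  (forall i, Lipc O (F i)) -> Lipc O (fun x => \sum_(i <- s) F i x).
Proof.
move=> FO; elim: s => [|i s IH].
  by under eq_fun do rewrite big_nil; exact: Lipc0.
by under eq_fun do rewrite big_cons; exact: LipcD.
Qed.

Definition clamp (t : K) := Num.min 1 (Num.max 0 t).

Lemma clamp_ge0 t : 0 <= clamp t. Proof. by rewrite le_min ler01 le_max lexx. Qed.

Lemma clamp_le1 t : clamp t <= 1. Proof. by rewrite ge_min lexx. Qed.

Lemma clamp_eq1 t : 1 <= t -> clamp t = 1.
Proof. by move=> t1; apply/min_idPl; rewrite le_max t1 orbT. Qed.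

Lemma clamp_eq0 t : t <= 0 -> clamp t = 0.
Proof. by move=> t0; rewrite /clamp (max_idPl t0); apply/min_idPr. Qed.

Lemma clamp_le t : 0 <= t -> clamp t <= t.
Proof. by move=> t0; rewrite /clamp (max_idPr t0) ge_min lexx orbT. Qed.

Lemma clamp_lip s t : `|clamp s - clamp t| <= `|s - t|.
Proof.
wlog st : s t / t <= s.
  move=> H; case: (leP t s) => [|/ltW]; first exact: H.
  by move=> ?; rewrite distrC (distrC s); exact: H.
rewrite (ger0_norm (_ : 0 <= s - t)) ?subr_ge0// ler_norml.
rewrite /clamp !minEle !maxEle.
by repeat case: ifPn; rewrite -?ltNge => *; apply/andP; split; lra.
Qed.

Lemma blip_clamp M L a b (f : X -> K) : blip M L f ->
  blip 1 (`|a| * L) (fun x => clamp (a * f x + b)).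
Proof.
move=> [fM fL]; split=> [x|x y].
  by rewrite ger0_norm ?clamp_ge0 ?clamp_le1.
rewrite (le_trans (clamp_lip _ _))// opprD addrACA subrr addr0 -mulrBr.
by rewrite normrM -mulrA ler_wpM2l.
Qed.

(** Distance to a set, truncated at 1 so that it is bounded, and equal to 1 for
the empty set. *)
Definition capdist (A : set X) x := inf ([set 1] `|` [set `|x - y| | y in A]).

Section Capdist.
Context (A : set X).

Let has_lb x : has_lbound ([set 1] `|` [set `|x - y| | y in A] : set K).
Proof. by exists 0 => _ [->|[y _ <-]]. Qed.

Lemma capdist_ge0 x : 0 <= capdist A x.
Proof. by apply: lb_le_inf; [exists 1; left|move=> _ [->|[y _ <-]]]. Qed.

Lemma capdist_le1 x : capdist A x <= 1.
Proof. by apply: ge_inf => //; left. Qed.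

Lemma capdist_le x y : A y -> capdist A x <= `|x - y|.
Proof. by move=> Ay; apply: ge_inf => //; right; exists y. Qed.

Lemma capdist_ge x r : r <= 1 -> (forall y, A y -> r <= `|x - y|) ->
  r <= capdist A x.
Proof.
by move=> r1 rA; apply: lb_le_inf; [exists 1; left|move=> _ [->//|[y /rA ? <-]]].
Qed.

Lemma capdist_ltP x r : r <= 1 -> capdist A x < r ->
  exists2 y, A y & `|x - y| < r.
Proof.
move=> r1 xr; apply: contrapT => nA; move: xr; apply/negP; rewrite -leNgt.
apply: capdist_ge => // y Ay; rewrite leNgt; apply/negP => yr.
by apply: nA; exists y.
Qed.

Lemma capdist_eq0 x : A x -> capdist A x = 0.
Proof.
move=> Ax; apply/eqP; rewrite eq_le capdist_ge0 andbT.
by rewrite (le_trans (capdist_le x Ax))// subrr normr0.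
Qed.

Lemma capdist_blip : blip 1 1 (capdist A).
Proof.
have lip x y : capdist A x - capdist A y <= `|x - y|.
  rewrite lerBlDr -lerBlDl; apply: lb_le_inf; first by exists 1; left.
  move=> _ [->|[z Az <-]]; rewrite lerBlDl.
    by rewrite (le_trans (capdist_le1 x))// lerDr.
  rewrite (le_trans (capdist_le x Az))//.
  have -> : x - z = (x - y) + (y - z) by rewrite addrA subrK.
  exact: ler_normD.
split=> [x|x y]; first by rewrite ger0_norm ?capdist_ge0 ?capdist_le1.
rewrite mul1r ler_norml lip andbT lerNl opprB distrC; exact: lip.
Qed.

Lemma capdist_gt0 x : open (~` A) -> ~ A x -> 0 < capdist A x.
Proof.
move=> oA Ax; have /nbhs_ballP[r /= r0 rA] := open_nbhs_nbhs (conj oA Ax).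
rewrite (@lt_le_trans _ _ (Num.min 1 r)) ?lt_min ?ltr01//.
apply: capdist_ge => [|y Ay]; first by rewrite ge_min lexx.
rewrite ge_min; apply/orP; right; rewrite leNgt; apply/negP => xyr.
by apply: (rA y) => //; rewrite -ball_normE.
Qed.

End Capdist.

Lemma blip_continuous (Y : normedModType K) M L (g : X -> Y) : blip M L g -> continuous g.
Proof.
move=> [_ gL] x; apply/cvgrPdist_le => e e0.
have L0 : 0 < Num.max 1 L by rewrite lt_max ltr01.
near=> y; rewrite (le_trans (gL _ _))//.
rewrite (@le_trans _ _ (Num.max 1 L * `|x - y|)) ?ler_wpM2r ?le_max ?lexx ?orbT//.
rewrite -ler_pdivlMl//; near: y; apply: cvgr_dist_le => //.
by rewrite mulr_gt0// invr_gt0.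
Unshelve. all: by end_near. Qed.

(** The first factor keeps the supports away from the complement of [O], and the
second one keeps them bounded. *)
Lemma Lipc_cutoff (O : set X) : open O -> exists chi : nat -> X -> K,
  [/\ forall n, Lipc O (chi n), forall n x, 0 <= chi n x <= 1 &
      forall x, O x -> (chi ^~ x) @ \oo --> (1 : K)].
Proof.
move=> oO; pose u := capdist (~` O).
pose c1 n (x : X) := clamp (n%:R * u x - 1).
pose c2 n (x : X) := clamp (- 1 * clamp (1 * `|x| - n%:R) + 1).
have b2 n : blip 1 1 (c2 n).
  suff: blip 1 (`|- 1| * 1) (c2 n) by rewrite normrN1 mulr1.
  apply: (@blip_clamp 1 1 (-1) 1); split=> [x|x y].
    by rewrite ger0_norm ?clamp_ge0 ?clamp_le1.
  rewrite !mul1r (le_trans (clamp_lip _ _))// opprB addrA subrK.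
  exact: ler_dist_dist.
have b1 n : blip 1 (`|n%:R| * 1) (c1 n) by apply: blip_clamp; exact: capdist_blip.
exists (fun n x => c1 n x * c2 n x); split.
- move=> n; apply/LipcP.
  have := blip_max (blipM (b1 n) (b2 n)); set M := Num.max _ _ => bM.
  exists M, (n%:R + 1), n.+1%:R^-1; split=> // [x|x y].
  + apply: contraNT; rewrite -ltNge => xn; rewrite mulf_eq0; apply/orP; right.
    apply/eqP/clamp_eq0; rewrite [clamp _]clamp_eq1 ?mulN1r ?addNr// mul1r.
    by rewrite lerBrDl ltW.
  + move=> c0 Oy; rewrite leNgt; apply: contraNN c0 => xy.
    rewrite mulf_eq0; apply/orP; left; apply/eqP/clamp_eq0.
    rewrite subr_le0 (@le_trans _ _ (n%:R / n.+1%:R))//.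
      rewrite ler_wpM2l// (le_trans (capdist_le _ (Oy : (~` O) y)))//.
      exact: ltW.
    by rewrite ler_pdivrMr// mul1r ler_nat.
- move=> n x; rewrite mulr_ge0 ?clamp_ge0//=.
  by rewrite mulr_ile1 ?clamp_ge0 ?clamp_le1.
- move=> x Ox; have u0 : 0 < u x.
    by apply: capdist_gt0; rewrite ?setCK//; exact.
  apply: cvg_near_cst; near=> n.
  have h1 : c1 n x = 1.
    apply: clamp_eq1; rewrite lerBrDr -ler_pdivrMr//.
    by near: n; exact: nbhs_infty_ger.
  have h2 : c2 n x = 1.
    apply: clamp_eq1; rewrite [clamp _]clamp_eq0 ?mulr0 ?add0r// mul1r subr_le0.
    by near: n; exact: nbhs_infty_ger.
  by rewrite h1 h2 mulr1.
Unshelve. all: by end_near. Qed.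

End BoundedLipschitz.

(** * Mass of linear functionals continuous along uniformly Lipschitz sequences *)

Section PositivePart.
Context (K : realType) (X : completeNormedModType K) (O : set X).
Implicit Types (T : (X -> K) -> K) (phi psi : X -> K).

(** The last condition makes up for the missing local compactness: linearity and
boundedness alone do not produce countably additive measures. *)
Definition lip_functional T C := [/\
  forall phi psi, Lipc O phi -> Lipc O psi ->
    T (fun x => phi x + psi x) = T phi + T psi,
  forall a phi, Lipc O phi -> T (fun x => a * phi x) = a * T phi,
  forall phi, Lipc O phi -> (forall x, 0 <= phi x <= 1) -> T phi <= C &
  forall L (phi : nat -> X -> K), (forall n, Lipc O (phi n)) ->
    (forall n, blip L L (phi n)) -> (forall x, phi ^~ x @ \oo --> 0) ->
    (fun n => T (phi n)) @ \oo --> 0].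

Definition unit_test phi := Lipc O phi /\ forall x, 0 <= phi x <= 1.

Context (sepX : separable_space X) (T : (X -> K) -> K) (C : K).
Hypothesis Tlip : lip_functional T C.

Lemma lipfD phi psi : Lipc O phi -> Lipc O psi ->
  T (fun x => phi x + psi x) = T phi + T psi.
Proof. by have [+ _ _ _] := Tlip; apply. Qed.

Lemma lipfZ a phi : Lipc O phi -> T (fun x => a * phi x) = a * T phi.
Proof. by have [_ + _ _] := Tlip; apply. Qed.

Lemma lipfC phi : unit_test phi -> T phi <= C.
Proof. by move=> [p1 p2]; have [_ _ + _] := Tlip; apply. Qed.

Lemma lipfB phi psi : Lipc O phi -> Lipc O psi ->
  T (fun x => phi x - psi x) = T phi - T psi.
Proof.
move=> p q; rewrite -[X in _ = _ + X]mulN1r -lipfZ// -lipfD//; last exact: LipcMl.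
by congr T; apply/funext => x; rewrite mulN1r.
Qed.

Lemma lipf0 : T (fun=> 0) = 0.
Proof.
have := lipfZ 0 (Lipc0 _ O : Lipc O (fun _ : X => 0 : K)); rewrite [RHS]mul0r => h; rewrite -[RHS]h.
by congr T; apply/funext => x; rewrite mul0r.
Qed.

Lemma unit_test0 : unit_test (fun=> 0).
Proof. by split; [exact: Lipc0|move=> x; rewrite lexx ler01]. Qed.

(** Adding the unused room [1 - g] of a nearly optimal [psi] keeps a function
below [g] in the order interval [0, 1]; optimality of [psi] bounds what the
function below [g] can contribute. *)
Lemma tight_along (L : K) (g : nat -> X -> K) : (forall n x, 0 <= g n x <= 1) ->
  (forall n, blip 1 L (g n)) -> (forall x, g ^~ x @ \oo --> 0) ->
  forall e, 0 < e -> exists N, forall phi, Lipc O phi ->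
    (forall x, 0 <= phi x <= g N x) -> T phi <= e.
Proof.
move=> g01 gL gto0 e e0.
have hs : has_sup [set T phi | phi in unit_test].
  by split; [exists (T (fun=> 0)), (fun=> 0) => //; exact: unit_test0|
    exists C => _ [phi up <-]; exact: lipfC].
have e2 : 0 < e / 2 by rewrite divr_gt0.
have [_ [psi [psiO psi01] <-] Mpsi] := sup_adherent e2 hs.
have [M M0 psiM] := Lipc_blip psiO.
have [N _ hN] : \forall n \near \oo, `|T (fun x => psi x * g n x)| <= e / 2.
  have [_ _ _ Tc] := Tlip.
  have := Tc (Num.max 1 (Num.max (M * 1) (M * L + M * 1)))
             (fun n x => psi x * g n x).
  have h1 n : Lipc O (fun x => psi x * g n x) by exact: LipcMr psiO (gL n).
  have h2 n := blip_max (blipM psiM (gL n)).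
  have h3 x : (fun n => psi x * g n x) @ \oo --> 0.
    by rewrite -(mulr0 (psi x)); apply: cvgM; [exact: cvg_cst|exact: gto0].
  move=> /(_ h1 h2 h3) /cvgrPdist_le/(_ _ e2); apply: filterS => n.
  by rewrite sub0r normrN.
exists N => phi phiO phig.
have /ler_normlP[_ hNN] := hN N (leqnn N).
have psig : Lipc O (fun x => psi x * g N x) by exact: LipcMr psiO (gL N).
have psid : Lipc O (fun x => psi x - psi x * g N x).
  rewrite (_ : (fun _ => _) = (fun x => psi x + -1 * (psi x * g N x))).
    by apply: LipcD => //; exact: LipcMl.
  by apply/funext => x; rewrite mulN1r.
have : T (fun x => phi x + (psi x - psi x * g N x)) <=
       sup [set T phi | phi in unit_test].
  apply: ub_le_sup; first by case: hs.
  eexists; last reflexivity.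
  split=> [|x]; first exact: LipcD.
  have /andP[p0 p1] := psi01 x; have /andP[q0 q1] := g01 N x.
  have /andP[r0 r1] := phig x; apply/andP; split; nra.
rewrite lipfD// lipfB// => h; move: Mpsi hNN h; lra.
Qed.

(** Writing [phi] as the telescoping sum of the products
[phi * chi k * \prod_(j < k) (1 - chi j)] plus a remainder that vanishes where
some [chi k] is 1. *)
Lemma peel (chi : nat -> X -> K) (L a : nat -> K) phi N : unit_test phi ->
  (forall k, blip 1 (L k) (chi k)) -> (forall k x, 0 <= chi k x <= 1) ->
  (forall k psi, (k < N)%N -> Lipc O psi -> (forall x, 0 <= psi x <= phi x) ->
    (forall x, psi x <= chi k x) -> T psi <= a k) ->
  exists psi, [/\ Lipc O psi, forall x, 0 <= psi x <= phi x,
    forall x k, (k < N)%N -> chi k x = 1 -> psi x = 0 &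
    T phi <= \sum_(k < N) a k + T psi].
Proof.
move=> [phiO phi01] chiL chi01; elim: N => [|N IH] ha.
  exists phi; split => //; last by rewrite big_ord0 add0r.
  by move=> x; have /andP[-> _] := phi01 x; rewrite lexx.
have [|psi [psiO psiphi psi0 Tpsi]] := IH; first by move=> k q kN; apply: ha; rewrite (ltn_trans kN).
have qO : Lipc O (fun x => psi x * chi N x) by exact: LipcMr psiO (chiL N).
exists (fun x => psi x - psi x * chi N x); split.
- rewrite (_ : (fun _ => _) = (fun x => psi x + -1 * (psi x * chi N x))).
    by apply: LipcD => //; exact: LipcMl.
  by apply/funext => x; rewrite mulN1r.
- move=> x; have /andP[p0 p1] := psiphi x; have /andP[q0 q1] := chi01 N x.
  by apply/andP; split; nra.
- move=> x k; rewrite ltnS leq_eqVlt => /predU1P[->|kN] h.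
    by rewrite h mulr1 subrr.
  by rewrite (psi0 x k)// mul0r subrr.
- rewrite big_ord_recr/= lipfB//.
  suff : T (fun x => psi x * chi N x) <= a N by move=> h; move: Tpsi h; lra.
  apply: ha => //.
    move=> x; have /andP[p0 p1] := psiphi x; have /andP[q0 q1] := chi01 N x.
    by apply/andP; split; nra.
  move=> x; have /andP[p0 p1] := psiphi x; have /andP[q0 q1] := chi01 N x.
  have /andP[_ r1] := phi01 x; nra.
Qed.

Lemma geom_half_sum (e : K) N : 0 <= e ->
  \sum_(k < N) e / (2 ^ k.+1)%:R <= e.
Proof.
move=> e0; suff -> : \sum_(k < N) e / (2 ^ k.+1)%:R = e - e / (2 ^ N)%:R.
  by rewrite gerBl divr_ge0.
elim: N => [|N IH]; first by rewrite big_ord0 expn0 divr1 subrr.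
rewrite big_ord_recr/= IH expnS natrM.
have : (2 ^ N)%:R != 0 :> K by rewrite pnatr_eq0 expn_eq0.
by move=> ?; field.
Qed.

(** The points of [S] at distance at most [1/(j+2)] of [A j] for all [j] form a
compact set, because [X] is complete. An open cover of it has a finite subcover
and a Lebesgue number, and these already serve if only finitely many [j] are
prescribed. *)
Lemma ball_nets_exhaust (A : nat -> set X) (S : set X) (U : nat -> set X) :
  closed S -> (forall j, finite_set (A j)) -> (forall k, open (U k)) ->
  S `<=` \bigcup_k U k ->
  exists N, forall x, S x ->
    (forall j, (j < N)%N -> capdist (A j) x <= j.+2%:R^-1) ->
    exists2 k, (k < N)%N & N.+1%:R^-1 <= capdist (~` U k) x.
Proof.
move=> cS finA oU SU; apply: contrapT => nex.
have {nex} /choice[y hy] : forall N, exists x, [/\ S x,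
    forall j, (j < N)%N -> capdist (A j) x <= j.+2%:R^-1 &
    forall k, (k < N)%N -> capdist (~` U k) x < N.+1%:R^-1].
  move=> N; apply: contrapT => nx; apply: nex; exists N => x Sx hx.
  apply: contrapT => nk; apply: nx; exists x; split=> // k kN.
  by rewrite ltNge; apply/negP => h; apply: nk; exists k.
have [G [ultraG ooG]] := ultraFilterLemma (eventually_filter : ProperFilter \oo).
have PG : ProperFilter G by exact: ultra_proper.
have FG : Filter G by exact: filter_filter.
have ge_G n : G [set m | (n <= m)%N] by apply: ooG; exists n.
have cauchyG : cauchy (y @ G).
  apply/cauchyP => e e0.
  have [j hj] : exists j, 2 * j.+2%:R^-1 < e :> K.
    have [j _ hj] := near_infty_natSinv_lt (PosNum (divr_gt0 e0 (ltr0n K 2))).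
    exists j; rewrite mulrC -ltr_pdivlMr//.
    apply: le_lt_trans (hj j (leqnn j)); rewrite lef_pV2 ?posrE//.
    by rewrite ler_nat.
  apply: contrapT => nball.
  have noball x : A j x -> G [set n | ~ ball x e (y n)].
    move=> Ax; have [Gb|//] := in_ultra_setVsetC [set n | ball x e (y n)] ultraG.
    by exfalso; apply: nball; exists x.
  have /finite_seqP[s As] := finA j.
  have Gs : G [set n | forall x, x \in s -> ~ ball x e (y n)].
    have : forall x, x \in s -> G [set n | ~ ball x e (y n)].
      by move=> x xs; apply: noball; rewrite As.
    elim: s {As} => [|x s IH] h; first by apply: filterE => n x.
    have h1 := h x (mem_head _ _).
    have h2 := IH (fun z zs => h z (mem_behead (s := x :: s) zs)).
    apply: filterS2 h1 h2 => n n1 n2 z; rewrite inE => /predU1P[->//|].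
    exact: n2.
  have [n [nos jn]] := filter_ex (filterI Gs (ge_G j.+1)).
  have [_ hA _] := hy n.
  have [||x Ax yx] := @capdist_ltP _ _ (A j) (y n) (Num.min 1 e).
  - by rewrite ge_min lexx.
  - apply: (le_lt_trans (hA j jn)).
    rewrite lt_min invf_lt1 ?posrE// ltr1n/=; apply: le_lt_trans hj.
    by rewrite ler_peMl// ler1n.
  - apply: (nos x); first by move: Ax; rewrite As.
    by rewrite -ball_normE /= distrC (lt_le_trans yx)// ge_min lexx orbT.
have /cvg_ex[l yl] : cvg (y @ G) by exact: cauchy_cvg.
have Sl : S l.
  apply: (@closed_cvg _ _ G PG y S cS _ l yl).
  by apply: filterE => n; have [] := hy n.
have [k _ Ukl] := SU l Sl.
have u0 : 0 < capdist (~` U k) l.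
  by apply: capdist_gt0; rewrite ?setCK//; exact.
have cu : (capdist (~` U k) \o y) @ G --> capdist (~` U k) l.
  apply: continuous_cvg => //.
  exact: (blip_continuous (capdist_blip (~` U k))).
have hcu : G [set n | capdist (~` U k) l / 2 < capdist (~` U k) (y n)].
  have := cvgr_gt _ cu; apply.
  by rewrite ltr_pdivrMr// mulr_natr mulr2n ltrDl.
have [j hj] : exists j, j.+1%:R^-1 < capdist (~` U k) l / 2.
  have := near_infty_natSinv_lt (PosNum (divr_gt0 u0 (ltr0n K 2))).
  by move=> [j _ hj]; exists j; exact: (hj j (leqnn j)).
have [n [h1 [/= jn kn]]] := filter_ex (filterI hcu (filterI (ge_G j) (ge_G k.+1))).
have [_ _ /(_ k kn)] := hy n.
apply/negP; rewrite -leNgt; apply: ltW; apply: lt_trans h1; apply: le_lt_trans hj.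
by rewrite lef_pV2 ?posrE// ler_nat.
Qed.

(** Countable subadditivity of the mass of [T] over open sets: outside nets of
small balls the mass is small by [tight_along], and on the nets finitely many
of the open sets suffice by [ball_nets_exhaust]. *)
Lemma countable_subadd (U : nat -> set X) (a : nat -> K) phi e :
  (forall k, open (U k)) -> unit_test phi ->
  closed_support phi `<=` \bigcup_k U k ->
  (forall k psi, unit_test psi -> closed_support psi `<=` U k -> T psi <= a k) ->
  0 < e -> exists N, T phi <= \sum_(k < N) a k + e.
Proof.
move=> oU [phiO phi01] phiU Ta e0.
have [d dd] := separable_seq sepX.
pose A n : set X := d @` `I_n.
pose g j n x := clamp (j.+2%:R * capdist (A n) x + 0).
have g01 j n x : 0 <= g j n x <= 1 by rewrite clamp_ge0 clamp_le1.
have gL j n : blip 1 (`|j.+2%:R| * 1) (g j n).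
  by apply: blip_clamp; exact: capdist_blip.
have gto0 j x : (g j) ^~ x @ \oo --> 0.
  apply/cvgrPdist_le => r r0.
  have [||i hi] := dd (ball x (r / j.+2%:R)); [exact: ball_open|
    by exists x; apply: ballxx; rewrite divr_gt0|].
  near=> n.
  rewrite sub0r normrN ger0_norm ?clamp_ge0//.
  have t0 : 0 <= j.+2%:R * capdist (A n) x + 0.
    by rewrite addr0 mulr_ge0 ?capdist_ge0.
  apply: (@le_trans _ _ (j.+2%:R * capdist (A n) x)).
    by rewrite (le_trans (clamp_le t0))// addr0.
  rewrite mulrC -ler_pdivlMr// (@le_trans _ _ `|x - d i|)//.
    apply: capdist_le; exists i => //=.
    by near: n; exact: nbhs_infty_gt.
  by move: hi; rewrite -ball_normE /= => /ltW.
have ej j : 0 < e / (2 ^ j.+1)%:R by rewrite divr_gt0// ltr0n expn_gt0.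
have /choice[n hn] := fun j => tight_along (g01 j) (gL j) (gto0 j) (ej j).
have [||||N hN] := @ball_nets_exhaust (fun j => A (n j)) (closed_support phi) U.
- exact: closed_closure.
- by move=> j; apply: finite_image; exact: finite_II.
- exact: oU.
- exact: phiU.
have [||||psi [psiO psiphi psi0 Tpsi]] := @peel (fun j => g j (n j))
    (fun j => `|j.+2%:R| * 1) (fun j => e / (2 ^ j.+1)%:R) phi N.
- by split.
- by [].
- by [].
- move=> k psi kN psiO psiphi psig; apply: hn => // x.
  by have /andP[-> _] := psiphi x; exact: psig.
(* [c k] vanishes near the complement of [U k], and it is 1 at distance at least
[1/(N+1)] of this complement. *)
pose c k x := clamp (2 * N.+1%:R * capdist (~` U k) x + (- 1)).
have [||||xi [xiO xipsi xi0 Txi]] := @peel c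
    (fun k => `|2 * N.+1%:R| * 1) a psi N.
- split=> // x; have /andP[-> h] := psiphi x.
  by have /andP[_ h'] := phi01 x; exact: le_trans h h'.
- by move=> k; apply: blip_clamp; exact: capdist_blip.
- by move=> k x; rewrite clamp_ge0 clamp_le1.
- move=> k q kN qO qpsi qc; apply: Ta.
    split=> // x; have /andP[-> h] := qpsi x; have /andP[_ h'] := psiphi x.
    by have /andP[_ h''] := phi01 x; exact: le_trans h (le_trans h' h'').
  move=> x qx; apply: contrapT => Ux.
  have [z [/= qz]] := qx _ (nbhsx_ballx x (2 * N.+1%:R)^-1 (ltac:(by rewrite invr_gt0 mulr_gt0))).
  rewrite -ball_normE /= => xz; move: qz; apply/negP; rewrite negbK.
  rewrite eq_le; have /andP[-> _] := qpsi z; rewrite andbT.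
  rewrite (le_trans (qc z))// /c clamp_eq0// subr_le0 mulrC -ler_pdivlMr ?mulr_gt0//.
  rewrite div1r (le_trans (capdist_le _ (Ux : (~` U k) x)))// distrC.
  exact: ltW.
have xi_eq0 : xi = fun=> 0.
  apply/funext => x; apply: contrapT => /eqP xix.
  have psix : psi x != 0.
    have /andP[h1 h2] := xipsi x.
    by rewrite gt_eqF// (lt_le_trans _ h2)// lt_def xix.
  have phix : phi x != 0.
    have /andP[h1 h2] := psiphi x.
    by rewrite gt_eqF// (lt_le_trans _ h2)// lt_def psix.
  have [||k kN hk] := hN x; first exact: subset_closure.
    move=> j jN; rewrite leNgt; apply: contra_neqN psix => hj.
    apply: (psi0 x j jN); apply: clamp_eq1; rewrite addr0 mulrC -ler_pdivrMr//.
    by rewrite div1r ltW.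
  move: xix; rewrite (xi0 x k kN) ?eqxx//; apply: clamp_eq1.
  have : 1 <= N.+1%:R * capdist (~` U k) x.
    by rewrite mulrC -ler_pdivrMr// div1r.
  by move=> h; rewrite -mulrA; lra.
exists N; rewrite (le_trans Tpsi)// addrC; apply: lerD.
  by rewrite (le_trans Txi)// xi_eq0 lipf0 addr0.
exact: geom_half_sum (ltW e0).
Unshelve. all: by end_near. Qed.

End PositivePart.

(** * The measure carried by the positive part of a functional *)

Section BorelIntegral.
Context (K : realType) (X : completeNormedModType K).

Lemma continuous_borel (g : X -> K) : continuous g ->
  measurable_fun [set: borel X] (g : borel X -> K).
Proof.
move=> cg; apply: (measurability (@RGenOInfty.G K)).
  exact: RGenOInfty.measurableE.
move=> _ [_ [a ->] <-]; rewrite setTI; apply: open_borel.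
by apply: open_comp => // x _; exact: cg.
Qed.

Lemma blip_measurable M L (g : X -> K) : blip M L g ->
  measurable_fun [set: borel X] (g : borel X -> K).
Proof. by move=> /blip_continuous/continuous_borel. Qed.

End BorelIntegral.

Section RintegralTools.
Context d (S : measurableType d) (K : realType) (m : {finite_measure set S -> \bar K}).

Lemma finite_bounded_integrable (g : S -> K) M : measurable_fun setT g ->
  (forall x, `|g x| <= M) -> m.-integrable setT (EFin \o g).
Proof.
move=> mg gM; apply: measurable_bounded_integrable => //.
  by rewrite -ge0_fin_numE// fin_num_measure.
by apply/(boundedP (V := K)); exists M.
Qed.

Lemma Rintegral_sum I (s : seq I) (F : I -> S -> K) :
  (forall i, m.-integrable setT (EFin \o F i)) ->
  \int[m]_x (\sum_(i <- s) F i x) = \sum_(i <- s) \int[m]_x F i x.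
Proof.
move=> iF; elim: s => [|i s IH].
  rewrite big_nil; under eq_Rintegral do rewrite big_nil.
  by rewrite /Rintegral integral0.
rewrite big_cons -IH -RintegralD//.
  by apply: eq_Rintegral => x _; rewrite big_cons.
have -> : EFin \o (fun x => \sum_(j <- s) F j x) =
          (fun x => \sum_(j <- s) (EFin \o F j) x)%E.
  by apply/funext => x /=; rewrite sumEFin.
by apply: integrable_sum => // j _; exact: iF.
Qed.

Lemma Rintegral_indic (U : set S) : measurable U ->
  \int[m]_x \1_U x = fine (m U).
Proof. by move=> mU; rewrite /Rintegral integral_indic// setIT. Qed.

Lemma measure_le_Rintegral (U : set S) (g : S -> K) : measurable U ->
  m.-integrable setT (EFin \o g) -> (forall x, 0 <= g x) ->
  (forall x, U x -> g x = 1) -> fine (m U) <= \int[m]_x g x.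
Proof.
move=> mU ig g0 g1; rewrite -Rintegral_indic//; apply: le_Rintegral => //.
  by apply: (@finite_bounded_integrable _ 1) => // x; rewrite indicE; case: (_ \in _);
    rewrite ?normr1 ?normr0.
by move=> x _; rewrite indicE; case: (boolP (x \in U)) => [/set_mem/g1 ->|].
Qed.

Lemma Rintegral_le_measure (U : set S) (g : S -> K) : measurable U ->
  m.-integrable setT (EFin \o g) -> (forall x, g x <= 1) ->
  (forall x, ~ U x -> g x = 0) -> \int[m]_x g x <= fine (m U).
Proof.
move=> mU ig g1 g0; rewrite -Rintegral_indic//; apply: le_Rintegral => //.
  by apply: (@finite_bounded_integrable _ 1) => // x; rewrite indicE; case: (_ \in _);
    rewrite ?normr1 ?normr0.
move=> x _; rewrite indicE; case: (boolP (x \in U)) => [_|].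
  exact: g1.
by rewrite notin_setE => /g0 ->.
Qed.

End RintegralTools.

Section MassMeasure.
Context (K : realType) (X : completeNormedModType K) (O : set X).
Context (sepX : separable_space X) (T : (X -> K) -> K) (C : K).
Hypothesis Tlip : lip_functional O T C.
Implicit Types (phi psi g : X -> K) (U : set X).

Definition test_in U phi := unit_test O phi /\ closed_support phi `<=` U.

(** As [psi] ranges over the test functions with [0 <= psi <= 1] and support in
[U], the supremum of [T psi] is the mass that the positive part of [T] gives to
[U]. *)
Definition open_mass U := sup [set T phi | phi in test_in U].

Lemma test_in0 U : test_in U (fun=> 0).
Proof.
split; first exact: unit_test0.
move=> x sx; have [y [/=]] := sx setT filterT.
by rewrite eqxx.
Qed.

Let has_sup_mass U : has_sup [set T phi | phi in test_in U].
Proof.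
split; first by exists (T (fun=> 0)), (fun=> 0) => //; exact: test_in0.
by exists C => _ [phi [up _] <-]; exact: (lipfC Tlip).
Qed.

Lemma open_mass_ub U phi : test_in U phi -> T phi <= open_mass U.
Proof. by move=> h; apply: ub_le_sup; [have [] := has_sup_mass U|exists phi]. Qed.

Lemma open_mass_le U c : (forall phi, test_in U phi -> T phi <= c) ->
  open_mass U <= c.
Proof.
move=> h; apply: ge_sup; first by have [] := has_sup_mass U.
by move=> _ [phi /h ? <-].
Qed.

Lemma open_mass_adherent U e : 0 < e ->
  exists2 phi, test_in U phi & open_mass U - e < T phi.
Proof.
move=> e0; have [_ [phi hphi <-] h] := sup_adherent e0 (has_sup_mass U).
by exists phi.
Qed.

Lemma open_mass_ge0 U : 0 <= open_mass U.
Proof. by rewrite -[leLHS](lipf0 Tlip); apply: open_mass_ub; exact: test_in0. Qed.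

Lemma open_mass_leC U : open_mass U <= C.
Proof. by apply: open_mass_le => phi [up _]; exact: (lipfC Tlip). Qed.

Lemma le_open_mass U U' : U `<=` U' -> open_mass U <= open_mass U'.
Proof.
move=> UU; apply: open_mass_le => phi [up sU]; apply: open_mass_ub.
by split=> // x /sU /UU.
Qed.

Lemma open_mass_bigcup (U : nat -> set X) : (forall k, open (U k)) ->
  ((open_mass (\bigcup_k U k))%:E <= \sum_(k <oo) (open_mass (U k))%:E)%E.
Proof.
move=> oU; apply/lee_addgt0Pr => e e0.
have [->|fin] := eqVneq (\sum_(k <oo) (open_mass (U k))%:E)%E +oo%E.
  by rewrite leey.
have sum0 : (0 <= \sum_(k <oo) (open_mass (U k))%:E)%E.
  by apply: nneseries_ge0 => k _ _; rewrite lee_fin open_mass_ge0.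
have fsum : (\sum_(k <oo) (open_mass (U k))%:E)%E \is a fin_num.
  by rewrite ge0_fin_numE// ltey.
rewrite -(fineK fsum) -EFinD lee_fin; apply: open_mass_le => phi [up sU].
have [|N hN] := @countable_subadd _ _ _ sepX _ _ Tlip U
  (fun k => open_mass (U k)) phi e oU up sU _ e0.
  by move=> k psi upsi spsi; exact: open_mass_ub.
rewrite (le_trans hN)// lerD2r -lee_fin (fineK fsum) -sumEFin.
rewrite -(big_mkord xpredT (fun k => (open_mass (U k))%:E)).
by apply: nneseries_lim_ge => k _; rewrite lee_fin open_mass_ge0.
Qed.

Definition mass_outer (B : set X) : \bar K :=
  ereal_inf [set (open_mass U)%:E | U in [set U | open U /\ B `<=` U]].

Lemma mass_outer_le B U : open U -> B `<=` U ->
  (mass_outer B <= (open_mass U)%:E)%E.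
Proof. by move=> oU BU; apply: ereal_inf_lbound; exists U. Qed.

Lemma mass_outer_ge B c :
  (forall U, open U -> B `<=` U -> (c <= (open_mass U)%:E)%E) ->
  (c <= mass_outer B)%E.
Proof. by move=> h; apply: le_ereal_inf_tmp => _ [U [oU BU] <-]; exact: h. Qed.

Lemma mass_outer_open U : open U -> mass_outer U = (open_mass U)%:E.
Proof.
move=> oU; apply/eqP; rewrite eq_le mass_outer_le//=.
by apply: mass_outer_ge => V oV UV; rewrite lee_fin le_open_mass.
Qed.

Let mass_outer_ge0 B : (0 <= mass_outer B)%E.
Proof. by apply: mass_outer_ge => U _ _; rewrite lee_fin open_mass_ge0. Qed.

Lemma mass_outer_fin B : mass_outer B \is a fin_num.
Proof.
rewrite ge0_fin_numE// (le_lt_trans (mass_outer_le openT (@subsetT _ B)))//.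
exact: ltry.
Qed.

Let mass_outer0 : mass_outer set0 = 0%E.
Proof.
apply/eqP; rewrite eq_le mass_outer_ge0 andbT mass_outer_open ?lee_fin; last exact: open0.
apply: open_mass_le => phi [_ s0].
suff -> : phi = fun=> 0 by rewrite (lipf0 Tlip).
apply/funext => x; apply: contrapT => /eqP px.
by apply: (s0 x); exact: subset_closure.
Qed.

Let le_mass_outer : {homo mass_outer : A B / A `<=` B >-> (A <= B)%E}.
Proof.
move=> A B AB; apply: mass_outer_ge => U oU BU.
by apply: mass_outer_le => //; exact: subset_trans AB BU.
Qed.

Let mass_outer_subadditive : sigma_subadditive mass_outer.
Proof.
move=> B; apply/lee_addgt0Pr => e e0.
have /choice[U hU] : forall k, exists U, [/\ open U, B k `<=` U &
    ((open_mass U)%:E <= mass_outer (B k) + (e / (2 ^ k.+1)%:R)%:E)%E].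
  move=> k; have ek : 0 < e / (2 ^ k.+1)%:R by rewrite divr_gt0// ltr0n expn_gt0.
  have [_ [U [oU BU] <-] /ltW h] := lb_ereal_inf_adherent ek (mass_outer_fin (B k)).
  by exists U.
have oU k : open (U k) by have [] := hU k.
apply: (@le_trans _ _ (open_mass (\bigcup_k U k))%:E).
  apply: mass_outer_le; first by apply: bigcup_open => k _; exact: oU.
  by apply: subset_bigcup => k _; have [] := hU k.
apply: (le_trans (open_mass_bigcup oU)).
apply: (le_trans _ (epsilon_trick _ _ (ltW e0))); last by [].
by apply: lee_nneseries => k _; [rewrite lee_fin open_mass_ge0|have [] := hU k].
Qed.

HB.instance Definition _ := isOuterMeasure.Build K X mass_outer mass_outer0
  mass_outer_ge0 le_mass_outer mass_outer_subadditive.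

(** A nearly optimal test function for [U `&` E] is supported in a closed set
[S] included in [E], so it can be added to any test function of the open set
[U `\` S], which contains [U `\` E]. *)
Lemma open_caratheodory (E : set X) : open E -> mass_outer.-caratheodory E.
Proof.
move=> oE; apply: le_caratheodory_measurable => B.
apply: mass_outer_ge => U oU BU; apply/lee_addgt0Pr => e e0.
have e2 : 0 < e / 2 by rewrite divr_gt0.
have [phi [[phiO phi01] sphi] hphi] := open_mass_adherent (U `&` E) e2.
pose S := closed_support phi.
have oUS : open (U `\` S).
  by apply: openI => //; rewrite openC; exact: closed_closure.
have [psi [[psiO psi01] spsi] hpsi] := open_mass_adherent (U `\` S) e2.
apply: (@le_trans _ _ ((open_mass (U `&` E))%:E + (open_mass (U `\` S))%:E)%E).
  apply: leeD; apply: mass_outer_le => //; first exact: openI.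
    exact: setSI.
  by move=> x [Bx Ex]; split; [exact: BU|move=> /sphi[]].
rewrite -!EFinD lee_fin.
suff : T (fun x => phi x + psi x) <= open_mass U.
  by rewrite (lipfD Tlip)// => h; move: h hphi hpsi; lra.
have disj x : phi x = 0 \/ psi x = 0.
  have [->|px] := eqVneq (phi x) 0; first by left.
  right; apply: contrapT => /eqP qx.
  have [_] := spsi x (subset_closure (qx : [set x | psi x != 0] x)).
  by apply; exact: subset_closure.
apply: open_mass_ub; split; first split; first exact: LipcD.
  by move=> x; have [->|->] := disj x; rewrite ?add0r ?addr0.
apply: (@subset_trans _ (closure ([set x | phi x != 0] `|` [set x | psi x != 0]))).
  apply: closureS => x /=; have [->|_ _] := eqVneq (phi x) 0; last by left.
  by rewrite add0r; right.
rewrite closureU => x [/sphi[]//|/spsi[]//].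
Qed.

(** The assumptions on the space and on the functional are arguments, because the
measure structures below hold only under them. *)
Definition mass of separable_space X & lip_functional O T C :=
  fun B : set (borel X) => mass_outer B.

Lemma borel_caratheodory (B : set (borel X)) : measurable B ->
  mass_outer.-caratheodory B.
Proof.
move=> mB; have := mB; apply: smallest_sub => [|U oU]; last exact: open_caratheodory.
split; first exact: caratheodory_measurable_set0.
- by move=> A mA; rewrite setTD; exact: caratheodory_measurable_setC.
- by move=> A mA; exact: caratheodory_measurable_bigcup.
Qed.

Let mass0 : mass sepX Tlip set0 = 0%E. Proof. exact: mass_outer0. Qed.

Let mass_ge0 B : (0 <= mass sepX Tlip B)%E. Proof. exact: mass_outer_ge0. Qed.

Let mass_sigma_additive : semi_sigma_additive (mass sepX Tlip).
Proof.
move=> B mB tB mUB.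
apply: (@caratheodory_measure_sigma_additive K X mass_outer) => //.
- by move=> n; apply: borel_caratheodory.
- exact: borel_caratheodory.
Qed.

HB.instance Definition _ := isMeasure.Build _ (borel X) K (mass sepX Tlip) mass0 mass_ge0
  mass_sigma_additive.

Let mass_finite : fin_num_fun (mass sepX Tlip).
Proof. by move=> B _; exact: mass_outer_fin. Qed.

HB.instance Definition _ := @Measure_isFinite.Build _ (borel X) K (mass sepX Tlip)
  mass_finite.

Local Notation mu := (mass sepX Tlip).

Lemma mass_open U : open U -> mu U = (open_mass U)%:E.
Proof. exact: mass_outer_open. Qed.

Lemma clamp_sum (t : K) n : 0 <= t ->
  \sum_(k < n) clamp (t - k%:R) = Num.min t n%:R.
Proof.
move=> t0; elim: n => [|n IH].
  by rewrite big_ord0; apply/esym/min_idPr.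
rewrite big_ord_recr/= IH -natr1 /clamp !minEle !maxEle.
by repeat case: ifPn; rewrite -?ltNge => *; lra.
Qed.

Lemma lipf_sum n (F : nat -> X -> K) : (forall k, Lipc O (F k)) ->
  T (fun x => \sum_(k < n) F k x) = \sum_(k < n) T (F k).
Proof.
move=> FO; elim: n => [|n IH].
  by rewrite big_ord0 -[RHS](lipf0 Tlip); congr T; apply/funext => x; rewrite big_ord0.
rewrite big_ord_recr/= -IH -(lipfD Tlip)//; last exact: Lipc_sum.
by congr T; apply/funext => x; rewrite big_ord_recr.
Qed.

(** [N * phi] is the sum of the layers [clamp (N * phi - k)], and the layer [k] lies
between the indicators of the open sets where [N * phi] exceeds [k + 1] and [k].
Comparison of [T] and of the integral on each layer costs a bounded amount, which
is divided by [N] in the end. *)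
Section Layers.
Context (phi : X -> K) (uphi : unit_test O phi) (N : nat) (N0 : (0 < N)%N).

Let layer k x := clamp (N%:R * phi x + (- k%:R)).

Let phi0 x : 0 <= phi x. Proof. by have [_ /(_ x)/andP[]] := uphi. Qed.

Let layer_blip k : exists2 M, 0 < M & blip M M (layer k).
Proof.
have [phiO _] := uphi; have [M _ phiM] := Lipc_blip phiO.
exists (Num.max 1 (Num.max 1 (`|N%:R| * M))); first by rewrite lt_max ltr01.
exact: blip_max (blip_clamp _ _ phiM).
Qed.

Let layer_unit k : unit_test O (layer k).
Proof.
split; last by move=> x; rewrite clamp_ge0 clamp_le1.
have [phiO _] := uphi; have [M _ bM] := layer_blip k.
by apply: (Lipc_dom phiO bM) => x p0; rewrite /layer p0 mulr0 add0r clamp_eq0// oppr_le0.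
Qed.

Let layer_int k : mu.-integrable setT (EFin \o layer k).
Proof.
have [M _ bM] := layer_blip k; apply: (@finite_bounded_integrable _ _ _ _ _ 1).
  exact: blip_measurable bM.
by move=> x; rewrite ger0_norm ?clamp_ge0 ?clamp_le1.
Qed.

Let layer_sum n x : (N <= n)%N -> \sum_(k < n) layer k x = N%:R * phi x.
Proof.
move=> Nn; rewrite /layer clamp_sum ?mulr_ge0//; apply/min_idPl.
rewrite (@le_trans _ _ N%:R) ?ler_nat// ler_piMr//.
by have [_ /(_ x)/andP[]] := uphi.
Qed.

Let level k := [set x | k.+1%:R < N%:R * phi x].

Let open_level k : open (level k).
Proof.
have [phiO _] := uphi; have [M _ phiM] := Lipc_blip phiO.
rewrite (_ : level k = phi @^-1` [set t | k.+1%:R / N%:R < t]).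
  by apply: open_comp; [move=> x _; exact: (blip_continuous phiM)|exact: open_gt].
by apply/seteqP; split=> x /=; rewrite /level/= ltr_pdivrMr ?ltr0n// mulrC.
Qed.

Let level_lower k : open_mass (level k) <= \int[mu]_x layer k x.
Proof.
rewrite -[leLHS]/(fine (open_mass (level k))%:E) -mass_open//.
apply: measure_le_Rintegral => // [|x|x]; first exact: open_borel.
  exact: clamp_ge0.
rewrite /level/= => h; apply: clamp_eq1; rewrite lerBrDr.
by move: h; rewrite -natr1 addrC => /ltW.
Qed.

Let level_upper k : \int[mu]_x layer k.+1 x <= open_mass (level k).
Proof.
rewrite -[leRHS]/(fine (open_mass (level k))%:E) -mass_open//.
apply: Rintegral_le_measure => // [|x|x]; first exact: open_borel.
  exact: clamp_le1.
by rewrite /level/= => /negP; rewrite -leNgt => h; apply: clamp_eq0; rewrite subr_le0.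
Qed.

Let int_phi n : (N <= n)%N ->
  \sum_(k < n) \int[mu]_x layer k x = N%:R * \int[mu]_x phi x.
Proof.
move=> Nn; have [phiO phi01] := uphi; have [M _ phiM] := Lipc_blip phiO.
rewrite -RintegralZl//; last first.
  apply: (@finite_bounded_integrable _ _ _ _ _ M); last by case: phiM.
  exact: blip_measurable phiM.
rewrite -(@Rintegral_sum _ _ _ mu _ (index_enum 'I_n) (fun k : 'I_n => layer k)) //.
by apply: eq_Rintegral => x _; rewrite layer_sum.
Qed.

Let C0 : 0 <= C.
Proof. exact: le_trans (open_mass_ge0 setT) (open_mass_leC _). Qed.

Lemma layer_le : T phi <= \int[mu]_x phi x + 2 * C / N%:R.
Proof.
have [phiO phi01] := uphi.
have NK : 0 < N%:R :> K by rewrite ltr0n.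
have : N%:R * T phi = \sum_(k < N.+2) T (layer k).
  rewrite -(lipfZ Tlip)// -lipf_sum; last by move=> k; have [] := layer_unit k.
  by congr T; apply/funext => x; rewrite layer_sum// leqW.
(* The two bottom layers contribute at most [C] each; the support of the layer
[k + 2] is contained in the open set [level k]. *)
rewrite 2!big_ord_recl/= => NT.
have h0 : T (layer 0%N) <= C by apply: (lipfC Tlip).
have h1 : T (layer 1%N) <= C by apply: (lipfC Tlip).
have h2 : \sum_(i < N) T (layer (bump 0 (bump 0 i))) <= N%:R * \int[mu]_x phi x.
  rewrite -(int_phi (leqnn N)); apply: ler_sum => k _.
  rewrite (le_trans _ (level_lower k))//; apply: open_mass_ub; split.
    exact: layer_unit.
  have cl : closed [set x | k.+2%:R <= N%:R * phi x].
    have [M _ phiM] := Lipc_blip phiO.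
    rewrite (_ : mkset _ = phi @^-1` [set t | k.+2%:R / N%:R <= t]).
      by apply: closed_comp; [move=> x _; exact: (blip_continuous phiM)|exact: closed_ge].
    by apply/seteqP; split=> x /=; rewrite ler_pdivrMr// mulrC.
  apply: (@subset_trans _ [set x | k.+2%:R <= N%:R * phi x]).
    rewrite [X in _ `<=` X](closure_id _).1//; apply: closureS => x /=.
    rewrite /bump/= !add1n; apply: contraNT; rewrite -ltNge => h.
    by apply/eqP/clamp_eq0; rewrite subr_le0 ltW.
  by move=> x /= h; rewrite /level/= (lt_le_trans _ h)// ltr_nat.
have : N%:R * T phi <= C + (C + N%:R * \int[mu]_x phi x).
  by rewrite NT lerD// lerD.
move=> h; rewrite -(ler_pM2l NK) mulrDr (le_trans h)//.
rewrite (_ : N%:R * (2 * C / N%:R) = 2 * C); first lra.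
by field; rewrite gt_eqF.
Qed.

Lemma layer_ge e : 0 < e -> exists psi, [/\ Lipc O psi,
  forall x, 0 <= psi x <= phi x &
  \int[mu]_x phi x - C / N%:R - e <= T psi].
Proof.
move=> e0; have NK : 0 < N%:R :> K by rewrite ltr0n.
have /choice[q hq] : forall k, exists q, test_in (level k) q /\
    open_mass (level k) - e < T q.
  by move=> k; have [q ? ?] := open_mass_adherent (level k) e0; exists q.
have qO k : Lipc O (q k) by have [[[]]] := hq k.
have qlayer k x : 0 <= q k x <= layer k x.
  have [[[_ q01] sq] _] := hq k; have /andP[q0 q1] := q01 x.
  rewrite q0/=; have [->|qx] := eqVneq (q k x) 0; first exact: clamp_ge0.
  rewrite (le_trans q1)// /layer clamp_eq1//.
  have : level k x by apply: sq; exact: subset_closure.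
  by rewrite /level/= -natr1 => h; rewrite lerBrDr addrC ltW.
exists (fun x => N%:R^-1 * \sum_(k < N) q k x); split.
- by apply: LipcMl; apply: Lipc_sum => k; exact: qO.
- move=> x; rewrite mulr_ge0 ?invr_ge0//=; last first.
    by apply: sumr_ge0 => k _; have /andP[] := qlayer k x.
  rewrite ler_pdivrMl// -(layer_sum x (leqnn N)); apply: ler_sum => k _.
  by have /andP[] := qlayer k x.
- rewrite (lipfZ Tlip); last by apply: Lipc_sum => k; exact: qO.
  rewrite lipf_sum// ler_pdivlMl//.
  apply: (@le_trans _ _ (\sum_(k < N) (\int[mu]_x layer k.+1 x - e))).
    rewrite sumrB sumr_const card_ord -[e *+ N]mulr_natl mulrBr lerD2r mulrBr.
    rewrite mulrCA divff ?gt_eqF// mulr1 -(int_phi (leqnSn N)) big_ord_recl/=.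
    rewrite addrAC gerDr subr_le0.
    apply: (@le_trans _ _ (open_mass setT)); last exact: open_mass_leC.
    rewrite -[leRHS]/(fine (open_mass setT)%:E) -mass_open; last exact: openT.
    apply: Rintegral_le_measure => // [x|x /(_ Logic.I)//]; exact: clamp_le1.
  apply: ler_sum => k _; have [_ /ltW h] := hq k.
  by rewrite (le_trans _ h)// lerD2r level_upper.
Qed.

End Layers.

Lemma mass_upper phi : unit_test O phi -> T phi <= \int[mu]_x phi x.
Proof.
move=> up; apply/ler_addgt0Pr => e e0.
have C1 : 0 < 2 * C + 1.
  by have := le_trans (open_mass_ge0 setT) (open_mass_leC setT) => ?; lra.
have [N _ hN] := near_infty_natSinv_lt (PosNum (divr_gt0 e0 C1)).
have := hN N (leqnn N); rewrite /= ltr_pdivlMr// => h.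
apply: le_trans (layer_le up (ltn0Sn N)) _; rewrite lerD2l.
rewrite mulrC (le_trans _ (ltW h))// ler_wpM2l//; lra.
Qed.

Lemma mass_lower phi e : unit_test O phi -> 0 < e ->
  exists psi, [/\ Lipc O psi, forall x, 0 <= psi x <= phi x &
  \int[mu]_x phi x - e <= T psi].
Proof.
move=> up e0; have e2 : 0 < e / 2 by rewrite divr_gt0.
have C1 : 0 < C + 1.
  by have := le_trans (open_mass_ge0 setT) (open_mass_leC setT) => ?; lra.
have [N _ hN] := near_infty_natSinv_lt (PosNum (divr_gt0 e2 C1)).
have := hN N (leqnn N); rewrite /= ltr_pdivlMr// => h.
have [psi [psiO psiphi hpsi]] := layer_ge up (ltn0Sn N) e2.
exists psi; split=> //; apply: le_trans hpsi.
have : C / N.+1%:R <= N.+1%:R^-1 * (C + 1) by rewrite mulrC ler_wpM2l//; lra.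
by move: h; set a := _^-1 * _; set b := C / _ => h h'; lra.
Qed.

(** The supports of test functions lie in [O], so [O] has full mass. *)
Lemma mass_compl0 : open O -> mu (~` O) = 0%E.
Proof.
move=> oO; have mO := open_borel oO.
have h : mu setT = mu O.
  rewrite !mass_open//; last exact: openT.
  congr EFin; apply/eqP; rewrite eq_le; apply/andP; split; last exact: le_open_mass.
  by apply: open_mass_le => phi [up _]; apply: open_mass_ub; split=> //; have [[]] := up.
have : mu setT = (mu O + mu (~` O))%E.
  by rewrite -measureU ?setUv//; [exact: measurableC|rewrite setICr].
rewrite h; have /fineK <- := fin_num_measure mu O mO.
have /fineK <- := fin_num_measure mu _ (measurableC mO).
by rewrite -EFinD => -[] /eqP; rewrite addrC -subr_eq subrr eq_sym => /eqP->.
Qed.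

End MassMeasure.

(** * Real integrals and approximation of Borel sets by Lipschitz functions *)

Notation rintegrable m f := (m.-integrable [set: _] (EFin \o f)).

Section RealIntegrable.
Context d (S : measurableType d) (K : realType) (m : {measure set S -> \bar K}).
Implicit Types f g h : S -> K.

Lemma rint_measurable f : rintegrable m f -> measurable_fun setT f.
Proof. by move=> /measurable_int/measurable_EFinP. Qed.

Lemma rintMb f h M : rintegrable m f -> measurable_fun setT h ->
  (forall x, `|h x| <= M) -> rintegrable m (fun x => f x * h x).
Proof.
move=> fi mh hM; rewrite (_ : _ \o _ = ((EFin \o f) \* (EFin \o h))%E).
  by apply: integrableMl => //; apply/(boundedP (V := K)); exists M.
by apply/funext => x /=; rewrite EFinM.
Qed.

Lemma rintD f g : rintegrable m f -> rintegrable m g ->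
  rintegrable m (fun x => f x + g x).
Proof.
move=> fi gi; rewrite (_ : _ \o _ = ((EFin \o f) \+ (EFin \o g))%E).
  exact: integrableD.
by apply/funext => x /=; rewrite EFinD.
Qed.

Lemma rintB f g : rintegrable m f -> rintegrable m g ->
  rintegrable m (fun x => f x - g x).
Proof.
move=> fi gi; rewrite (_ : _ \o _ = ((EFin \o f) \- (EFin \o g))%E).
  exact: integrableB.
by apply/funext => x /=; rewrite EFinB.
Qed.

Lemma rintZ a f : rintegrable m f -> rintegrable m (fun x => a * f x).
Proof.
move=> fi; rewrite (_ : _ \o _ = (fun x => a%:E * (EFin \o f) x)%E).
  exact: integrableZl.
by apply/funext => x /=; rewrite EFinM.
Qed.

Lemma rint_abs f : rintegrable m f -> rintegrable m (fun x => `|f x|).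
Proof.
move=> fi; rewrite (_ : _ \o _ = (abse \o (EFin \o f))%E).
  exact: integrable_abse.
by apply/funext.
Qed.

Lemma rint_le f g : rintegrable m g -> measurable_fun setT f ->
  (forall x, `|f x| <= `|g x|) -> rintegrable m f.
Proof.
move=> gi mf fg; apply: (le_integrable _ _ _ gi) => //.
  exact/measurable_EFinP.
by move=> x _ /=; rewrite lee_fin.
Qed.

Lemma rint_sum I (s : seq I) (F : I -> S -> K) :
  (forall i, rintegrable m (F i)) -> rintegrable m (fun x => \sum_(i <- s) F i x).
Proof.
move=> Fi; rewrite (_ : _ \o _ = (fun x => \sum_(i <- s) (EFin \o F i) x)%E).
  by apply: integrable_sum => // i _; exact: Fi.
by apply/funext => x /=; rewrite sumEFin.
Qed.

Lemma Rintegral_dct (h : nat -> S -> K) (g G : S -> K) :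
  (forall n, measurable_fun setT (h n)) -> (forall x, h ^~ x @ \oo --> g x) ->
  (forall n x, `|h n x| <= G x) -> rintegrable m G ->
  (fun n => \int[m]_x h n x) @ \oo --> \int[m]_x g x.
Proof.
move=> mh hg hG Gi.
have mg : measurable_fun setT g.
  by apply: (measurable_fun_cvg mh) => x _; exact: hg.
have gi : rintegrable m g.
  apply: (rint_le Gi mg) => x.
  have G0 : 0 <= G x by rewrite (le_trans _ (hG 0%N x)).
  rewrite (ger0_norm G0).
  have hgx : (fun n => `|h n x|) @ \oo --> `|g x| by exact: cvg_norm.
  rewrite -(cvg_lim _ hgx)//; apply: limr_le; first by apply/cvg_ex; exists `|g x|.
  by apply: nearW => n; exact: hG.
have := @dominated_cvg _ _ _ m setT measurableT (fun n => EFin \o h n)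
  (EFin \o g) (EFin \o G).
move=> H; apply: fine_cvg.
rewrite fineK; last first.
  by apply: integrable_fin_num.
apply: H => //.
- by move=> n; apply/measurable_EFinP.
- by move=> x _; apply: cvg_EFin; [exact: nearW|exact: hg].
- by move=> n x _ /=; rewrite lee_fin.
Qed.

Lemma Rintegral_dct0 (h : nat -> S -> K) (G : S -> K) :
  (forall n, measurable_fun setT (h n)) -> (forall x, h ^~ x @ \oo --> 0) ->
  (forall n x, `|h n x| <= G x) -> rintegrable m G ->
  (fun n => \int[m]_x h n x) @ \oo --> 0.
Proof.
move=> mh h0 hG Gi; have := Rintegral_dct mh h0 hG Gi.
by rewrite /Rintegral integral0.
Qed.

Lemma measurable_indic01 (B : set S) : measurable B ->
  measurable_fun setT (\1_B : S -> K).
Proof. by move=> mB; exact: measurable_indic. Qed.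

Lemma indic01 (B : set S) x : 0 <= (\1_B x : K) <= 1.
Proof. by rewrite indicE; case: (_ \in _); rewrite ?lexx ?ler01. Qed.

End RealIntegrable.

Section LipschitzDensity.
Context (K : realType) (X : completeNormedModType K).
Context (m : {measure set (borel X) -> \bar K}) (w : borel X -> K).
Hypothesis wi : rintegrable m w.

Let E (g : borel X -> K) := \int[m]_x (`|g x| * `|w x|).

Let bmeas (g : borel X -> K) := measurable_fun setT g /\ exists M, forall x, `|g x| <= M.

Let i01 (B : set (borel X)) x : 0 <= (\1_B x : K) <= 1.
Proof. exact: indic01. Qed.

Let Eint g : bmeas g -> rintegrable m (fun x => `|g x| * `|w x|).
Proof.
move=> [mg [M gM]]; under eq_fun do rewrite mulrC.
apply: (@rintMb _ _ _ _ _ _ M); first exact: rint_abs.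
  exact: measurableT_comp.
by move=> x; rewrite normr_id.
Qed.

Let E_tri g h k : bmeas g -> bmeas h -> bmeas k ->
  (forall x, `|g x| <= `|h x| + `|k x|) -> E g <= E h + E k.
Proof.
move=> bg bh bk gh; rewrite /E -RintegralD//; [|exact: Eint..].
apply: le_Rintegral; [by []|exact: Eint|by apply: rintD; exact: Eint|].
by move=> x _; rewrite -mulrDl ler_wpM2r.
Qed.

Let E_cvg (g : nat -> borel X -> K) M : (forall n, measurable_fun setT (g n)) ->
  (forall n x, `|g n x| <= M) -> (forall x, g ^~ x @ \oo --> 0) ->
  (fun n => E (g n)) @ \oo --> 0.
Proof.
move=> mg gM g0; apply: (@Rintegral_dct0 _ _ _ _ _ (fun x => M * `|w x|)).
- move=> n; apply: measurable_funM; first exact: measurableT_comp.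
  by apply: measurableT_comp => //; exact: rint_measurable wi.
- move=> x; rewrite -(mul0r `|w x|); apply: cvgMl; rewrite -(@normr0 _ K).
  exact: cvg_norm.
- by move=> n x; rewrite normrM !normr_id ler_wpM2r.
- exact/rintZ/rint_abs.
Qed.

Let approx (B : set (borel X)) := measurable B /\ forall e, 0 < e ->
  exists (eta : X -> K) (L : K), [/\ blip 1 L eta, forall x, 0 <= eta x <= 1 &
    E (fun x => eta x - \1_B x) <= e].

Let diff_bmeas (B : set (borel X)) L (eta : X -> K) : measurable B ->
  blip 1 L eta -> bmeas (fun x => eta x - \1_B x).
Proof.
move=> mB bl; split.
  apply: measurable_funB; first exact: blip_measurable bl.
  exact: measurable_indic01.
exists 2 => x; rewrite (le_trans (ler_normB _ _))// -[2]/(1 + 1) lerD//.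
  by case: bl.
by have /andP[h0 h1] := i01 B x; rewrite ger0_norm.
Qed.

Let indicB_bmeas (A B : set (borel X)) : measurable A -> measurable B ->
  bmeas (fun x => \1_A x - \1_B x).
Proof.
move=> mA mB; split; first by apply: measurable_funB; exact: measurable_indic01.
exists 1 => x; have /andP[h0 h1] := i01 B x.
by have /andP[h2 h3] := i01 A x; rewrite ler_norml; lra.
Qed.

Let approx_open U : open U -> approx U.
Proof.
move=> oU; split; first exact: open_borel.
move=> e e0; pose eta n x := clamp (n%:R * capdist (~` U) x + 0).
have bl n : blip 1 (`|n%:R| * 1) (eta n).
  by apply: blip_clamp; exact: capdist_blip.
have mU := open_borel oU.
have /cvgrPdist_le/(_ _ e0) : (fun n => E (fun x => eta n x - \1_U x)) @ \oo --> 0.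
  apply: (@E_cvg _ 2).
  - by move=> n; have [] := diff_bmeas mU (bl n).
  - move=> n x; rewrite (le_trans (ler_normB _ _))// -[2]/(1 + 1) lerD//.
      by have [] := bl n.
    by have /andP[h0 h1] := i01 U x; rewrite ger0_norm.
  - move=> x; apply: cvg_near_cst; near=> n.
    rewrite indicE; have [Ux|Ux] := pselect (U x).
      rewrite mem_set//= /eta clamp_eq1 ?subrr// addr0.
      have u0 : 0 < capdist (~` U) x.
        by apply: capdist_gt0; rewrite ?setCK//; exact.
      rewrite -ler_pdivrMr//; near: n; exact: nbhs_infty_ger.
    rewrite memNset//= /eta capdist_eq0// mulr0 addr0 clamp_eq0//.
    by rewrite subrr.
move=> [N _ hN]; exists (eta N), (`|N%:R| * 1); split => //.
  by move=> x; rewrite clamp_ge0 clamp_le1.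
by have := hN N (leqnn N); rewrite sub0r normrN => /(le_trans (ler_norm _)).
Unshelve. all: by end_near. Qed.

Let approxC B : approx B -> approx (~` B).
Proof.
move=> [mB aB]; split; first exact: measurableC.
move=> e /aB[eta [L [bl eta01 etaE]]].
exists (fun x => 1 + -1 * eta x), L; split.
- split=> [x|x y].
    by have /andP[? ?] := eta01 x; rewrite ger0_norm; lra.
  have -> : 1 + -1 * eta x - (1 + -1 * eta y) = - (eta x - eta y) by ring.
  by rewrite normrN; case: bl.
- by move=> x; have /andP[? ?] := eta01 x; apply/andP; split; lra.
- apply: le_trans etaE; rewrite le_eqVlt; apply/orP; left; apply/eqP.
  apply: eq_Rintegral => x _; congr (_ * _); rewrite -normrN; congr `|_|.
  by rewrite !indicE in_setC; case: (_ \in _) => /=; ring.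
Qed.

Let approxI A B : approx A -> approx B -> approx (A `&` B).
Proof.
move=> [mA aA] [mB aB]; split; first exact: measurableI.
move=> e e0; have e2 : 0 < e / 2 by rewrite divr_gt0.
have [a [La [bla a01 aE]]] := aA _ e2; have [b [Lb [blb b01 bE]]] := aB _ e2.
have blab := blipM bla blb; rewrite mulr1 in blab.
exists (fun x => a x * b x), (1 * Lb + La * 1); split => //.
  move=> x; have /andP[? ?] := a01 x; have /andP[? ?] := b01 x.
  by apply/andP; split; nra.
rewrite (splitr e); apply: (le_trans _ (lerD aE bE)).
apply: E_tri.
- by apply: (diff_bmeas _ blab); exact: measurableI.
- exact: (diff_bmeas mA bla).
- exact: (diff_bmeas mB blb).
move=> x; rewrite indicI /=.
have -> : a x * b x - \1_A x * \1_B x = (a x - \1_A x) * b x + \1_A x * (b x - \1_B x).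
  by ring.
rewrite (le_trans (ler_normD _ _))// !normrM; apply: lerD.
  by rewrite ler_piMr//; case: blb.
rewrite ler_piMl//; have /andP[h0 h1] := i01 A x.
by rewrite ger0_norm.
Qed.

Let approx_bigcup (B : nat -> set (borel X)) : (forall n, approx (B n)) ->
  approx (\bigcup_n B n).
Proof.
move=> aB; pose U n := \big[setU/set0]_(k < n) B k.
have aU n : approx (U n).
  rewrite /U; elim: n => [|n IH].
    by rewrite big_ord0; apply: approx_open; exact: open0.
  by rewrite big_ord_recr/= -[X in approx X]setCK setCU; apply: approxC; apply: approxI; exact: approxC.
have mU : measurable (\bigcup_n B n).
  by apply: bigcupT_measurable => n; have [] := aB n.
split=> // e e0; have e2 : 0 < e / 2 by rewrite divr_gt0.
have /cvgrPdist_le/(_ _ e2)[N _ hN] :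
    (fun n => E (fun x => \1_(U n) x - \1_(\bigcup_n B n) x)) @ \oo --> 0.
  apply: (@E_cvg _ 1).
  - move=> n; apply: measurable_funB; apply: measurable_indic01 => //.
    by have [] := aU n.
  - move=> n x; have /andP[h0 h1] := i01 (\bigcup_n B n) x.
    by have /andP[h2 h3] := i01 (U n) x; rewrite ler_norml; lra.
  - move=> x; apply: cvg_near_cst.
    rewrite /U; have [[k _ Bkx]|Bx] := pselect ((\bigcup_n B n) x).
      near=> n.
      have Un : (\big[setU/set0]_(i < n) B i) x.
        by rewrite -bigcup_mkord; exists k => //=; near: n; exact: nbhs_infty_gt.
      have Ux : (\bigcup_n B n) x by exists k.
      by rewrite !indicE (mem_set Un) (mem_set Ux) subrr.
    near=> n; rewrite !indicE !memNset ?subrr//.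
    by rewrite -bigcup_mkord => -[k /= _ Bkx]; apply: Bx; exists k.
have [_ /(_ _ e2)[eta [L [bl eta01 etaE]]]] := aU N.
exists eta, L; split => //; rewrite (splitr e).
have hNN : E (fun x => \1_(U N) x - \1_(\bigcup_n B n) x) <= e / 2.
  by have := hN N (leqnn N); rewrite sub0r normrN => /(le_trans (ler_norm _)).
apply: (le_trans _ (lerD etaE hNN)); apply: E_tri.
- exact: (diff_bmeas mU bl).
- by apply: (diff_bmeas _ bl) => //; have [] := aU N.
- by apply: indicB_bmeas => //; have [] := aU N.
move=> x; apply: le_trans (ler_normD _ _); rewrite le_eqVlt; apply/orP; left.
by apply/eqP; congr `|_|; ring.
Unshelve. all: by end_near. Qed.

(** The Borel sets whose indicator functions are limits of Lipschitz functions
in the weighted space [L^1(`|w| m)] form a sigma-algebra that contains the open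
sets. *)
Lemma borel_lipschitz_approx (B : set (borel X)) : measurable B ->
  forall e, 0 < e -> exists (eta : X -> K) (L : K), [/\ blip 1 L eta, forall x, 0 <= eta x <= 1 &
    \int[m]_x (`|eta x - \1_B x| * `|w x|) <= e].
Proof.
suff H : measurable `<=` approx by move=> /H[].
apply: smallest_sub; last exact: approx_open.
split; [exact: approx_open open0|by move=> A; rewrite setTD; exact: approxC|].
exact: approx_bigcup.
Qed.

End LipschitzDensity.

(** * Representation of functionals by differences of finite measures *)

Section MeasureDifference.
Context d (S : measurableType d) (K : realType).

(** Moving the subtracted measures to the other side leaves two sums of measures
that agree on all measurable sets. *)
Lemma Rintegral_measure_diff (a b a' b' : {finite_measure set S -> \bar K})
    (g : S -> K) M : measurable_fun setT g -> (forall x, `|g x| <= M) ->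
  (forall B, measurable B ->
    fine (a B) - fine (b B) = fine (a' B) - fine (b' B)) ->
  \int[a]_x g x - \int[b]_x g x = \int[a']_x g x - \int[b']_x g x.
Proof.
move=> mg gM ab.
have gi (m : {finite_measure set S -> \bar K}) : rintegrable m g.
  exact: finite_bounded_integrable mg gM.
have addE (m1 m2 : {finite_measure set S -> \bar K}) :
  fine (\int[measure_add m1 m2]_x (g x)%:E) = \int[m1]_x g x + \int[m2]_x g x.
  rewrite integral_measure_add//; [|exact: gi..].
  by rewrite fineD//; apply: integrable_fin_num => //; exact: gi.
suff : \int[a]_x g x + \int[b']_x g x = \int[a']_x g x + \int[b]_x g x by lra.
rewrite -!addE; congr fine; apply: eq_measure_integral => A mA _.
rewrite /= /msum !big_ord_recl/= !big_ord0 !adde0; have := ab A mA.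
rewrite -[in X in _ -> X](fineK (fin_num_measure a A mA)).
rewrite -[in X in _ -> X](fineK (fin_num_measure b A mA)).
rewrite -[in X in _ -> X](fineK (fin_num_measure a' A mA)).
rewrite -[in X in _ -> X](fineK (fin_num_measure b' A mA)).
by rewrite -!EFinD => h; congr EFin; lra.
Qed.

End MeasureDifference.

Section SignedRepresentation.
Context (K : realType) (X : completeNormedModType K) (O : set X).
Context (sepX : separable_space X).

(** A function [psi <= g] that nearly attains the mass of [T1] below [g] leaves the
difference [g - psi], on which [- T1] is bounded by its own measure. *)
Let half_repr (T1 T2 : (X -> K) -> K) C1 C2 (h1 : lip_functional O T1 C1)
    (h2 : lip_functional O T2 C2) (g : X -> K) :
  (forall phi, T2 phi = - T1 phi) -> unit_test O g ->
  \int[mass sepX h1]_x g x - \int[mass sepX h2]_x g x <= T1 g.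
Proof.
move=> T12 ug; have [gO g01] := ug.
have aux (a b c t p e : K) : c <= b -> - (t - p) <= c -> a - e <= p -> a - b <= t + e.
  by clear; lra.
apply/ler_addgt0Pr => e e0.
have [psi [psiO psig hpsi]] := mass_lower sepX h1 ug e0.
have dO : Lipc O (fun x => g x - psi x).
  rewrite (_ : (fun _ => _) = (fun x => g x + -1 * psi x)).
    by apply: LipcD => //; exact: LipcMl.
  by apply/funext => x; rewrite mulN1r.
have ud : unit_test O (fun x => g x - psi x).
  split=> // x; have /andP[? ?] := psig x; have /andP[? ?] := g01 x.
  by apply/andP; split; lra.
have := mass_upper sepX h2 ud; rewrite T12 (lipfB h1)//.
have : \int[mass sepX h2]_x (g x - psi x) <= \int[mass sepX h2]_x g x.
  apply: le_Rintegral => //.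
  - have [M _ bM] := Lipc_blip dO.
    by apply: (@finite_bounded_integrable _ _ _ _ _ M);
      [exact: blip_measurable bM|case: bM].
  - have [M _ bM] := Lipc_blip gO.
    by apply: (@finite_bounded_integrable _ _ _ _ _ M);
      [exact: blip_measurable bM|case: bM].
  - by move=> x _; have /andP[? ?] := psig x; rewrite gerBl.
by move=> h h'; exact: aux h h' hpsi.
Qed.

(** A Riesz representation theorem without local compactness: completeness and
separability of [X] make the continuity of [T] along uniformly Lipschitz
sequences sufficient for countable additivity. *)
Theorem lip_functional_repr (T : (X -> K) -> K) C C' : open O ->
  lip_functional O T C -> lip_functional O (fun phi => - T phi) C' ->
  exists mp mn : {finite_measure set (borel X) -> \bar K},
    [/\ mp (~` O) = 0%E, mn (~` O) = 0%E & forall phi, Lipc O phi ->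
      T phi = \int[mp]_x phi x - \int[mn]_x phi x].
Proof.
move=> oO h1 h2.
exists (mass sepX h1), (mass sepX h2).
split; [exact: mass_compl0|exact: mass_compl0|].
have unit g : unit_test O g ->
    T g = \int[mass sepX h1]_x g x - \int[mass sepX h2]_x g x.
  move=> ug; apply/eqP; rewrite eq_le (half_repr h1 h2)// andbT.
  have := half_repr h2 h1 (fun phi => esym (opprK (T phi))) ug.
  by move=> h; rewrite -lerN2 opprB.
move=> phi phiO; have [M M0 bM] := Lipc_blip phiO.
have [phiM _] := bM.
(* For [s = 1] and [s = -1] these are the positive and negative parts of [phi / M]. *)
pose part s x := clamp (s / M * phi x + 0).
have partO s : unit_test O (part s).
  split; last by move=> x; rewrite clamp_ge0 clamp_le1.
  apply: (Lipc_dom phiO (blip_max (blip_clamp (s / M) 0 bM))) => x ->.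
  by rewrite mulr0 addr0 clamp_eq0.
have phiE x : phi x = M * part 1 x + (- M) * part (-1) x.
  have /ler_normlP[h3 h4] := phiM x; rewrite /part /clamp.
  have -> : phi x = M * (1 / M * phi x) by field; rewrite gt_eqF.
  set t := 1 / M * phi x.
  have -> : -1 / M * (M * t) + 0 = - t by field; rewrite gt_eqF.
  have -> : 1 / M * (M * t) + 0 = t by field; rewrite gt_eqF.
  have [t1 t2] : - 1 <= t /\ t <= 1.
    have -> : t = phi x / M by rewrite /t mul1r mulrC.
    by rewrite ler_pdivlMr// ler_pdivrMr//; split; lra.
  by rewrite !minEle !maxEle; repeat case: ifPn; rewrite -?ltNge => *; nra.
have -> : phi = fun x => M * part 1 x + (- M) * part (-1) x by exact/funext.
have [p1 p2] := (partO 1, partO (-1)).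
rewrite (lipfD h1); [|apply: LipcMl; by case: p1|apply: LipcMl; by case: p2].
rewrite (lipfZ h1 _ p1.1) (lipfZ h1 _ p2.1) (unit _ p1) (unit _ p2).
have pint s (m : {finite_measure set (borel X) -> \bar K}) : rintegrable m (part s).
  have [sO s01] := partO s; have [N _ bN] := Lipc_blip sO.
  by apply: (@finite_bounded_integrable _ _ _ _ _ N);
      [exact: blip_measurable bN|case: bN].
have intE (m : {finite_measure set (borel X) -> \bar K}) :
    \int[m]_x (M * part 1 x + - M * part (-1) x) =
    M * \int[m]_x part 1 x + - M * \int[m]_x part (-1) x.
  rewrite RintegralD//; [|exact: rintZ (pint _ _)..].
  by rewrite !RintegralZl//; exact: pint.
by rewrite !intE; ring.
Qed.

End SignedRepresentation.

(** * Smooth approximation of Lipschitz functions *)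

Section SmoothApproximation.
Context (K : realType) (X : completeNormedModType K) (ip : inner_product X).
Context (sepX : separable_space X).

Lemma applyr_ip_continuous g : continuous (applyr ip g : X -> K).
Proof.
apply: bounded_linear_continuous; apply/linear_boundedP.
exists `|g|; split=> [|r gr x /=]; first exact: num_real.
by rewrite (le_trans (ip_bound _ _ _))// mulrC ler_wpM2r// ltW.
Qed.

Lemma grad_differentiable (f : X -> K) x g :
  (forall e, 0 < e -> \forall h \near (0 : X),
     `|f (h + x) - f x - ip h g| <= e * `|h|) -> differentiable f x.
Proof.
move=> H; have eqo : f \o shift x = cst (f x) + applyr ip g +o_ (0 : X) id.
  apply/eqaddoP => e /H; apply: filterS => h /=.
  by rewrite !fctE /= opprD addrA.
apply/diff_locallyP.
rewrite (diff_unique (applyr_ip_continuous (g := g)) eqo); split=> //.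
exact: applyr_ip_continuous.
Qed.

Lemma differentiable_sqr_dist (a x : X) : differentiable (fun y => `|y - a| ^+ 2) x.
Proof.
apply: (@grad_differentiable _ _ (2 *: (x - a))) => e e0.
apply: filterS (nbhs0_le e0) => h he.
have -> : h + x - a = (x - a) + h by rewrite -addrA addrC.
rewrite (norm_add_sqr ip) ip_scaler (ipC ip h).
have -> : `|x - a| ^+ 2 + 2 * ip (x - a) h + `|h| ^+ 2 - `|x - a| ^+ 2 -
  2 * ip (x - a) h = `|h| ^+ 2 by ring.
rewrite ger0_norm ?sqr_ge0// expr2.
exact: ler_wpM2r.
Qed.

Lemma differentiable_scalar_comp (g : X -> K) (f df : K -> K) x :
  differentiable g x -> is_derive (g x) 1 f (df (g x)) ->
  differentiable (fun y => f (g y)) x.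
Proof.
move=> dg df1; apply: (@differentiable_comp _ _ _ _ g f) => //.
by apply/derivable1_diffP; apply: ex_derive.
Qed.

Lemma frechet_gradP phi x : differentiable phi x ->
  forall h, 'd phi x h = ip (frechet_grad ip phi x) h.
Proof.
move=> dphi; rewrite /frechet_grad.
have := diff_continuous dphi.
move=> /linear_bounded_continuous/linear_boundedP[M [_ /(_ (Num.max 0 M + 1))]].
rewrite (@le_lt_trans _ _ (Num.max 0 M)) ?ltrDl ?le_max ?lexx ?orbT// => /(_ isT) dM.
have [||||g hg] := @riesz _ _ ip sepX ('d phi x) (Num.max 0 M + 1).
- by rewrite addr_ge0// le_max lexx.
- exact: linearD.
- by move=> a y; rewrite linearZ.
- exact: dM.
by apply: (@xgetPex _ 0 [set g | forall h, 'd phi x h = ip g h]); exists g => h; rewrite hg ipC.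
Qed.

Lemma derive_frechet phi x h : differentiable phi x ->
  'D_h phi x = ip (frechet_grad ip phi x) h.
Proof. by move=> dphi; rewrite deriveE// frechet_gradP. Qed.

(** Increments are restricted to a sequence so that upper limits of difference
quotients are Borel functions. *)
Definition diffq (h : X) (phi : X -> K) n x :=
  n.+1%:R * (phi (x + n.+1%:R^-1 *: h) - phi x).

Lemma cvg_diffq phi x h l : is_derive x h phi l ->
  (fun n => diffq h phi n x) @ \oo --> l.
Proof.
move=> [dphi <-]; pose u n : K := n.+1%:R^-1.
have u0 : (forall n, u n != 0) /\ u @ \oo --> 0.
  by split=> [n|]; [rewrite invr_eq0|exact: cvg_harmonic].
have /cvgr_dnbhsP/(_ _ u0) : (fun t : K => t^-1 *: ((phi \o shift x) (t *: h) - phi x))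
    @ 0^' --> 'D_h phi x by exact: dphi.
by apply: cvg_trans; apply: near_eq_cvg; apply: nearW => n; rewrite /diffq /u invrK /= (addrC x).
Qed.

Lemma diffq_le M L phi h n x : blip M L phi -> `|diffq h phi n x| <= L * `|h|.
Proof.
move=> [_ pL]; rewrite /diffq normrM (@ger0_norm _ n.+1%:R)// mulrC -ler_pdivlMr ?ltr0n//.
rewrite (le_trans (pL _ _))// addrC addKr normrZ normfV ger0_norm//.
by rewrite mulrCA mulrC.
Qed.

Lemma frechet_grad_le M L (phi : X -> K) x : 0 <= L -> blip M L phi ->
  differentiable phi x -> `|frechet_grad ip phi x| <= L.
Proof.
move=> L0 bl dphi; set g := frechet_grad ip phi x.
have h1 : is_derive x g phi (ip g g).
  by apply: DeriveDef; [exact: diff_derivable|exact: derive_frechet].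
have := cvg_diffq h1; rewrite -(ip_normE ip) => h2.
have : `|g| ^+ 2 <= L * `|g|.
  rewrite -(cvg_lim _ h2)//; apply: limr_le; first by apply/cvg_ex; eexists; exact: h2.
  by apply: nearW => n; exact: le_trans (ler_norm _) (diffq_le _ _ _ bl).
have [->//|g0] := eqVneq `|g| 0.
by rewrite expr2 ler_pM2r// lt_def g0 normr_ge0.
Qed.

Section SoftMin.
Context (beta M L : K) (n : nat) (r : nat -> X -> K).
Hypotheses (beta0 : 0 < beta) (L0 : 0 <= L).

(** The smooth minimum of [M] and of the [n] first functions [r k]. It is
monotone in its arguments and commutes with the addition of constants, hence it
preserves Lipschitz constants. *)
Let S x := expR (- beta * M) + \sum_(k < n) expR (- beta * r k x).

Definition softmin x := - beta^-1 * ln (S x).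

Let S0 x : 0 < S x.
Proof.
by apply: ltr_wpDr; [apply: sumr_ge0 => k _; exact: expR_ge0|exact: expR_gt0].
Qed.

Let softmin_le_ln c x : expR (- beta * c) <= S x -> softmin x <= c.
Proof.
move=> h; rewrite /softmin mulNr lerNl ler_pdivlMl// mulrN -mulNr.
by rewrite -ler_expR lnK ?posrE.
Qed.

Let ln_le_softmin c x : S x <= expR (- beta * c) -> c <= softmin x.
Proof.
move=> h; rewrite /softmin mulNr lerNr ler_pdivrMl// mulrN -mulNr.
by rewrite -ler_expR lnK ?posrE.
Qed.

Lemma softmin_leM x : softmin x <= M.
Proof.
by apply: softmin_le_ln; rewrite lerDl sumr_ge0// => k _; exact: expR_ge0.
Qed.

Lemma softmin_le k x : (k < n)%N -> softmin x <= r k x.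
Proof.
move=> kn; apply: softmin_le_ln; rewrite /S (bigD1 (Ordinal kn))//= addrCA lerDl.
by rewrite addr_ge0 ?expR_ge0 ?sumr_ge0// => j _; exact: expR_ge0.
Qed.

Lemma softmin_ge c x : c <= M -> (forall k, c <= r k x) ->
  c - n%:R / beta <= softmin x.
Proof.
move=> cM cr; apply: ln_le_softmin.
apply: (@le_trans _ _ ((n%:R + 1) * expR (- beta * c))).
  rewrite mulrDl mul1r addrC lerD//.
    by rewrite ler_expR ler_nM2l ?oppr_lt0.
  rewrite -[n in n%:R]card_ord mulr_natl -sumr_const; apply: ler_sum => k _.
  by rewrite ler_expR ler_nM2l ?oppr_lt0.
have -> : - beta * (c - n%:R / beta) = n%:R + - beta * c.
  by field; rewrite gt_eqF.
by rewrite expRD ler_wpM2r ?expR_ge0// addrC expR_ge1Dx.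
Qed.

Lemma softmin_lip : (forall k x y, r k x - r k y <= L * `|x - y|) ->
  forall x y, `|softmin x - softmin y| <= L * `|x - y|.
Proof.
move=> rL; have one x y : softmin x - softmin y <= L * `|x - y|.
  rewrite lerBlDl; apply: softmin_le_ln.
  suff h : expR (- beta * (softmin y)) <= expR (beta * (L * `|x - y|)) * S x.
    have -> : - beta * (softmin y + L * `|x - y|) =
      - beta * softmin y + - (beta * (L * `|x - y|)) by ring.
    by rewrite expRD expRN ler_pdivrMr ?expR_gt0// [leRHS]mulrC.
  have -> : - beta * softmin y = ln (S y) by rewrite /softmin; field; rewrite gt_eqF.
  rewrite lnK ?posrE//.
  rewrite /S mulrDr mulr_sumr; apply: lerD.
    rewrite -expRD ler_expR -subr_ge0 addrK.
    by rewrite !mulr_ge0// ltW.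
  apply: ler_sum => k _; rewrite -expRD ler_expR -subr_ge0.
  have := rL k x y => h.
  rewrite (_ : _ - _ = beta * (L * `|x - y| - (r k x - r k y))); last by ring.
  by rewrite mulr_ge0 ?subr_ge0// ltW.
move=> x y; rewrite ler_norml one andbT lerNl opprB distrC; exact: one.
Qed.

Lemma softmin_differentiable x : (forall k, differentiable (r k) x) ->
  differentiable softmin x.
Proof.
move=> dr; apply: differentiableZ.
apply: (@differentiable_scalar_comp S (@ln K) (fun t => t^-1)).
  apply: differentiableD; first exact: differentiable_cst.
  rewrite (_ : (fun _ => _) = \sum_(k < n) (fun x => expR (- beta * r k x))).
    apply: differentiable_sum => k.
    apply: (@differentiable_scalar_comp (fun x => - beta * r k x) (@expR K) (@expR K)).
    exact: differentiableZ.
  by apply/funext => y; rewrite fct_sumE.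
exact: is_derive1_ln.
Qed.

End SoftMin.

Lemma sqrt_dist_lip (e : K) (a x y : X) :
  Num.sqrt (e ^+ 2 + `|x - a| ^+ 2) - Num.sqrt (e ^+ 2 + `|y - a| ^+ 2) <=
  `|x - y|.
Proof.
rewrite lerBlDl; set u := Num.sqrt (_ + `|y - a| ^+ 2).
have u0 : 0 <= u by exact: sqrtr_ge0.
have u2 : u ^+ 2 = e ^+ 2 + `|y - a| ^+ 2 by rewrite sqr_sqrtr// addr_ge0 ?sqr_ge0.
have yu : `|y - a| <= u.
  by rewrite -ler_sqr ?nnegrE// u2 lerDr sqr_ge0.
have tri : `|x - a| <= `|y - a| + `|x - y|.
  by rewrite -{1}(subrK y x) -addrA addrC ler_normD.
rewrite -ler_sqr ?nnegrE ?sqrtr_ge0 ?addr_ge0// sqr_sqrtr ?addr_ge0 ?sqr_ge0//.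
rewrite sqrrD u2.
have : `|x - a| ^+ 2 <= (`|y - a| + `|x - y|) ^+ 2.
  by rewrite ler_sqr ?nnegrE ?addr_ge0.
have : `|y - a| * `|x - y| <= u * `|x - y| by rewrite ler_wpM2r.
rewrite sqrrD; lra.
Qed.

(** A bounded Lipschitz function is the infimum of the cones
[phi (d k) + L * |x - d k|] over a dense sequence; rounding the cones and taking
smooth minima of finitely many of them keeps the Lipschitz constant. *)
Lemma smooth_approx M L (phi : X -> K) : 0 <= L -> blip M L phi ->
  exists psi : nat -> X -> K, [/\ forall n, C1b ip (psi n),
    forall n x, differentiable (psi n) x,
    forall n, blip (M + 1) L (psi n) &
    forall x, psi ^~ x @ \oo --> phi x].
Proof.
move=> L0 [pM pL]; have [d dd] := separable_seq sepX.
pose e n : K := n.+1%:R^-1.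
have e0 n : 0 < e n by rewrite invr_gt0.
pose r n k x := phi (d k) + L * Num.sqrt (e n ^+ 2 + `|x - d k| ^+ 2).
(* The smooth minimum of [n] functions errs by at most [n / beta], which tends to 0
for this choice of [beta]. *)
pose psi n := softmin (n.+1%:R ^+ 2) M n (r n).
have b0 n : 0 < n.+1%:R ^+ 2 :> K by rewrite exprn_gt0.
have phiM x : phi x <= M by exact: le_trans (ler_norm _) (pM x).
have Mphi x : - M <= phi x by have /ler_normlP[h _] := pM x; rewrite lerNl.
have phir n k x : phi x <= r n k x.
  rewrite -lerBlDl (le_trans (ler_norm _))// (le_trans (pL _ _))// ler_wpM2l//.
  by rewrite -[leLHS]ger0_norm// -sqrtr_sqr ler_wsqrtr// lerDr sqr_ge0.
have rL n k x y : r n k x - r n k y <= L * `|x - y|.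
  rewrite /r opprD addrACA subrr add0r -mulrBr ler_wpM2l//.
  exact: sqrt_dist_lip.
have lower n x : phi x - e n <= psi n x.
  apply: le_trans (softmin_ge n (b0 n) (phiM x) (fun k => phir n k x)).
  rewrite lerD2l lerN2 ler_pdivrMr// /e expr2 mulrA mulVf ?pnatr_eq0// mul1r.
  by rewrite ler_nat.
have e1 n : e n <= 1 by rewrite invf_le1// ler1n.
have bpsi n : blip (M + 1) L (psi n).
  split; last exact: softmin_lip.
  move=> x; rewrite ler_norml; apply/andP; split.
    by have := lower n x; have := Mphi x; have := e1 n; lra.
  by rewrite (le_trans (softmin_leM _ _ _ (b0 n) x))// lerDl.
have dpsi n x : differentiable (psi n) x.
  apply: softmin_differentiable => // k.
  apply: differentiableD; first exact: differentiable_cst.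
  apply: differentiableZ.
  apply: (@differentiable_scalar_comp (fun x => e n ^+ 2 + `|x - d k| ^+ 2)
    (@Num.sqrt K) (fun t => (2 * Num.sqrt t)^-1)).
    apply: differentiableD; first exact: differentiable_cst.
    exact: differentiable_sqr_dist.
  by apply: is_derive1_sqrt; rewrite ltr_wpDr ?sqr_ge0// exprn_gt0.
exists psi; split=> //.
- move=> n; split => //.
    by apply/(boundedP (V := K)); exists (M + 1) => x _; case: (bpsi n).
  apply/boundedP; exists L => x _.
  exact: frechet_grad_le (bpsi n) (dpsi n x).
- move=> x; apply/cvgrPdist_le => t t0.
  have L1 : 0 < 2 * L + 1 by lra.
  have d0 : 0 < t / 2 / (2 * L + 1) by rewrite !divr_gt0.
  have [||k hk] := dd (ball x (t / 2 / (2 * L + 1))); [exact: ball_open|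
    by exists x; exact: ballxx|].
  have {}hk : `|x - d k| <= t / 2 / (2 * L + 1) by move: hk; rewrite -ball_normE => /ltW.
  near=> n.
  have kn : (k < n)%N by near: n; exact: nbhs_infty_gt.
  have en : e n <= t / 2 / (2 * L + 1).
    by near: n; have [N _ hN] := near_infty_natSinv_lt (PosNum d0); exists N => // m /hN/ltW.
  have up : psi n x <= phi (d k) + L * (e n + `|x - d k|).
    rewrite (le_trans (softmin_le _ _ (b0 n) x kn))// /r lerD2l ler_wpM2l//.
    rewrite -[leRHS]ger0_norm ?addr_ge0 ?(ltW (e0 n))// -sqrtr_sqr ler_wsqrtr//.
    have := mulr_ge0 (ltW (e0 n)) (normr_ge0 (x - d k)).
    by rewrite sqrrD; lra.
  have dk : phi (d k) - phi x <= L * `|x - d k|.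
    by rewrite distrC (le_trans (ler_norm _)).
  have lo := lower n x.
  set q := t / 2 / (2 * L + 1) in hk en *.
  have tq : t = 2 * (2 * L + 1) * q by rewrite /q; field; rewrite gt_eqF.
  have h1 : L * `|x - d k| <= L * q by rewrite ler_wpM2l.
  have h2 : L * e n <= L * q by rewrite ler_wpM2l.
  have Lq : 0 <= L * q by rewrite mulr_ge0// ltW.
  by rewrite distrC ler_norml tq; apply/andP; split; nra.
Unshelve. all: by end_near. Qed.

End SmoothApproximation.

(** * Integration by parts for Lipschitz functions *)

Lemma adjoint (K : realType) (X : completeNormedModType K) (ip : inner_product X)
    (sepX : separable_space X) (R : {linear X -> X}) (z : X) : continuous R ->
  exists h, forall x, ip (R x) z = ip x h.
Proof.
move=> contR.
have := contR; move=> /linear_bounded_continuous/linear_boundedP.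
move=> [M [_ /(_ (Num.max 0 M + 1))]].
rewrite (@le_lt_trans _ _ (Num.max 0 M)) ?ltrDl ?le_max ?lexx ?orbT// => /(_ isT) RM.
have C0 : 0 <= Num.max 0 M + 1 by rewrite addr_ge0// le_max lexx.
apply: (@riesz _ _ ip sepX (fun x => ip (R x) z) ((Num.max 0 M + 1) * `|z|)).
- by rewrite mulr_ge0.
- by move=> x y; rewrite linearD ip_addl.
- by move=> a x; rewrite linearZ ipZl.
- move=> x; rewrite (le_trans (ip_bound _ _ _))// mulrAC ler_wpM2r//.
Qed.

Section SmoothParts.
Context (K : realType) (X : completeNormedModType K) (ip : inner_product X).
Context (sepX : separable_space X) (nu : probability (borel X) K).
Context (w : X -> K) (h : X) (wi : rintegrable nu (w : borel X -> K)).
(** [h] is a direction along which [nu] has logarithmic derivative [- w]. *)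
Hypothesis parts : forall phi : X -> K, C1b ip phi ->
  \int[nu]_x ip (frechet_grad ip phi x) h = \int[nu]_x (phi x * w x).

Let blip_int M L (phi : X -> K) : blip M L phi -> rintegrable nu (phi : borel X -> K).
Proof.
move=> bl; apply: (@finite_bounded_integrable _ _ _ _ _ M); last by case: bl.
exact: blip_measurable bl.
Qed.

Lemma blip_shift M L (phi : X -> K) (a : X) : blip M L phi ->
  blip M L (fun x => phi (x + a)).
Proof.
move=> [pM pL]; split=> [x|x y]; first exact: pM.
by rewrite (le_trans (pL _ _))// opprD addrACA subrr addr0.
Qed.

Section Smooth.
Context (M L : K) (phi : X -> K) (L0 : 0 <= L) (bphi : blip M L phi).
Hypothesis dphi : forall x, differentiable phi x.

Let f (s : K) (x : borel X) := phi ((x : X) + s *: h).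

Let Df (s : K) (x : X) : K := 'D_h (fun y => phi (y + s *: h)) x.

Let differentiable_shift s x : differentiable (fun y => phi (y + s *: h)) x.
Proof.
exact: (@differentiable_comp _ _ _ _ (fun y => y + s *: h) phi).
Qed.

Let derivable_f (s : K) (x : borel X) : is_derive s (1 : K) (f ^~ x) (Df s x).
Proof.
have E : (fun t : K => t^-1 *: (((fun y => phi (y + s *: h)) \o shift (x : X)) (t *: h) -
    phi ((x : X) + s *: h))) =
  (fun t : K => t^-1 *: ((f ^~ x \o shift s) (t *: 1) - f s x)).
  apply/funext => t /=; rewrite /f scaler1 scalerDl; congr (_ *: (phi _ - _)).
  by rewrite -addrA addrCA.
apply: DeriveDef; last by rewrite /Df /derive E.
have : derivable (fun y => phi (y + s *: h)) x h by exact: diff_derivable.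
by rewrite /derivable E.
Qed.

Let Df_le s x : `|Df s x| <= L * `|h|.
Proof.
rewrite /Df (derive_frechet ip sepX)// (le_trans (ip_bound _ _ _))// ler_wpM2r//.
exact: frechet_grad_le (blip_shift _ bphi) _.
Qed.

Let F (s : K) : K := \int[nu]_x f s x.

Let is_derive_F (s : K) : is_derive s (1 : K) F (\int[nu]_x (phi (x + s *: h) * w x)).
Proof.
have h1 : `]s - 1, s + 1[%classic s by rewrite /= in_itv/= ltrBlDr ltrDl ltr01.
have h2 t : `]s - 1, s + 1[%classic t -> rintegrable nu (f t).
  by move=> _; exact: blip_int (blip_shift _ bphi).
have h3 t y : `]s - 1, s + 1[%classic t -> setT y -> derivable (f ^~ y) t 1.
  by move=> _ _; apply: ex_derive; exact: derivable_f.
have h4 : rintegrable nu (fun _ : borel X => L * `|h|).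
  by apply: (@finite_bounded_integrable _ _ _ _ _ `|L * `|h| |).
have h5 t y : `]s - 1, s + 1[%classic t -> setT y ->
    `|partial1of2 f t y| <= L * `|h|.
  by move=> _ _; rewrite partial1of2E (@derive_val _ _ _ _ _ _ _ (derivable_f t y)).
have h6 : forall y : borel X, 0 <= L * `|h| by move=> _; rewrite mulr_ge0.
apply: DeriveDef.
  exact: (@derivable_under_integral _ _ _ nu f setT measurableT s (s - 1) (s + 1)
    h1 h2 h3 (fun=> L * `|h|) h6 h4 h5).
have := @differentiation_under_integral _ _ _ nu f setT measurableT s (s - 1) (s + 1)
    h1 h2 h3 (fun=> L * `|h|) h6 h4 h5.
rewrite derive1E => ->.
rewrite -parts; last first.
  have bs := blip_shift (s *: h) bphi; split => //.
    by apply/(boundedP (V := K)); exists M => x _; case: bs.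
  by apply/boundedP; exists L => x _; exact: frechet_grad_le bs _.
apply: eq_Rintegral => x _.
by rewrite partial1of2E (@derive_val _ _ _ _ _ _ _ (derivable_f s x)) /Df (derive_frechet ip sepX).
Qed.

(** By the hypothesis on the translates of [phi], the function
[t |-> \int phi (x + t *: h)] has derivative [\int phi (x + t *: h) * w x], which
is Lipschitz in [t]; the mean value theorem gives the remainder. *)
Lemma smooth_shift_parts t : 0 < t ->
  `|\int[nu]_x phi (x + t *: h) - \int[nu]_x phi x - t * \int[nu]_x (phi x * w x)|
  <= L * `|h| * (\int[nu]_x `|w x|) * t ^+ 2.
Proof.
move=> t0.
have cF : {within `[0, t], continuous F}.
  apply: derivable_within_continuous => s _.
  by apply: ex_derive; exact: is_derive_F.
have [c] := @MVT K F (fun s => \int[nu]_x (phi (x + s *: h) * w x)) 0 t t0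
  (fun s _ => is_derive_F s) cF.
rewrite in_itv/= => /andP[c0 ct]; rewrite subr0 => Ft.
have F0 : F 0 = \int[nu]_x phi x.
  by apply: eq_Rintegral => x _; rewrite /f scale0r addr0.
rewrite -F0 -/(F t) Ft mulrC -mulrBr normrM (gtr0_norm t0) mulrC expr2 mulrA ler_wpM2r//.
  exact: ltW.
have bwi (psi : X -> K) : blip M L psi -> rintegrable nu (fun x : borel X => psi x * w x).
  move=> bp; under eq_fun do rewrite mulrC.
  apply: (@rintMb _ _ _ _ _ _ M) => //; last by case: bp.
  exact: blip_measurable bp.
rewrite -RintegralB//; [|exact: bwi (blip_shift _ bphi)|exact: bwi].
apply: le_trans (le_normr_Rintegral _ _) _ => //.
  by apply: rintB; [exact: bwi (blip_shift _ bphi)|exact: bwi].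
rewrite mulrAC -RintegralZl//; last exact: rint_abs.
apply: le_Rintegral => //.
- by apply: rint_abs; apply: rintB; [exact: bwi (blip_shift _ bphi)|exact: bwi].
- by apply: rintZ; exact: rint_abs.
move=> x _; rewrite -mulrBl normrM ler_wpM2r//.
case: bphi => _ /(_ (x + c *: h) x)/le_trans; apply.
rewrite addrC addKr normrZ (gtr0_norm c0) -mulrA ler_wpM2l//.
by rewrite [leLHS]mulrC ler_wpM2l// ltW.
Qed.

End Smooth.

(** The estimate for smooth functions involves only the Lipschitz constant, so it
passes to pointwise limits of uniformly Lipschitz functions. *)
Lemma shift_parts M L (phi : X -> K) t : 0 <= L -> blip M L phi -> 0 < t ->
  `|\int[nu]_x phi (x + t *: h) - \int[nu]_x phi x - t * \int[nu]_x (phi x * w x)|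
  <= L * `|h| * (\int[nu]_x `|w x|) * t ^+ 2.
Proof.
move=> L0 bphi t0.
have [psi [_ dpsi bpsi cpsi]] := smooth_approx ip sepX L0 bphi.
have c1 : (fun n => \int[nu]_x psi n (x + t *: h)) @ \oo --> \int[nu]_x phi (x + t *: h).
  apply: (@Rintegral_dct _ _ _ nu _ _ (fun=> M + 1)) => [n|x|n x|].
  - exact: blip_measurable (blip_shift _ (bpsi n)).
  - exact: cpsi.
  - by case: (bpsi n).
  - by apply: (@finite_bounded_integrable _ _ _ _ _ `|M + 1|).
have c2 : (fun n => \int[nu]_x psi n x) @ \oo --> \int[nu]_x phi x.
  apply: (@Rintegral_dct _ _ _ nu _ _ (fun=> M + 1)) => [n|x|n x|].
  - exact: blip_measurable (bpsi n).
  - exact: cpsi.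
  - by case: (bpsi n).
  - by apply: (@finite_bounded_integrable _ _ _ _ _ `|M + 1|).
have c3 : (fun n => \int[nu]_x (psi n x * w x)) @ \oo --> \int[nu]_x (phi x * w x).
  apply: (@Rintegral_dct _ _ _ nu _ _ (fun x => (M + 1) * `|w x|)) => [n|x|n x|].
  - apply: measurable_funM; first exact: blip_measurable (bpsi n).
    exact: rint_measurable wi.
  - by apply: cvgMl; exact: cpsi.
  - by rewrite normrM ler_wpM2r//; case: (bpsi n).
  - by apply: rintZ; exact: rint_abs.
have c : (fun n => `|\int[nu]_x psi n (x + t *: h) - \int[nu]_x psi n x -
    t * \int[nu]_x (psi n x * w x)|) @ \oo -->
  `|\int[nu]_x phi (x + t *: h) - \int[nu]_x phi x - t * \int[nu]_x (phi x * w x)|.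
  by apply: cvg_norm; apply: cvgB; [exact: cvgB|exact: cvgMr].
rewrite -(cvg_lim _ c)//; apply: limr_le; first by apply/cvg_ex; eexists; exact: c.
by apply: nearW => n; exact: (smooth_shift_parts L0 (bpsi n)).
Qed.

(** Since the bound above is quadratic in [t], dividing by [t] and letting [t]
tend to 0 gives integration by parts for Lipschitz functions. *)
Lemma lipschitz_parts M L (phi : X -> K) : 0 <= L -> blip M L phi ->
  (fun n => \int[nu]_x diffq h phi n x) @ \oo --> \int[nu]_x (phi x * w x).
Proof.
move=> L0 bphi; pose C := L * `|h| * (\int[nu]_x `|w x|).
apply/cvgrPdist_le => e e0.
have C1 : 0 < `|C| + 1 by rewrite ltr_wpDl.
have [N _ hN] := near_infty_natSinv_lt (PosNum (divr_gt0 e0 C1)).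
exists N => // n /hN /=; rewrite ltr_pdivlMr// => hn.
have n0 : 0 < n.+1%:R^-1 :> K by rewrite invr_gt0.
have := shift_parts L0 bphi n0; rewrite -/C.
have -> : \int[nu]_x diffq h phi n x =
    n.+1%:R * (\int[nu]_x phi (x + n.+1%:R^-1 *: h) - \int[nu]_x phi x).
  rewrite -RintegralB//; [|exact: blip_int (blip_shift _ bphi)|exact: blip_int bphi].
  rewrite -RintegralZl//; apply: rintB; last exact: blip_int bphi.
  exact: blip_int (blip_shift _ bphi).
set A := _ - \int[nu]_x phi x; set B := \int[nu]_x (_ * _).
move: A B => A B hC.
have -> : B - n.+1%:R * A = - (n.+1%:R * (A - n.+1%:R^-1 * B)).
  by rewrite mulrBr mulrA divff ?pnatr_eq0// mul1r opprB.
rewrite normrN normrM ger0_norm//.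
rewrite (@le_trans _ _ (n.+1%:R * (C * n.+1%:R^-1 ^+ 2)))// ?ler_wpM2l//.
have -> : n.+1%:R * (C * n.+1%:R^-1 ^+ 2) = n.+1%:R^-1 * C.
  have : n.+1%:R != 0 :> K by rewrite pnatr_eq0.
  by move: (n.+1%:R) => q q0; field.
apply: le_trans (ltW hn); rewrite ler_wpM2l ?(ltW n0)//.
by rewrite (le_trans (ler_norm _))// lerDl.
Qed.

End SmoothParts.

(** * Integrals of almost everywhere defined functions and L1 density *)

Section AeEqual.
Import HBSimple HBNNSimple.
Context d (S : measurableType d) (K : realType) (m : {measure set S -> \bar K}).

Let ge0_ae_le (f g : S -> \bar K) (N : set S) : measurable N -> m N = 0%E ->
  (forall x, (0 <= f x)%E) -> (forall x, (0 <= g x)%E) ->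
  (forall x, ~ N x -> (f x <= g x)%E) -> (\int[m]_x f x <= \int[m]_x g x)%E.
Proof.
move=> mN N0 f0 g0 fg; rewrite !ge0_integralTE//.
apply: ge_ereal_sup => _ [h hf <-].
have mNC : measurable (~` N) by exact: measurableC.
apply: ereal_sup_ubound; exists (proj_nnsfun h mNC).
  move=> x /=; rewrite mindicE; have [Nx|Nx] := pselect (N x).
    by rewrite memNset ?mulr0//= => /(_ Nx).
  by rewrite mem_set// mulr1 (le_trans (hf x))// fg.
rewrite -!integralT_nnsfun; apply: ae_eq_integral => //.
- by apply/measurable_EFinP.
- by apply/measurable_EFinP.
exists N; split=> // x /= nx; apply: contrapT => Nx; apply: nx => _.
by rewrite mindicE mem_set//= mulr1.
Qed.

(** The integral of a nonnegative function is a supremum over simple functions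
below it, whose integrals do not change when they are cut off on a null set.
Gradients are not known to be measurable, so this generality matters. *)
Lemma Rintegral_ae_eq (f g : S -> K) : {ae m, forall x, f x = g x} ->
  \int[m]_x f x = \int[m]_x g x.
Proof.
move=> [N [mN N0 fgN]]; rewrite /Rintegral; congr fine.
have fg x : ~ N x -> f x = g x.
  by move=> Nx; apply: contrapT => h; apply: Nx; exact: fgN.
rewrite integralE [in RHS]integralE; congr (_ - _)%E; apply/eqP; rewrite eq_le;
  apply/andP; split; apply: (ge0_ae_le mN N0) => // x Nx;
  by rewrite ?funeposE ?funenegE fg.
Qed.

End AeEqual.

Section L1Density.
Import HBSimple HBNNSimple.
Context (K : realType) (X : completeNormedModType K).
Context (m : {finite_measure set (borel X) -> \bar K}).

Let approx (F : borel X -> K) := forall e, 0 < e ->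
  exists (eta : X -> K) (M : K), blip M M eta /\ \int[m]_x `|F x - eta x| <= e.

Let blip_int M L (phi : X -> K) : blip M L phi -> rintegrable m (phi : borel X -> K).
Proof.
move=> bl; apply: (@finite_bounded_integrable _ _ _ _ _ M); last by case: bl.
exact: blip_measurable bl.
Qed.

Let approxD F G : rintegrable m F -> rintegrable m G -> approx F -> approx G ->
  approx (fun x => F x + G x).
Proof.
move=> Fi Gi aF aG e e0; have e2 : 0 < e / 2 by rewrite divr_gt0.
have [a [M [ba aE]]] := aF _ e2; have [b [M' [bb bE]]] := aG _ e2.
exists (fun x => a x + b x), (M + M'); split; first exact: blipD.
have ia := blip_int ba; have ib := blip_int bb.
rewrite (splitr e) (le_trans _ (lerD aE bE))//.
rewrite -RintegralD//; [|by apply: rint_abs; exact: rintB..].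
apply: le_Rintegral => //.
- by apply: rint_abs; apply: rintB; exact: rintD.
- by apply: rintD; apply: rint_abs; exact: rintB.
move=> x _; apply: le_trans (ler_normD _ _).
by rewrite opprD addrACA.
Qed.

Let approx_indic r (B : set (borel X)) : measurable B -> approx (fun x => r * \1_B x).
Proof.
move=> mB e e0; have r1 : 0 < `|r| + 1 by rewrite ltr_wpDl.
have i1 : rintegrable m (fun=> 1 : K).
  by apply: (@finite_bounded_integrable _ _ _ _ _ 1) => // x; rewrite normr1.
have [eta [L [be e01 hE]]] := borel_lipschitz_approx i1 mB (divr_gt0 e0 r1).
have := blip_max (blipM (blip_cst X (r : K^o)) be); set M := Num.max _ _ => bM.
exists (fun x => r * eta x), M; split => //.
have ie := blip_int be.
have iB : rintegrable m (\1_B : borel X -> K).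
  apply: (@finite_bounded_integrable _ _ _ _ _ 1); first exact: measurable_indic.
  by move=> x; rewrite indicE; case: (_ \in _); rewrite ?normr1 ?normr0.
have -> : \int[m]_x `|r * \1_B x - r * eta x| = `|r| * \int[m]_x (`|eta x - \1_B x| * `|1%R : K|).
  rewrite -RintegralZl//.
    by apply: eq_Rintegral => x _; rewrite -mulrBr normrM normr1 mulr1 distrC.
  by under eq_fun do rewrite normr1 mulr1; apply: rint_abs; exact: rintB.
rewrite mulrC; apply: le_trans (ler_wpM2r (normr_ge0 r) hE) _.
by rewrite mulrAC ler_pdivrMr// ler_wpM2l ?lerDl// ltW.
Qed.

Lemma L1_lipschitz_approx F : rintegrable m F -> approx F.
Proof.
move=> Fi e e0; have e2 : 0 < e / 2 by rewrite divr_gt0.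
have [g [gi _ gF]] := approximation_sfun_integrable measurableT Fi.
have := gF => /fine_cvgP[_ /cvgrPdist_le/(_ _ e2)[N _ hN]].
have {hN} hN : \int[m]_x `|F x - g N x| <= e / 2.
  by have := hN N (leqnn N); rewrite sub0r normrN => /(le_trans (ler_norm _)).
have ag : approx (g N).
  pose s := finmap.enum_fset (fset_set (range (g N))).
  have gE x : g N x = \sum_(y <- s) y * \1_(g N @^-1` [set y]) x.
    by rewrite fimfunE fsbig_finite.
  have -> : (g N : borel X -> K) =
      fun x => \sum_(y <- s) y * \1_(g N @^-1` [set y]) x by exact/funext.
  have mg y : measurable (g N @^-1` [set y]) by exact: measurable_funPTI.
  have ii (s' : seq K) : rintegrable m
      (fun x => \sum_(y <- s') y * \1_(g N @^-1` [set y]) x).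
    elim: s' => [|y s' IH].
      under eq_fun do rewrite big_nil.
      by apply: (@finite_bounded_integrable _ _ _ _ _ 0) => // x; rewrite normr0.
    under eq_fun do rewrite big_cons.
    apply: rintD => //; apply: rintZ.
    apply: (@finite_bounded_integrable _ _ _ _ _ 1); first exact: measurable_indic.
    by move=> x; rewrite indicE; case: (_ \in _); rewrite ?normr1 ?normr0.
  elim: s {gE} => [|y s IH].
    under eq_fun do rewrite big_nil.
    move=> t t0; exists (fun=> 0), 0; split.
      by split=> [x|x y]; rewrite ?subrr normr0 ?mul0r.
    under eq_Rintegral do rewrite subr0 normr0.
    by rewrite /Rintegral integral0 ltW.
  under eq_fun do rewrite big_cons.
  apply: approxD => //; last exact: approx_indic.
  by have := ii [:: y]; under eq_fun do rewrite big_seq1.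
have [eta [M [be hE]]] := ag _ e2; exists eta, M; split=> //.
rewrite (splitr e) (le_trans _ (lerD hN hE))//.
have ie := blip_int be; have ig := gi N.
rewrite -RintegralD//; [|by apply: rint_abs; exact: rintB..].
apply: le_Rintegral => //.
- by apply: rint_abs; exact: rintB.
- by apply: rintD; apply: rint_abs; exact: rintB.
move=> x _; apply: le_trans (ler_normD _ _).
by rewrite addrA subrK.
Qed.

End L1Density.

Section DirectionalDerivative.
Context (K : realType) (X : completeNormedModType K).
Implicit Types (phi psi : X -> K) (h : X).

(** A Borel version of the derivative of a Lipschitz function in the direction
[h], with the same bound as the difference quotients at every point. *)
Definition pder h phi (x : X) : K :=
  fine (limn_esup (fun n => (diffq h phi n x)%:E)).

Lemma pder_cvg h phi x (l : K) : (fun n => diffq h phi n x) @ \oo --> l ->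
  pder h phi x = l.
Proof.
move=> c; rewrite /pder.
have c' : (fun n => (diffq h phi n x)%:E) @ \oo --> l%:E.
  by apply: cvg_EFin => //; exact: nearW.
by rewrite (cvg_limn_einf_sup c').2.
Qed.

Lemma limn_esup_bound (u : nat -> \bar K) c : (forall n, (`|u n| <= c%:E)%E) ->
  `|fine (limn_esup u)| <= c.
Proof.
move=> uc; rewrite limn_esup_lim.
have uc2 n : (- c%:E <= u n)%E /\ (u n <= c%:E)%E.
  have := uc n; case: (u n) => [r| |] //=.
  by rewrite !lee_fin ler_norml => /andP[].
have lo n : (- c%:E <= esups u n)%E.
  apply: le_trans (_ : (u n <= _)%E); first by have [] := uc2 n.
  by apply: ereal_sup_ubound; exists n => /=.
have up n : (esups u n <= c%:E)%E.
  apply: ge_ereal_sup => _ [k _ <-].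
  by have [] := uc2 k.
have h1 : (- c%:E <= limn (esups u))%E.
  by apply: lime_ge; [exact: is_cvg_esups|exact: nearW].
have h2 : (limn (esups u) <= c%:E)%E.
  by apply: lime_le; [exact: is_cvg_esups|exact: nearW].
move: h1 h2; case: (limn _) => [r| |] //=.
  by rewrite !lee_fin ler_norml => -> ->.
Qed.

Lemma pder_le M L h phi x : blip M L phi -> `|pder h phi x| <= L * `|h|.
Proof.
by move=> bp; apply: limn_esup_bound => n; rewrite lee_fin; exact: diffq_le bp.
Qed.

Lemma diffq_measurable M L h phi n : blip M L phi ->
  measurable_fun [set: borel X] (diffq h phi n : borel X -> K).
Proof.
move=> bp; apply: measurable_funM; first exact: measurable_cst.
apply: measurable_funB; last exact: blip_measurable bp.
exact: blip_measurable (blip_shift _ bp).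
Qed.

Lemma pder_measurable M L h phi : blip M L phi ->
  measurable_fun [set: borel X] (pder h phi : borel X -> K).
Proof.
move=> bp; apply: measurableT_comp => //.
apply: measurable_fun_limn_esup => n.
by apply/measurable_EFinP; exact: diffq_measurable bp.
Qed.

Lemma cvg_diffqM phi psi h x (a b M L : K) : blip M L psi ->
  (fun n => diffq h phi n x) @ \oo --> a ->
  (fun n => diffq h psi n x) @ \oo --> b ->
  (fun n => diffq h (fun y => phi y * psi y) n x) @ \oo --> a * psi x + phi x * b.
Proof.
move=> bp ca cb.
have cx : (fun n => psi (x + n.+1%:R^-1 *: h)) @ \oo --> psi x.
  apply: (@continuous_cvg _ _ _ _ _ (fun n : nat => x + n.+1%:R^-1 *: h) psi).
    exact: (blip_continuous bp).
  rewrite -[X in _ --> X]addr0; apply: cvgD; first exact: cvg_cst.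
  by rewrite -(scale0r h); apply: cvgZr_tmp; exact: cvg_harmonic.
have -> : (fun n => diffq h (fun y => phi y * psi y) n x) =
  (fun n => diffq h phi n x * psi (x + n.+1%:R^-1 *: h) + phi x * diffq h psi n x).
  by apply/funext => n; rewrite /diffq; ring.
by apply: cvgD; [exact: cvgM|exact: cvgMr].
Qed.

Lemma cvg_diffqD phi psi h x (a b c : K) :
  (fun n => diffq h phi n x) @ \oo --> a ->
  (fun n => diffq h psi n x) @ \oo --> b ->
  (fun n => diffq h (fun y => c * phi y + psi y) n x) @ \oo --> c * a + b.
Proof.
move=> ca cb.
have -> : (fun n => diffq h (fun y => c * phi y + psi y) n x) =
  (fun n => c * diffq h phi n x + diffq h psi n x).
  by apply/funext => n; rewrite /diffq; ring.
by apply: cvgD => //; exact: cvgMr.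
Qed.

End DirectionalDerivative.

(** * Calculus for Lipschitz functions *)

Section AlmostEverywhere.
Context d (S : measurableType d) (K : realType) (m : probability S K).

Lemma ae_imply (P Q : S -> Prop) : (forall x, P x -> Q x) ->
  {ae m, forall x, P x} -> {ae m, forall x, Q x}.
Proof. by move=> PQ; apply: filterS => x; exact: PQ. Qed.

Lemma ae_imply2 (P P' Q : S -> Prop) : (forall x, P x -> P' x -> Q x) ->
  {ae m, forall x, P x} -> {ae m, forall x, P' x} -> {ae m, forall x, Q x}.
Proof. by move=> PQ; apply: filterS2 => x; exact: PQ. Qed.

End AlmostEverywhere.

Section LipschitzCalculus.
Context (K : realType) (X : completeNormedModType K) (ip : inner_product X).
Context (sepX : separable_space X) (nu : probability (borel X) K).
Hypothesis lip_gateaux : forall phi : X -> K, [lipschitz phi x | x in setT] ->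
  {ae nu, forall x, gateaux_differentiable ip phi x}.
Implicit Types (phi psi : X -> K) (h : X).

Let blip_int M L phi : blip M L phi -> rintegrable nu (phi : borel X -> K).
Proof.
move=> bl; apply: (@finite_bounded_integrable _ _ _ _ _ M); last by case: bl.
exact: blip_measurable bl.
Qed.

Lemma ae_cvg_diffq M L phi : blip M L phi -> {ae nu, forall x, forall h,
  (fun n => diffq h phi n x) @ \oo --> ip (gateaux_grad ip phi x) h}.
Proof.
move=> [_ pL]; have /lip_gateaux : [lipschitz phi x | x in setT].
  by apply/lipschitzP; exists L.
apply: ae_imply => x [g hg] h; apply: cvg_diffq.
have := @xgetPex _ 0 [set g | forall h, is_derive x h phi (ip g h)] (ex_intro _ g hg).
exact.
Qed.

Lemma ae_pder M L phi : blip M L phi -> {ae nu, forall x, forall h,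
  pder h phi x = ip (gateaux_grad ip phi x) h}.
Proof.
by move=> /ae_cvg_diffq; apply: ae_imply => x hx h; exact: pder_cvg (hx h).
Qed.

Lemma pder_int M L phi h : blip M L phi -> rintegrable nu (pder h phi : borel X -> K).
Proof.
move=> bp; apply: (@finite_bounded_integrable _ _ _ _ _ (L * `|h|)).
  exact: pder_measurable bp.
by move=> x; exact: pder_le bp.
Qed.

Section Direction.
Context (w : X -> K) (h : X) (wi : rintegrable nu (w : borel X -> K)).
Hypothesis parts : forall phi, C1b ip phi ->
  \int[nu]_x ip (frechet_grad ip phi x) h = \int[nu]_x (phi x * w x).

Lemma pder_parts M phi : blip M M phi ->
  \int[nu]_x pder h phi x = \int[nu]_x (phi x * w x).
Proof.
move=> bp; have M0 := blip_ge0 bp.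
have c1 := lipschitz_parts sepX wi parts M0 bp.
suff c2 : (fun n => \int[nu]_x diffq h phi n x) @ \oo --> \int[nu]_x pder h phi x.
  by rewrite -(cvg_lim _ c1)// -(cvg_lim _ c2).
have [|||||_ _ c] := @dominated_convergence _ _ _ nu setT measurableT
    (fun n x => (diffq h phi n x)%:E) (fun x => (pder h phi x)%:E) (fun=> (M * `|h|)%:E).
- by move=> n; apply/measurable_EFinP; exact: diffq_measurable bp.
- by apply/measurable_EFinP; exact: pder_measurable bp.
- have := ae_cvg_diffq bp; apply: ae_imply => x hx _.
  by rewrite (pder_cvg (hx h)); apply: cvg_EFin; [exact: nearW|exact: hx].
- apply: (@finite_bounded_integrable _ _ _ nu (fun=> M * `|h|) `|M * `|h| |) => //.
- apply: aeW => x n _; rewrite lee_fin; exact: diffq_le bp.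
apply: fine_cvg; rewrite fineK; first exact: c.
by apply: integrable_fin_num => //; exact: pder_int bp.
Qed.

Lemma pder_parts_mul M M' phi psi : blip M M phi -> blip M' M' psi ->
  \int[nu]_x (psi x * pder h phi x) =
  \int[nu]_x (phi x * (psi x * w x)) - \int[nu]_x (phi x * pder h psi x).
Proof.
move=> bp bq.
have bpq := blipM bp bq.
have := pder_parts (blip_max bpq).
have -> : \int[nu]_x pder h (fun y => phi y * psi y) x =
  \int[nu]_x (psi x * pder h phi x + phi x * pder h psi x).
  apply: Rintegral_ae_eq; apply: ae_imply2 (ae_cvg_diffq bp) (ae_cvg_diffq bq).
  move=> x hp hq; rewrite (pder_cvg (cvg_diffqM bq (hp h) (hq h))).
  by rewrite (pder_cvg (hp h)) (pder_cvg (hq h)) mulrC.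
have i1 : rintegrable nu (fun x : borel X => psi x * pder h phi x).
  exact: (rintMb (blip_int bq) (pder_measurable h bp) (fun x => pder_le h x bp)).
have i2 : rintegrable nu (fun x : borel X => phi x * pder h psi x).
  exact: (rintMb (blip_int bp) (pder_measurable h bq) (fun x => pder_le h x bq)).
rewrite RintegralD// => E.
have -> : \int[nu]_x (phi x * (psi x * w x)) = \int[nu]_x (phi x * psi x * w x).
  by apply: eq_Rintegral => x _; rewrite mulrA.
by rewrite -E addrK.
Qed.

(** For a Lipschitz weight, integration by parts moves the derivative to the weight
and dominated convergence applies. Lipschitz weights are dense in [L^1], and the
derivatives are uniformly bounded. *)
Lemma pder_weak_cvg (F : borel X -> K) L (phi : nat -> X -> K) :
  rintegrable nu F -> (forall n, blip L L (phi n)) ->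
  (forall x, phi ^~ x @ \oo --> 0) ->
  (fun n => \int[nu]_x (F x * pder h (phi n) x)) @ \oo --> 0.
Proof.
move=> Fi bp p0; have L0 := blip_ge0 (bp 0%N).
have mw := rint_measurable wi.
have lipc M (eta : X -> K) : blip M M eta ->
    (fun n => \int[nu]_x (eta x * pder h (phi n) x)) @ \oo --> 0.
  move=> be; under eq_fun do rewrite (pder_parts_mul (bp _) be).
  rewrite -(subr0 (0 : K)); apply: cvgB.
    apply: (@Rintegral_dct0 _ _ _ nu _ (fun x => L * (M * `|w x|))).
    - move=> n; apply: measurable_funM; first exact: blip_measurable (bp n).
      by apply: measurable_funM => //; exact: blip_measurable be.
    - by move=> x; rewrite -(mul0r (eta x * w x)); apply: cvgMl; exact: p0.
    - move=> n x; rewrite !normrM ler_pM//; first by case: (bp n).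
      by rewrite ler_wpM2r//; case: be.
    - by apply: rintZ; apply: rintZ; exact: rint_abs.
  apply: (@Rintegral_dct0 _ _ _ nu _ (fun x => L * (M * `|h|))).
  - move=> n; apply: measurable_funM; first exact: blip_measurable (bp n).
    exact: pder_measurable be.
  - by move=> x; rewrite -(mul0r (pder h eta x)); apply: cvgMl; exact: p0.
  - move=> n x; rewrite normrM ler_pM//; first by case: (bp n).
    exact: pder_le be.
  - by apply: (@finite_bounded_integrable _ _ _ _ _ `|L * (M * `|h|)|).
apply/cvgrPdist_le => e e0.
have c0 : 0 < 2 * (L * `|h| + 1) by rewrite mulr_gt0// ltr_wpDl// mulr_ge0.
have e2 : 0 < e / 2 by rewrite divr_gt0.
have [eta [M [be hE]]] := L1_lipschitz_approx Fi (divr_gt0 e0 c0).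
have /cvgrPdist_le/(_ _ e2) := lipc _ _ be; apply: filterS => n.
rewrite !sub0r !normrN => hn.
have pb x : `|pder h (phi n) x| <= L * `|h| by exact: pder_le (bp n).
have i1 : rintegrable nu (fun x : borel X => F x * pder h (phi n) x).
  exact: rintMb Fi (pder_measurable h (bp n)) pb.
have i2 : rintegrable nu (fun x : borel X => eta x * pder h (phi n) x).
  exact: rintMb (blip_int be) (pder_measurable h (bp n)) pb.
have i3 : rintegrable nu (fun x : borel X => F x - eta x).
  exact: rintB Fi (blip_int be).
have -> : \int[nu]_x (F x * pder h (phi n) x) =
    \int[nu]_x ((F x - eta x) * pder h (phi n) x) + \int[nu]_x (eta x * pder h (phi n) x).
  rewrite -RintegralD//; last exact: rintMb i3 (pder_measurable h (bp n)) pb.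
  by apply: eq_Rintegral => x _; rewrite mulrBl subrK.
rewrite (le_trans (ler_normD _ _))// (splitr e) lerD//.
rewrite (le_trans (le_normr_Rintegral _ _))//.
  exact: rintMb i3 (pder_measurable h (bp n)) pb.
apply: (@le_trans _ _ (\int[nu]_x ((L * `|h|) * `|F x - eta x|))).
  apply: le_Rintegral => //.
  - by apply: rint_abs; exact: rintMb i3 (pder_measurable h (bp n)) pb.
  - by apply: rintZ; exact: rint_abs.
  - by move=> x _; rewrite normrM mulrC ler_wpM2r.
rewrite RintegralZl//; last exact: rint_abs.
have Lh : 0 <= L * `|h| by rewrite mulr_ge0.
apply: (@le_trans _ _ (L * `|h| * (e / (2 * (L * `|h| + 1))))).
  by rewrite ler_wpM2l.
move: (L * `|h|) Lh c0 {hE} => c Lh c0.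
rewrite mulrA ler_pdivrMr// -[leRHS]mulrA mulrC ler_wpM2l ?(ltW e0)//; lra.
Qed.

End Direction.
End LipschitzCalculus.

(** * The divergence functional *)

Section DivergenceFunctional.
Context (K : realType) (X : completeNormedModType K) (ip : inner_product X).
Context (sepX : separable_space X) (nu : probability (borel X) K).
Hypothesis lip_gateaux : forall phi : X -> K, [lipschitz phi x | x in setT] ->
  {ae nu, forall x, gateaux_differentiable ip phi x}.
Context (R : {linear X -> X}) (adj : X -> X) (v : X -> X -> K).
Hypothesis adjP : forall x z, ip (R x) z = ip x (adj z).
Hypothesis vi : forall z, rintegrable nu (v z : borel X -> K).
Hypothesis v_parts : forall (z : X) (phi : X -> K), C1b ip phi ->
  \int[nu]_x ip (R (frechet_grad ip phi x)) z = \int[nu]_x (phi x * v z x).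
Implicit Types (phi psi : X -> K) (z : X).

Let parts z phi : C1b ip phi ->
  \int[nu]_x ip (frechet_grad ip phi x) (adj z) = \int[nu]_x (phi x * v z x).
Proof. by move=> /(v_parts z) <-; apply: eq_Rintegral => x _; rewrite adjP. Qed.

Let adj_lin a z z' : adj (a *: z + z') = a *: adj z + adj z'.
Proof.
apply: (@ip_inj _ _ ip) => h.
by rewrite !(ipC _ _ h) -adjP ip_addr ip_scaler !adjP ip_addr ip_scaler.
Qed.

Lemma ae_pder_lin M L phi a z z' : blip M L phi -> {ae nu, forall x,
  pder (adj (a *: z + z')) phi x = a * pder (adj z) phi x + pder (adj z') phi x}.
Proof.
move=> /(ae_pder lip_gateaux); apply: ae_imply => x hx.
by rewrite !hx adj_lin ip_addr ip_scaler.
Qed.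

(** Integration by parts gives both sides the same integrals against Lipschitz
functions, which separate integrable functions. *)
Lemma ae_v_lin a z z' : {ae nu, forall x, v (a *: z + z') x = a * v z x + v z' x}.
Proof.
pose u x := v (a *: z + z') x - (a * v z x + v z' x).
have iu : rintegrable nu (u : borel X -> K).
  by apply: rintB; [exact: vi|apply: rintD; [apply: rintZ; exact: vi|exact: vi]].
have mulv M (eta : X -> K) y : blip M M eta -> rintegrable nu (fun x : borel X => eta x * v y x).
  move=> be; under eq_fun do rewrite mulrC.
  by apply: (rintMb (vi y) (blip_measurable be) (M := M)); case: be.
have lip0 M (eta : X -> K) : blip M M eta -> \int[nu]_x (eta x * u x) = 0.
  move=> be.
  have -> : \int[nu]_x (eta x * u x) = \int[nu]_x (eta x * v (a *: z + z') x) -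
      (a * \int[nu]_x (eta x * v z x) + \int[nu]_x (eta x * v z' x)).
    rewrite -RintegralZl//; last exact: mulv be.
    rewrite -RintegralD//; [|by apply: rintZ; exact: mulv be|exact: mulv be].
    rewrite -RintegralB//; [|exact: mulv be|
      by apply: rintD; [apply: rintZ|]; exact: mulv be].
    by apply: eq_Rintegral => x _; rewrite /u; ring.
  rewrite -!(pder_parts sepX lip_gateaux (vi _) (@parts _) be).
  rewrite (Rintegral_ae_eq (ae_pder_lin a z z' be)).
  have pi y := pder_int nu y be.
  by rewrite RintegralD ?RintegralZl ?subrr//; apply: rintZ.
have ind0 (E : set (borel X)) : measurable E -> \int[nu]_(x in E) u x = 0.
  move=> mE; apply/eqP; rewrite -normr_le0; apply/ler_addgt0Pr => e e0.
  rewrite add0r.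
  have [eta [L [be e01 hE]]] := borel_lipschitz_approx iu mE e0.
  apply: le_trans hE; have bM := blip_max be.
  have -> : \int[nu]_(x in E) u x = - \int[nu]_x ((eta x - \1_E x) * u x).
    rewrite Rintegral_mkcond.
    have -> : \int[nu]_x ((eta x - \1_E x) * u x) =
      \int[nu]_x (eta x * u x) - \int[nu]_x ((u \_ E) x).
      rewrite -RintegralB//.
      - apply: eq_Rintegral => x _; rewrite mulrBl patchE indicE.
        by case: (x \in E); rewrite ?mul1r ?mul0r.
      - under eq_fun do rewrite mulrC.
        by apply: (rintMb iu (blip_measurable be) (M := 1)); case: be.
      - apply: (rint_le iu); last by move=> x; rewrite patchE; case: ifP; rewrite ?normr0.
        by apply/measurable_restrict => //; apply: measurable_funTS; exact: rint_measurable iu.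
    by rewrite (lip0 _ _ bM) sub0r opprK.
  rewrite normrN; apply: le_trans (le_normr_Rintegral _ _) _ => //.
    under eq_fun do rewrite mulrC; apply: (rintMb iu (M := 2)).
      apply: measurable_funB; first exact: blip_measurable be.
      exact: measurable_indic.
    move=> x; have /andP[? ?] := e01 x; rewrite indicE.
    by case: (_ \in _) => /=; rewrite ler_norml; apply/andP; split; lra.
  rewrite le_eqVlt; apply/orP; left; apply/eqP.
  by apply: eq_Rintegral => x _; rewrite normrM.
have [N [mN N0 uN]] : ae_eq nu setT (EFin \o u) (cst 0%E).
  apply: integral_ae_eq => // E _ mE.
  rewrite integral0 -[LHS]fineK; last first.
    by apply: integrable_fin_num => //; exact: integrableS iu.
  by have := ind0 E mE; rewrite /Rintegral => ->.
exists N; split=> // x /= h; apply: uN => /= h'; apply: h.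
by have := h' Logic.I => -[] /eqP; rewrite subr_eq0 => /eqP.
Qed.

Context (F : X -> K) (Fi : rintegrable nu (F : borel X -> K)).
Hypothesis Fvi : forall z, rintegrable nu (fun x : borel X => F x * v z x).

Definition div_integrand z phi x := F x * (pder (adj z) phi x - phi x * v z x).

(** The functional that integration by parts of [F] against [phi] produces; it
is represented by the derivative of [F] in the direction [z] when there is one. *)
Definition div_functional z phi := - \int[nu]_x div_integrand z phi x.

Lemma div_integrand_int M L z phi : blip M L phi ->
  rintegrable nu (div_integrand z phi : borel X -> K).
Proof.
move=> bp; rewrite /div_integrand.
under eq_fun do rewrite mulrBr mulrCA.
apply: rintB; first exact: (rintMb Fi (pder_measurable _ bp) (fun x => pder_le _ x bp)).
under eq_fun do rewrite mulrC.
by apply: (rintMb (Fvi z) (blip_measurable bp) (M := M)); case: bp.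
Qed.

Lemma div_functional_lin a z M L M' L' phi psi : blip M L phi -> blip M' L' psi ->
  div_functional z (fun x => a * phi x + psi x) =
  a * div_functional z phi + div_functional z psi.
Proof.
move=> bp bq; rewrite /div_functional mulrN -opprD; congr (- _).
have ip_ := div_integrand_int z bp; have iq := div_integrand_int z bq.
rewrite -RintegralZl// -RintegralD//; last exact: rintZ.
apply: Rintegral_ae_eq.
apply: ae_imply2 (ae_cvg_diffq lip_gateaux bp) (ae_cvg_diffq lip_gateaux bq) => x hp hq.
rewrite /div_integrand (pder_cvg (hp _)) (pder_cvg (hq _)).
by rewrite (pder_cvg (cvg_diffqD (c := a) (hp _) (hq _))); ring.
Qed.

Lemma div_functional_dirlin a z z' M L phi : blip M L phi ->
  div_functional (a *: z + z') phi = a * div_functional z phi + div_functional z' phi.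
Proof.
move=> bp; rewrite /div_functional mulrN -opprD; congr (- _).
have i1 := div_integrand_int z bp; have i2 := div_integrand_int z' bp.
rewrite -RintegralZl// -RintegralD//; last exact: rintZ.
apply: Rintegral_ae_eq; apply: ae_imply2 (ae_pder_lin a z z' bp) (ae_v_lin a z z').
by move=> x; rewrite /div_integrand => -> ->; ring.
Qed.

Lemma div_functional_cvg z L (phi : nat -> X -> K) : (forall n, blip L L (phi n)) ->
  (forall x, phi ^~ x @ \oo --> 0) ->
  (fun n => div_functional z (phi n)) @ \oo --> 0.
Proof.
move=> bp p0; rewrite /div_functional -(oppr0 K); apply: cvgN.
have i1 n : rintegrable nu (fun x : borel X => F x * pder (adj z) (phi n) x).
  exact: (rintMb Fi (pder_measurable _ (bp n)) (fun x => pder_le _ x (bp n))).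
have i2 n : rintegrable nu (fun x : borel X => F x * v z x * phi n x).
  by apply: (rintMb (Fvi z) (blip_measurable (bp n)) (M := L)); case: (bp n).
have E n : \int[nu]_x div_integrand z (phi n) x =
    \int[nu]_x (F x * pder (adj z) (phi n) x) - \int[nu]_x (F x * v z x * phi n x).
  rewrite -RintegralB//; apply: eq_Rintegral => x _; rewrite /div_integrand; ring.
under eq_fun do rewrite E.
rewrite -(subr0 (0 : K)); apply: cvgB.
  exact: (pder_weak_cvg sepX lip_gateaux (vi z) (@parts z)) bp p0.
apply: (@Rintegral_dct0 _ _ _ nu _ (fun x => L * `|F x * v z x|)).
- by move=> n; exact: rint_measurable (i2 n).
- by move=> x; rewrite -(mulr0 (F x * v z x)); apply: cvgMr; exact: p0.
- by move=> n x; rewrite normrM mulrC ler_wpM2r//; case: (bp n).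
- by apply: rintZ; apply: rint_abs; exact: Fvi.
Qed.

(** The Borel version of the derivative may replace the one obtained from the
gradient, which need not be measurable. *)
Lemma sum_div_functional m (e : 'I_m -> X) (phi : 'I_m -> X -> K) :
  (forall j, exists M, blip M M (phi j)) ->
  \int[nu]_x (F x * \sum_j (ip (R (gateaux_grad ip (phi j) x)) (e j) -
    phi j x * v (e j) x)) = - \sum_j div_functional (e j) (phi j).
Proof.
move=> /choice[M bp].
rewrite -sumrN; under [RHS]eq_bigr do rewrite opprK.
rewrite -(@Rintegral_sum _ _ _ nu _ _ (fun j => div_integrand (e j) (phi j))); last first.
  by move=> j; exact: div_integrand_int (bp j).
apply: Rintegral_ae_eq.
have : {ae nu, forall x, forall j : 'I_m, forall h,
    pder h (phi j) x = ip (gateaux_grad ip (phi j) x) h}.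
  apply: filter_forall => j; exact: ae_pder (bp j).
apply: ae_imply => x hx; rewrite mulr_sumr; apply: eq_bigr => j _.
by rewrite /div_integrand hx adjP.
Qed.

End DivergenceFunctional.

(** * Simultaneous approximation and partitions of unity *)

Section SimultaneousApproximation.
Context (K : realType) (X : completeNormedModType K) (O : set X) (oO : open O).

Let dominating (I : eqType) (a : I -> {finite_measure set (borel X) -> \bar K}) (s : seq I) :
  exists M : {measure set (borel X) -> \bar K}, (M setT < +oo)%E /\
    forall i (f : borel X -> K), i \in s -> measurable_fun setT f ->
      (forall x, 0 <= f x) -> (\int[a i]_x (f x)%:E <= \int[M]_x (f x)%:E)%E.
Proof.
elim: s => [|i s [M [Moo IH]]].
  by exists mzero; split=> //; exact: ltry.
exists (measure_add (a i) M); split.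
  rewrite /= /msum !big_ord_recl/= big_ord0 adde0 lte_add_pinfty//.
  by rewrite -ge0_fin_numE// fin_num_measure.
move=> j f; rewrite inE => js mf f0.
have mf' : measurable_fun setT (EFin \o f) by exact/measurable_EFinP.
rewrite ge0_integral_measure_add//; last by move=> x _; rewrite lee_fin.
have g0 (m : {measure set (borel X) -> \bar K}) : (0 <= \int[m]_x (f x)%:E)%E.
  by apply: integral_ge0 => x _; rewrite lee_fin.
case/predU1P : js => [->|js]; first by rewrite leeDl.
by apply: (le_trans (IH j f js mf f0)); rewrite leeDr.
Qed.

(** The sum of the measures dominates each of them, so an approximation for the
sum serves all; a cut-off function turns it into a test function. *)
Lemma Lipc_approx (I : finType) (a : I -> {finite_measure set (borel X) -> \bar K})
    (A : set (borel X)) e : measurable A -> A `<=` O -> 0 < e ->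
  exists psi : X -> K, unit_test O psi /\
    forall i, \int[a i]_x `|psi x - \1_A x| <= e.
Proof.
move=> mA AO e0; have e2 : 0 < e / 2 by rewrite divr_gt0.
have [M [Moo hM]] := dominating a (enum I).
have bint (g : borel X -> K) c : measurable_fun setT g -> (forall x, `|g x| <= c) ->
    rintegrable M g.
  move=> mg gc; apply: measurable_bounded_integrable => //.
  by apply/(boundedP (V := K)); exists c.
have M1 : rintegrable M (fun=> 1 : K) by apply: (bint _ 1) => // x; rewrite normr1.
have [eta [L [be e01 hE]]] := borel_lipschitz_approx M1 mA e2.
have [chi [chiO chi01 chi1]] := Lipc_cutoff oO.
have mchi n : measurable_fun [set: borel X] (chi n : borel X -> K).
  by have [Q _ bQ] := Lipc_blip (chiO n); exact: blip_measurable bQ.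
have meta := blip_measurable be.
have mind : measurable_fun setT (\1_A : borel X -> K) by exact: measurable_indic.
have c0 : (fun n => \int[M]_x (\1_A x * (1 - chi n x))) @ \oo --> 0.
  apply: (@Rintegral_dct0 _ _ _ M _ (fun=> 1)) => //.
  - by move=> n; apply: measurable_funM => //; exact: measurable_funB.
  - move=> x; have [Ax|Ax] := pselect (A x).
      rewrite -(mulr0 (\1_A x)); apply: cvgMr.
      by rewrite -(subrr 1); apply: cvgB; [exact: cvg_cst|exact/chi1/AO].
    rewrite indicE memNset// (_ : (fun _ => _) = cst 0); first exact: cvg_cst.
    by apply/funext => n; rewrite mul0r.
  - move=> n x; have /andP[? ?] := chi01 n x; rewrite indicE.
    by case: (_ \in _); rewrite /= ?mul1r ?mul0r ?normr0// ger0_norm; lra.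
have /cvgrPdist_le/(_ _ e2)[N _ hN] := c0.
pose psi x := chi N x * eta x.
have psiO : unit_test O psi.
  split; first exact: LipcMr (chiO N) be.
  move=> x; have /andP[? ?] := chi01 N x; have /andP[? ?] := e01 x.
  by apply/andP; split; rewrite /psi; nra.
have mpsi : measurable_fun [set: borel X] (psi : borel X -> K) by exact: measurable_funM.
exists psi; split=> // i.
have mf : measurable_fun [set: borel X] (fun x : borel X => `|psi x - \1_A x|).
  by apply: measurableT_comp => //; exact: measurable_funB.
have i01 x : 0 <= (\1_A x : K) <= 1.
  by rewrite indicE; case: (_ \in _); rewrite /= ?lexx ler01.
have fb x : `| `|psi x - \1_A x| | <= 1.
  have [_ /(_ x)/andP[? ?]] := psiO; have /andP[? ?] := i01 x.
  by rewrite normr_id ler_norml; apply/andP; split; lra.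
have step1 : \int[a i]_x `|psi x - \1_A x| <= \int[M]_x `|psi x - \1_A x|.
  have ai : rintegrable (a i) (fun x : borel X => `|psi x - \1_A x|).
    exact: finite_bounded_integrable mf fb.
  rewrite -lee_fin /Rintegral !fineK.
  - by apply: hM => //; rewrite mem_enum.
  - exact: integrable_fin_num (bint _ _ mf fb).
  - exact: integrable_fin_num ai.
apply: le_trans step1 _; rewrite (splitr e).
have hNN : \int[M]_x (\1_A x * (1 - chi N x)) <= e / 2.
  by have := hN N (leqnn N); rewrite sub0r normrN => /(le_trans (ler_norm _)).
apply: le_trans (lerD hE hNN).
have b1 : rintegrable M (fun x : borel X => `|eta x - \1_A x| * `|1 : K|).
  apply: (bint _ 1).
    apply: measurable_funM => //; apply: measurableT_comp => //; exact: measurable_funB.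
  move=> x; rewrite normr1 mulr1 normr_id.
  have /andP[? ?] := e01 x; have /andP[? ?] := i01 x.
  by rewrite ler_norml; apply/andP; split; lra.
have b2 : rintegrable M (fun x : borel X => \1_A x * (1 - chi N x)).
  apply: (bint _ 1); first by apply: measurable_funM => //; exact: measurable_funB.
  move=> x; have /andP[? ?] := chi01 N x; have /andP[? ?] := i01 x.
  by rewrite ler_norml; apply/andP; split; nra.
rewrite -RintegralD//; apply: le_Rintegral => //.
- exact: bint mf fb.
- exact: rintD.
move=> x _; rewrite normr1 mulr1 /psi.
have /andP[? ?] := chi01 N x; have /andP[? ?] := i01 x.
have -> : chi N x * eta x - \1_A x =
   chi N x * (eta x - \1_A x) - \1_A x * (1 - chi N x) by ring.
rewrite (le_trans (ler_normB _ _))// lerD//.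
  by rewrite normrM ler_piMl// ger0_norm.
by rewrite ger0_norm// mulr_ge0// subr_ge0.
Qed.

End SimultaneousApproximation.

Section Variation.
Context (K : realType) (X : completeNormedModType K) (ip : inner_product X).
Context (O : set X) (oO : open O).
Context (T : X -> (X -> K) -> K).
Hypothesis T_lin : forall z (a : K) (phi psi : X -> K), Lipc O phi -> Lipc O psi ->
  T z (fun x => a * phi x + psi x) = a * T z phi + T z psi.

Lemma T0 z : T z (fun=> 0) = 0.
Proof.
have L0 : Lipc O (fun _ : X => 0 : K) by exact: Lipc0.
have h : - 1 * T z (fun=> 0) + T z (fun=> 0) = 0 by rewrite mulN1r addNr.
rewrite -[RHS]h -(T_lin z (- 1) L0 L0); congr T.
by apply/funext => x; rewrite mulr0 addr0.
Qed.

Lemma T_sum z n (c : 'I_n -> K) (psi : 'I_n -> X -> K) : (forall k, Lipc O (psi k)) ->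
  T z (fun x => \sum_k c k * psi k x) = \sum_k c k * T z (psi k).
Proof.
move=> psiO; pose s := index_enum 'I_n; rewrite -/s.
elim: s => [|k s IH].
  by rewrite big_nil -[RHS](T0 z); congr T; apply/funext => x; rewrite big_nil.
rewrite big_cons -IH -T_lin//.
  by congr T; apply/funext => x; rewrite big_cons.
by apply: Lipc_sum => j; exact: LipcMl.
Qed.

Lemma norm_orthonormal m (e : 'I_m -> X) (c : 'I_m -> K) :
  (forall i j, ip (e i) (e j) = (i == j)%:R) ->
  `|\sum_j c j *: e j| ^+ 2 = \sum_j c j ^+ 2.
Proof.
move=> eo; rewrite (ip_normE ip) ip_suml'; apply: eq_bigr => i _.
rewrite ipZl ip_sumr (bigD1 i)//= big1 => [|j ji].
  by rewrite ip_scaler eo eqxx mulr1 addr0 expr2.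
by rewrite ip_scaler eo eq_sym (negbTE ji) mulr0.
Qed.

(** The product [\prod_(k < n) (1 - psi k)]. The functions
[residue psi k * psi k] have sum at most 1, and they are close to [psi k] if the
functions [psi k] are close to the indicators of disjoint sets. *)
Fixpoint residue (psi : nat -> X -> K) n : X -> K :=
  if n is k.+1 then fun x => residue psi k x * (1 - psi k x) else fun=> 1.

Lemma residue01 psi n x : (forall k, 0 <= psi k x <= 1) -> 0 <= residue psi n x <= 1.
Proof.
move=> p01; elim: n => [|n /= /andP[h0 h1]]; first by rewrite ler01 lexx.
by have /andP[? ?] := p01 n; apply/andP; split; nra.
Qed.

Lemma residue_blip psi n : (forall k, unit_test O (psi k)) ->
  exists L, blip 1 L (residue psi n).
Proof.
move=> up; elim: n => [|n [L bL]].
  exists 0; split=> [x|x y]; first by rewrite normr1.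
  by rewrite subrr normr0 mul0r.
have [pO p01] := up n; have [M _ [pM pL]] := Lipc_blip pO.
have b1 : blip 1 M (fun x => 1 - psi n x).
  split=> [x|x y]; first by have /andP[? ?] := p01 x; rewrite ger0_norm; lra.
  have -> : 1 - psi n x - (1 - psi n y) = - (psi n x - psi n y) by ring.
  by rewrite normrN.
by exists (1 * M + L * 1); have := blipM bL b1; rewrite [X in blip X](mulr1 1).
Qed.

Lemma residue_sum psi n x : \sum_(k < n) residue psi k x * psi k x = 1 - residue psi n x.
Proof.
elim: n => [|n IH]; first by rewrite big_ord0 subrr.
by rewrite big_ord_recr/= IH; ring.
Qed.

Lemma residue_approx psi (A : nat -> set X) n x :
  (forall k, 0 <= psi k x <= 1) -> (forall k l, (k < l)%N -> A k `&` A l = set0) ->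
  `|residue psi n x * psi n x - \1_(A n) x| <=
  \sum_(k < n.+1) `|psi k x - \1_(A k) x|.
Proof.
move=> p01 dis.
have i01 B : 0 <= (\1_B x : K) <= 1.
  by rewrite indicE; case: (_ \in _); rewrite /= ?lexx ler01.
pose u := residue (fun k => \1_(A k)).
have u1 k : u k x * \1_(A k) x = \1_(A k) x.
  rewrite [in RHS]indicE indicE; have [Ax|Ax] := boolP (x \in A k); last by rewrite mulr0.
  rewrite mulr1 /u; have : forall l, (l <= k)%N -> residue (fun k => \1_(A k)) l x = 1.
    elim=> [//|l IH lk /=]; rewrite IH ?(ltnW lk)// indicE memNset ?subr0 ?mulr1//.
    move=> Alx; suff : (A l `&` A k) x by rewrite dis.
    by split=> //; exact: set_mem.
  by apply.
have ru k : `|residue psi k x - u k x| <= \sum_(l < k) `|psi l x - \1_(A l) x|.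
  elim: k => [|k IH]; first by rewrite big_ord0 subrr normr0.
  rewrite big_ord_recr/=.
  have -> : residue psi k x * (1 - psi k x) - u k x * (1 - \1_(A k) x) =
    (residue psi k x - u k x) * (1 - psi k x) - u k x * (psi k x - \1_(A k) x) by ring.
  rewrite (le_trans (ler_normB _ _))// !normrM lerD//.
    rewrite (le_trans _ IH)// ler_piMr//; have /andP[? ?] := p01 k.
    by rewrite ger0_norm; lra.
  rewrite ler_piMl//; have /andP[? ?] : 0 <= u k x <= 1 by apply: residue01 => l; exact: i01.
  by rewrite ger0_norm.
rewrite big_ord_recr/= -{1}u1.
have -> : residue psi n x * psi n x - u n x * \1_(A n) x =
  (residue psi n x - u n x) * psi n x + u n x * (psi n x - \1_(A n) x) by ring.
rewrite (le_trans (ler_normD _ _))// !normrM lerD//.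
  rewrite (le_trans _ (ru n))// ler_piMr//; have /andP[? ?] := p01 n.
  by rewrite ger0_norm.
rewrite ler_piMl//; have /andP[? ?] : 0 <= u n x <= 1 by apply: residue01 => l; exact: i01.
by rewrite ger0_norm.
Qed.

End Variation.

(** * Sums of norms against the variation *)

Section VariationBound.
Context (K : realType) (X : completeNormedModType K) (ip : inner_product X).
Context (O : set X) (oO : open O) (T : X -> (X -> K) -> K) (V : K).
Hypothesis T_lin : forall z (a : K) (phi psi : X -> K), Lipc O phi -> Lipc O psi ->
  T z (fun x => a * phi x + psi x) = a * T z phi + T z psi.
Hypothesis T_le : forall m (e : 'I_m -> X) (phi : 'I_m -> X -> K),
  (forall i j, ip (e i) (e j) = (i == j)%:R) -> (forall j, Lipc O (phi j)) ->
  (forall x, \sum_j phi j x ^+ 2 <= 1) -> \sum_j T (e j) (phi j) <= V.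

(** The test fields [\sum_k psi_k *: z_k], with [psi_k] a partition of unity
approximating the indicators of the sets [A k] and [z_k] the direction of the
vector measure of [A k], realize the sum of the norms up to an error. *)
Lemma sum_norm_le m (e : 'I_m -> X)
    (a b : 'I_m -> {finite_measure set (borel X) -> \bar K}) (A : nat -> set (borel X)) n :
  (forall i j, ip (e i) (e j) = (i == j)%:R) ->
  (forall j phi, Lipc O phi -> T (e j) phi = \int[a j]_x phi x - \int[b j]_x phi x) ->
  (forall k, measurable (A k)) -> (forall k, A k `<=` O) ->
  (forall k l, (k < l)%N -> A k `&` A l = set0) ->
  \sum_(k < n) `|\sum_j (fine (a j (A k)) - fine (b j (A k))) *: e j| <= V.
Proof.
move=> eo repr mA AO dis.
pose c j k := fine (a j (A k)) - fine (b j (A k)).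
pose w k := \sum_j c j k *: e j.
pose z k j := `|w k|^-1 * c j k.
have zE k : \sum_j z k j *: e j = normalize (w k).
  by rewrite /normalize scaler_sumr; apply: eq_bigr => j _; rewrite scalerA.
have zsum k : \sum_j z k j ^+ 2 <= 1.
  rewrite -(norm_orthonormal (ip := ip) _ eo) zE.
  by have [->|->] := normalize_sqr (w k); rewrite ?normr0 ?expr0n ?expr1n ?ler01.
have z1 k j : `|z k j| <= 1.
  rewrite -(@ler_pXn2r _ 2)// ?nnegrE// expr1n real_normK ?num_real//.
  by apply: le_trans (zsum k); rewrite (bigD1 j)//= lerDl sumr_ge0// => i _; rewrite sqr_ge0.
have zc k : \sum_j z k j * c j k = `|w k|.
  under eq_bigr do rewrite /z -mulrA -expr2; rewrite -mulr_sumr.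
  rewrite -(norm_orthonormal (ip := ip) _ eo) -/(w k).
  have [->|w0] := eqVneq `|w k| 0; first by rewrite expr0n mulr0.
  by rewrite expr2 mulrA mulVf// mul1r.
apply/ler_addgt0Pr => eps eps0.
pose D : K := n%:R * (m%:R * (n%:R + n%:R)) + 1.
have D0 : 0 < D by rewrite ltr_wpDl// !mulr_ge0// addr_ge0.
pose del := eps / D.
have del0 : 0 < del by rewrite divr_gt0.
pose ab (i : 'I_m + 'I_m) := match i with inl j => a j | inr j => b j end.
have /choice[psi hpsi] := fun k => Lipc_approx oO ab (mA k) (@AO k) del0.
have upsi k : unit_test O (psi k) by have [] := hpsi k.
have psi01 k x : 0 <= psi k x <= 1 by have [_] := upsi k.
pose xi k x := residue psi k x * psi k x.
have xiO k : Lipc O (xi k).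
  have [L bL] := residue_blip k upsi; rewrite /xi.
  by under eq_fun do rewrite mulrC; apply: LipcMr bL; have [] := upsi k.
have xi0 k x : 0 <= xi k x.
  have /andP[? ?] := residue01 (x := x) k (fun k => psi01 k x).
  by have /andP[? ?] := psi01 k x; rewrite mulr_ge0.
have xiA i k : (k < n)%N -> `|\int[ab i]_x xi k x - fine (ab i (A k))| <= n%:R * del.
  move=> kn; rewrite -Rintegral_indic//.
  have [M _ bM] := Lipc_blip (xiO k).
  have ixi : rintegrable (ab i) (xi k : borel X -> K).
    by apply: (@finite_bounded_integrable _ _ _ _ _ M); [exact: blip_measurable bM|case: bM].
  have i01 (B : set (borel X)) (x : borel X) : 0 <= (\1_B x : K) <= 1.
    by rewrite indicE; case: (_ \in _); rewrite /= ?lexx ler01.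
  have iA l : rintegrable (ab i) (\1_(A l) : borel X -> K).
    apply: (@finite_bounded_integrable _ _ _ _ _ 1); first exact: measurable_indic.
    by move=> x; have /andP[? ?] := i01 (A l) x; rewrite ger0_norm.
  have ipsi l : rintegrable (ab i) (psi l : borel X -> K).
    have [pO _] := upsi l; have [N _ bN] := Lipc_blip pO.
    by apply: (@finite_bounded_integrable _ _ _ _ _ N); [exact: blip_measurable bN|case: bN].
  rewrite -RintegralB// (le_trans (le_normr_Rintegral _ _))//; first exact: rintB.
  have idiff l : rintegrable (ab i) (fun x : borel X => `|psi l x - \1_(A l) x|).
    by apply: rint_abs; exact: rintB.
  apply: (@le_trans _ _ (\int[ab i]_x \sum_(l < k.+1) `|psi l x - \1_(A l) x|)).
    apply: le_Rintegral => //.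
    - by apply: rint_abs; exact: rintB.
    - by apply: (@rint_sum _ _ _ (ab i) _ _ (fun (l : 'I_k.+1) (x : borel X) => `|psi l x - \1_(A l) x|)) => l; exact: idiff.
    - by move=> x _; apply: residue_approx.
  rewrite (@Rintegral_sum _ _ _ (ab i) _ _ (fun (l : 'I_k.+1) (x : borel X) => `|psi l x - \1_(A l) x|))//.
  apply: (@le_trans _ _ (\sum_(l < k.+1) del)).
    by apply: ler_sum => l _; have [_] := hpsi l; exact.
  rewrite sumr_const card_ord -[del *+ _]mulr_natl ler_wpM2r ?(ltW del0)//.
  by rewrite ler_nat.
pose phi j x := \sum_(k < n) z k j * xi k x.
have phiO j : Lipc O (phi j) by apply: Lipc_sum => k; apply: LipcMl; exact: xiO.
have phi1 x : \sum_j phi j x ^+ 2 <= 1.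
  rewrite -(norm_orthonormal (ip := ip) _ eo).
  have -> : \sum_j phi j x *: e j = \sum_(k < n) xi k x *: normalize (w k).
    under eq_bigr do rewrite scaler_suml.
    rewrite exchange_big/=; apply: eq_bigr => k _.
    by rewrite -zE scaler_sumr; apply: eq_bigr => j _; rewrite scalerA mulrC.
  rewrite -[leRHS](expr1n _ 2) ler_sqr ?nnegrE// (le_trans (ler_norm_sum _ _ _))//.
  apply: (@le_trans _ _ (\sum_(k < n) xi k x)).
    apply: ler_sum => k _; rewrite normrZ (ger0_norm (xi0 _ _)).
    by have [->|->] := normalize_sqr (w k); rewrite ?normr0 ?mulr0 ?mulr1.
  rewrite residue_sum gerBl.
  by have /andP[] := residue01 (x := x) n (fun k => psi01 k x).
have := T_le eo phiO phi1.
have -> : \sum_j T (e j) (phi j) = \sum_(k < n) \sum_j z k j * T (e j) (xi k).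
  rewrite exchange_big/=; apply: eq_bigr => j _.
  by rewrite (T_sum T_lin) // => k; exact: xiO.
move=> hV.
have E k : (k < n)%N -> `|w k| - (m%:R * (n%:R + n%:R) * del) <= \sum_j z k j * T (e j) (xi k).
  move=> kn; rewrite -zc lerBlDr -lerBlDl -sumrB.
  apply: (@le_trans _ _ (\sum_(j < m) (n%:R * del + n%:R * del))).
    apply: ler_sum => j _; rewrite -mulrBr.
    rewrite (le_trans (ler_norm _))// normrM (le_trans (ler_piMl _ (z1 k j)))//.
    rewrite repr// /c.
    have ha := xiA (inl j) k kn; have hb := xiA (inr j) k kn.
    rewrite /= in ha hb.
    rewrite distrC (_ : _ - _ = (\int[a j]_x xi k x - fine (a j (A k))) -
       (\int[b j]_x xi k x - fine (b j (A k)))); last by ring.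
    by rewrite (le_trans (ler_normB _ _))// lerD.
  by rewrite sumr_const card_ord -[(_ + _) *+ m]mulr_natl -mulrDl mulrA.
have : \sum_(k < n) (`|w k| - (m%:R * (n%:R + n%:R) * del)) <= V.
  by apply: le_trans hV; apply: ler_sum => k _; exact: E.
rewrite sumrB sumr_const card_ord -[(_ * del) *+ n]mulr_natl lerBlDr => h.
apply: le_trans h _; rewrite lerD2l mulrA /del mulrCA -[leRHS]mulr1 ler_wpM2l ?(ltW eps0)//.
by rewrite ler_pdivrMr// mul1r lerDl.
Qed.

End VariationBound.

(** * Vector measures with given coordinates *)

Lemma cvg_finsum (K : realType) I (s : seq I) (u : I -> nat -> K) (l : I -> K) :
  (forall i, u i @ \oo --> l i) ->
  (fun n => \sum_(i <- s) u i n) @ \oo --> \sum_(i <- s) l i.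
Proof.
move=> ul; elim: s => [|i s IH].
  by under eq_fun do rewrite big_nil; rewrite big_nil; exact: cvg_cst.
by under eq_fun do rewrite big_cons; rewrite big_cons; exact: cvgD.
Qed.

Section NonzeroBasis.
Context (K : realType) (X : completeNormedModType K) (ip : inner_product X).

(** Dropping the zero vectors of the Gram-Schmidt sequence gives families that are
admissible in the definition of the variation. *)
Lemma gs_orthonormal (d : nat -> X) N : exists m (e : 'I_m -> X),
  (forall i j, ip (e i) (e j) = (i == j)%:R) /\
  forall x, \sum_j ip x (e j) *: e j = gs_proj ip d N x.
Proof.
pose I := [pred i : 'I_N | gs ip d i != 0].
exists #|I|, (fun k : 'I_#|I| => gs ip d (enum_val k : 'I_N)); split.
  move=> i j; have [->|ij] := eqVneq i j.
    have := enum_valP j; rewrite inE => gj.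
    have [g0|g1] := gs01 ip d (enum_val j : 'I_N); first by rewrite g0 eqxx in gj.
    by rewrite -(ip_normE ip) g1 expr1n.
  rewrite gs_orth//; apply: contra_neq ij => h.
  by apply: enum_val_inj; apply: val_inj.
move=> x; rewrite gs_projE.
rewrite -(big_enum_val (fun i : 'I_N => ip x (gs ip d i) *: gs ip d i)).
rewrite [RHS](bigID [pred i | i \in I])/= [X in _ = _ + X]big1 ?addr0//.
by move=> i; rewrite inE negbK => /eqP ->; rewrite scaler0.
Qed.

End NonzeroBasis.

Section VectorMeasure.
Context (K : realType) (X : completeNormedModType K) (ip : inner_product X).
Context (sepX : separable_space X).
Context (O : set X) (oO : open O) (T : X -> (X -> K) -> K) (V : K).
Hypothesis T_lin : forall z (a : K) (phi psi : X -> K), Lipc O phi -> Lipc O psi ->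
  T z (fun x => a * phi x + psi x) = a * T z phi + T z psi.
Hypothesis T_le : forall m (e : 'I_m -> X) (phi : 'I_m -> X -> K),
  (forall i j, ip (e i) (e j) = (i == j)%:R) -> (forall j, Lipc O (phi j)) ->
  (forall x, \sum_j phi j x ^+ 2 <= 1) -> \sum_j T (e j) (phi j) <= V.

(** Projections onto finite-dimensional subspaces reduce the estimate to finitely
many coordinates. *)
Lemma vector_sum_norm_le (mu : set X -> X)
    (a b : X -> {finite_measure set (borel X) -> \bar K}) (A : nat -> set (borel X)) n :
  (forall z phi, Lipc O phi -> T z phi = \int[a z]_x phi x - \int[b z]_x phi x) ->
  (forall z B, measurable (B : set (borel X)) -> B `<=` O ->
    ip (mu B) z = fine (a z B) - fine (b z B)) ->
  (forall k, measurable (A k)) -> (forall k, A k `<=` O) -> trivIset setT A ->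
  \sum_(k < n) `|mu (A k)| <= V.
Proof.
move=> repr muE mA AO tA; have [d dd] := separable_seq sepX.
have c : (fun N => \sum_(k < n) `|gs_proj ip d N (mu (A k))|) @ \oo -->
    \sum_(k < n) `|mu (A k)|.
  by apply: cvg_finsum => k; apply: cvg_norm; exact: gs_proj_cvg.
rewrite -(cvg_lim _ c)//; apply: limr_le; first by apply/cvg_ex; eexists; exact: c.
apply: nearW => N; have [m [e [eo eE]]] := gs_orthonormal ip d N.
have dis k l : (k < l)%N -> A k `&` A l = set0.
  move=> kl; apply/eqP; apply/negP => /negP/set0P[x [Akx Alx]].
  by have := tA k l Logic.I Logic.I (ex_intro _ x (conj Akx Alx)) => e'; rewrite e' ltnn in kl.
have := sum_norm_le oO T_lin T_le n eo (fun j => repr (e j)) mA AO dis.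
apply: le_trans; apply: ler_sum => k _; rewrite -eE.
by under eq_bigr do rewrite muE//.
Qed.

(** The Jordan decomposition turns the coordinate charges into pairs of finite
measures, so that the estimates for pairs of measures that represent [T] apply to
every vector measure whose coordinates represent [T]. *)
Lemma coord_measures (mu : borel_vmeasure X O) z :
  (forall phi, Lipc O phi ->
    charge_integral (coord_charge ip mu z (open_borel oO)) O phi = T z phi) ->
  exists ab : {finite_measure set (borel X) -> \bar K} *
              {finite_measure set (borel X) -> \bar K},
  (forall phi, Lipc O phi -> T z phi = \int[ab.1]_x phi x - \int[ab.2]_x phi x) /\
  (forall B, measurable (B : set (borel X)) -> B `<=` O ->
    ip (mu B) z = fine (ab.1 B) - fine (ab.2 B)).
Proof.
move=> muT; pose c := coord_charge ip mu z (open_borel oO) : {charge set (borel X) -> \bar K}.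
move: muT; rewrite /charge_integral; case: cid => P exN; case: cid => N nuPN muT.
exists ((jordan_pos nuPN : {finite_measure set (borel X) -> \bar K}),
  (jordan_neg nuPN : {finite_measure set (borel X) -> \bar K})); split => /=.
  move=> phi phiO; rewrite -muT// [X in X - _]Rintegral_mkcond [X in _ - X]Rintegral_mkcond.
  have -> // : phi \_ O = phi.
  apply/funext => x; rewrite patchE; case: ifPn => //.
  by rewrite notin_setE => /(Lipc_notin phiO).
move=> B mB BO.
have -> : ip (mu B) z = fine (coord_charge ip mu z (open_borel oO) B).
  by rewrite /coord_charge/= setIidl.
rewrite (jordan_decomp nuPN mB) /cadd/= cscaleN1 fineD ?fin_num_measure//.
  by rewrite fineN.
by rewrite fin_numN fin_num_measure.
Qed.

Hypothesis T_dir : forall (a : K) z z' (phi : X -> K), Lipc O phi ->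
  T (a *: z + z') phi = a * T z phi + T z' phi.
Hypothesis T_repr : forall z, exists mp mn : {finite_measure set (borel X) -> \bar K},
  [/\ mp (~` O) = 0%E, mn (~` O) = 0%E & forall phi, Lipc O phi ->
    T z phi = \int[mp]_x phi x - \int[mn]_x phi x].

(** The values [M z B] of the signed measures are limits of values [T z psi] with
the same [psi] for finitely many [z], so they inherit linearity in [z] and the
bound from [T]; the Riesz theorem then gives a vector [mu B]. *)
Theorem vmeasure_repr : exists mu : borel_vmeasure X O, forall phi z, Lipc O phi ->
  charge_integral (coord_charge ip mu z (open_borel oO)) O phi = T z phi.
Proof.
have /choice[ab hab] : forall z, exists ab : {finite_measure set (borel X) -> \bar K} *
    {finite_measure set (borel X) -> \bar K},
    [/\ ab.1 (~` O) = 0%E, ab.2 (~` O) = 0%E & forall phi, Lipc O phi ->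
    T z phi = \int[ab.1]_x phi x - \int[ab.2]_x phi x].
  by move=> z; have [mp [mn h]] := T_repr z; exists (mp, mn).
pose a z := (ab z).1; pose b z := (ab z).2.
have repr z phi : Lipc O phi -> T z phi = \int[a z]_x phi x - \int[b z]_x phi x.
  by have [_ _ +] := hab z; apply.
pose M z B := fine (a z B) - fine (b z B).
have mO := open_borel oO.
have nullI (m : {finite_measure set (borel X) -> \bar K}) (B : set (borel X)) :
    m (~` O) = 0%E -> measurable B -> m (B `&` O) = m B.
  move=> m0 mB; have mOc : measurable (~` O : set (borel X)) by exact: measurableC.
  have mBO : measurable (B `&` ~` O : set (borel X)) by exact: measurableI.
  have mBO' : measurable (B `&` O : set (borel X)) by exact: measurableI.
  rewrite -[in RHS](setIT B) -(setUv O) setIUr measureU//; last by rewrite setIACA setICr setI0.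
  by rewrite [X in _ = (_ + X)%E](subset_measure0 mBO mOc _ m0) ?adde0//; exact: subIsetr.
have MI z (B : set (borel X)) : measurable B -> M z (B `&` O) = M z B.
  by move=> mB; have [a0 b0 _] := hab z; rewrite /M !nullI.
(* Three directions suffice to compare the values at [z], [z'] and [s *: z + z']. *)
have M_approx z1 z2 z3 (B : set (borel X)) e : measurable B -> 0 < e ->
    exists psi, [/\ Lipc O psi, `|T z1 psi - M z1 B| <= e, `|T z2 psi - M z2 B| <= e &
      `|T z3 psi - M z3 B| <= e].
  move=> mB e0; have e2 : 0 < e / 2 by rewrite divr_gt0.
  pose zs (i : 'I_3) := nth z1 [:: z1; z2; z3] i.
  pose c (i : 'I_3 + 'I_3) := match i with inl j => a (zs j) | inr j => b (zs j) end.
  have mBO : measurable (B `&` O : set (borel X)) by exact: measurableI.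
  have [psi [upsi hpsi]] := Lipc_approx oO c mBO (@subIsetr _ _ _) e2.
  have [psiO psi01] := upsi; have [Q _ bQ] := Lipc_blip psiO.
  have one i : `|\int[c i]_x psi x - fine (c i (B `&` O))| <= e / 2.
    rewrite -Rintegral_indic// -RintegralB//.
    - apply: le_trans (le_normr_Rintegral _ _) (hpsi i) => //.
      apply: rintB; first by apply: (@finite_bounded_integrable _ _ _ _ _ Q); [exact: blip_measurable bQ|case: bQ].
      apply: (@finite_bounded_integrable _ _ _ _ _ 1); first exact: measurable_indic.
      by move=> x; rewrite indicE; case: (_ \in _); rewrite ?normr1 ?normr0.
    - by apply: (@finite_bounded_integrable _ _ _ _ _ Q); [exact: blip_measurable bQ|case: bQ].
    - apply: (@finite_bounded_integrable _ _ _ _ _ 1); first exact: measurable_indic.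
      by move=> x; rewrite indicE; case: (_ \in _); rewrite ?normr1 ?normr0.
  have two j : `|T (zs j) psi - M (zs j) B| <= e.
    rewrite repr// -MI// /M.
    have ha := one (inl j); have hb := one (inr j); rewrite /= in ha hb.
    rewrite (_ : _ - _ = (\int[a (zs j)]_x psi x - fine (a (zs j) (B `&` O))) -
      (\int[b (zs j)]_x psi x - fine (b (zs j) (B `&` O)))); last by ring.
    by rewrite (le_trans (ler_normB _ _))// (splitr e) lerD.
  exists psi; split=> //.
  - exact: (two (@Ordinal 3 0 isT)).
  - exact: (two (@Ordinal 3 1 isT)).
  - exact: (two (@Ordinal 3 2 isT)).
have M_lin s z z' (B : set (borel X)) : measurable B -> M (s *: z + z') B = s * M z B + M z' B.
  move=> mB; apply/eqP; rewrite -subr_eq0 -normr_le0; apply/ler_addgt0Pr => e e0.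
  rewrite add0r; have s0 : 0 < `|s| + 2 by rewrite ltr_wpDl.
  have [psi [psiO h1 h2 h3]] := M_approx (s *: z + z') z z' _ _ mB (divr_gt0 e0 s0).
  rewrite T_dir// in h1.
  set q := e / (`|s| + 2) in h1 h2 h3.
  have h2' : `|s * (T z psi - M z B)| <= `|s| * q by rewrite normrM ler_wpM2l.
  have -> : M (s *: z + z') B - (s * M z B + M z' B) =
     - (s * T z psi + T z' psi - M (s *: z + z') B) + (s * (T z psi - M z B) +
     (T z' psi - M z' B)) by ring.
  rewrite (le_trans (ler_normD _ _))// normrN.
  rewrite (_ : e = q + (`|s| * q + q)); last by rewrite /q; field; rewrite gt_eqF.
  rewrite lerD// (le_trans (ler_normD _ _))// lerD//.
have V0 : 0 <= V.
  pose e0 (_ : 'I_0) : X := 0; pose p0 (_ : 'I_0) (_ : X) : K := 0.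
  have <- : \sum_j T (e0 j) (p0 j) = 0 by exact: big_ord0.
  apply: T_le.
  - by case.
  - by case.
  - by move=> x; rewrite big_ord0 ler01.
have M_bound z (B : set (borel X)) : measurable B -> `|M z B| <= V * `|z|.
  move=> mB; have M0 : M 0 B = 0.
    have := M_lin (-1) 0 0 B mB; rewrite scaler0 addr0 => ->.
    by rewrite mulN1r addNr.
  have [->|z0] := eqVneq z 0; first by rewrite M0 !normr0 mulr0.
  have nz : `|z| != 0 by rewrite normr_eq0.
  pose e (_ : 'I_1) := `|z|^-1 *: z.
  have eo i j : ip (e i) (e j) = (i == j)%:R.
    rewrite !ord1 eqxx -(ip_normE ip) /e normrZ normfV normr_id mulVf//.
    by rewrite expr1n.
  pose A (k : nat) : set (borel X) := if k is 0%N then B `&` O else set0.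
  have := @sum_norm_le K X ip O oO T V T_lin T_le 1 e (fun j => a (e j)) (fun j => b (e j)) A 1 eo.
  rewrite !big_ord1.
  have -> : fine (a (e ord0) (A (@ord0 0))) - fine (b (e ord0) (A (@ord0 0))) = M (e ord0) B by rewrite -MI.
  move=> h; have {}h : `|M (e ord0) B *: e ord0| <= V.
    apply: h.
    - by move=> j phi; exact: repr.
    - by case=> [|k]; [exact: measurableI|exact: measurable0].
    - by case=> [|k]; [exact: subIsetr|exact: sub0set].
    - by move=> k [|l] // _; rewrite /= setI0.
  have en : `|e ord0| = 1 by rewrite /e normrZ normfV normr_id mulVf.
  rewrite normrZ en mulr1 in h.
  have -> : M z B = `|z| * M (e ord0) B.
    have := M_lin `|z| (e ord0) 0 B mB; rewrite M0 !addr0 => <-.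
    by rewrite /e scalerA divff// scale1r.
  by rewrite normrM normr_id mulrC ler_wpM2r.
have /choice[mu hmu] : forall B : set (borel X), exists g, measurable B ->
    forall z, ip g z = M z B.
  move=> B; have [mB|nB] := pselect (measurable B); last by exists 0.
  have [|||g hg] := @riesz _ _ ip sepX (fun z => M z B) V V0.
  - by move=> x y; have := M_lin 1 x y B mB; rewrite scale1r mul1r.
  - move=> s x; have := M_lin s x 0 B mB; rewrite addr0 => ->.
    have := M_bound 0 B mB; rewrite normr0 mulr0 normr_le0 => /eqP ->.
    by rewrite addr0.
  - by move=> x; exact: M_bound.
  - by exists g => _ z; rewrite hg ipC.
have muE z B : measurable (B : set (borel X)) -> B `<=` O ->
    ip (mu B) z = fine (a z B) - fine (b z B) by move=> mB _; exact: hmu.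
have sumle (A : nat -> set (borel X)) n : (forall k, measurable (A k)) ->
    (forall k, A k `<=` O) -> trivIset setT A -> \sum_(k < n) `|mu (A k)| <= V.
  exact: vector_sum_norm_le repr muE.
have sadd : forall (A : (set (borel X))^nat) (B : set (borel X)), B `<=` O ->
    partition_of B A -> series (fun n => mu (A n)) @ \oo --> mu B.
  move=> A B BO [mA tA AB].
  have AO k : A k `<=` O by apply: subset_trans BO; rewrite -AB; exact: bigcup_sup.
  have mB : measurable B by rewrite -AB; exact: bigcupT_measurable.
  have cs : cvgn (series (fun n => mu (A n))).
    apply: normed_cvg; apply: nondecreasing_is_cvgn.
      by apply/nondecreasing_seqP => n; rewrite /= seriesSr lerDl.
    by exists V => _ [n _ <-]; rewrite /= seriesEord; exact: sumle.
  have /cvg_ex[l hl] := cs.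
  suff -> : mu B = l by [].
  apply: (@ip_inj _ _ ip) => z; rewrite hmu//.
  have c1 : (fun n => ip (series (fun n => mu (A n)) n) z) @ \oo --> ip l z by exact: cvg_ip.
  have sa (m : {finite_measure set (borel X) -> \bar K}) :
      (fun n => \sum_(k < n) fine (m (A k))) @ \oo --> fine (m B).
    have := @measure_semi_sigma_additive _ _ _ m A mA tA; rewrite AB => /(_ mB).
    rewrite -[X in _ --> X](fineK (fin_num_measure m B mB)) => /fine_cvg.
    apply: cvg_trans; apply: near_eq_cvg; apply: nearW => n /=.
    by rewrite big_mkord sum_fine// => k _; exact: fin_num_measure.
  have c2 : (fun n => ip (series (fun n => mu (A n)) n) z) @ \oo --> M z B.
    rewrite (_ : (fun n => _) = fun n => \sum_(k < n) fine (a z (A k)) -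
      \sum_(k < n) fine (b z (A k))); first exact: cvgB (sa _) (sa _).
    apply/funext => n; rewrite seriesEord/= ip_suml' -sumrB.
    by apply: eq_bigr => k _; rewrite hmu.
  by rewrite -(cvg_lim _ c1)// -(cvg_lim _ c2).
have fvar : (vm_variation mu O < +oo)%E.
  apply: (@le_lt_trans _ _ V%:E); last exact: ltry.
  apply: ge_ereal_sup => _ [A [mA tA AO] <-].
  have AkO k : A k `<=` O by rewrite -AO; exact: bigcup_sup.
  apply: lime_le; first by apply: is_cvg_nneseries.
  apply: nearW => n; rewrite sumEFin lee_fin big_mkord; exact: sumle.
exists (VMeasure sadd fvar) => phi z phiO.
have [Q _ bQ] := Lipc_blip phiO.
rewrite repr// /charge_integral; case: cid => P exN; case: cid => N nuPN.
have phiE : phi \_ O = phi.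
  apply/funext => x; rewrite patchE; case: ifPn => //.
  by rewrite notin_setE => /(Lipc_notin phiO).
rewrite [X in X - _ = _]Rintegral_mkcond [X in _ - X = _]Rintegral_mkcond phiE.
apply: (@Rintegral_measure_diff _ _ _ _ _ _ _ _ Q).
- exact: blip_measurable bQ.
- by case: bQ.
move=> B mB; have := jordan_decomp nuPN mB.
rewrite /cadd/= cscaleN1 => /(congr1 fine).
rewrite fineD ?fin_num_measure//; last by rewrite fin_numN fin_num_measure.
rewrite fineN /coord_charge/= => <-.
by rewrite hmu ?MI//; exact: measurableI.
Qed.

End VectorMeasure.

(** * Integrals of fields against a vector measure *)

Section SmallPartition.
Context (K : realType) (X : completeNormedModType K) (O : set X) (oO : open O).

(** The balls of radius [r / 2] round a dense sequence cover [O]. *)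
Lemma small_partition (sepX : separable_space X) (r : K) : 0 < r ->
  exists B : nat -> set (borel X), partition_of (O : set (borel X)) B /\
    forall k x y, B k x -> B k y -> `|x - y| <= r.
Proof.
move=> r0; have [d dd] := separable_seq sepX.
have r2 : 0 < r / 2 by rewrite divr_gt0.
pose U k : set (borel X) := O `&` ball (d k) (r / 2).
exists (seqDU U); split; first split.
- apply: seqDU_measurable => k; apply: measurableI; first exact: open_borel.
  apply: open_borel; exact: ball_open.
- exact: trivIset_seqDU.
- rewrite -seqDU_bigcup_eq; apply/seteqP; split=> [x [k _ []]//|x Ox].
  have [||k dk] := dd (ball (x : X) (r / 2)).
  + exact: ball_open.
  + by exists x; exact: ballxx.
  + by exists k => //; split=> //; exact: ball_sym.
have close k x : seqDU U k x -> `|d k - x| < r / 2.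
  move=> h; have [_ h'] := @subset_seqDU _ U k x h; rewrite -ball_normE in h'.
  exact: h'.
move=> k x y /close hx /close hy.
rewrite -(subrKA (d k)) (le_trans (ler_normD _ _))// (splitr r) lerD//; last exact: ltW.
by rewrite distrC ltW.
Qed.

(** The error of a Riemann sum over finitely many pieces of a partition into
small sets is due to the oscillation of the function, and to what is left of
[O] by these pieces. *)
Lemma riemann_sum_le (m : {finite_measure set (borel X) -> \bar K})
    (B : nat -> set (borel X)) (xi : nat -> X) (r M : K) (phi : X -> K) N :
  partition_of (O : set (borel X)) B -> (forall k x y, B k x -> B k y -> `|x - y| <= r) ->
  (forall k y, B k y -> B k (xi k)) -> 0 <= M -> 0 <= r ->
  Lipc O phi -> blip 1 M phi ->
  `|\int[m]_x phi x - \sum_(k < N) phi (xi k) * fine (m (B k))| <=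
  M * r * fine (m setT) + \int[m]_x \1_(O `\` \bigcup_(k < N) B k) x.
Proof.
move=> [mB tB BO] Br xiB M0 r0 phiO bp; have [p1 pL] := bp.
set A := O `\` _.
have mA : measurable (A : set (borel X)).
  by apply: measurableD; [exact: open_borel|exact: bigcup_measurable].
have iind (C : set (borel X)) : measurable C -> rintegrable m (\1_C : borel X -> K).
  move=> mC; apply: (@finite_bounded_integrable _ _ _ _ _ 1); first exact: measurable_indic.
  by move=> x; rewrite indicE; case: (_ \in _); rewrite ?normr1 ?normr0.
have iphi : rintegrable m (phi : borel X -> K).
  exact: finite_bounded_integrable (blip_measurable bp) p1.
pose s (x : borel X) := \sum_(k < N) phi (xi k) * \1_(B k) x.
have iterm (k : 'I_N) : rintegrable m (fun x : borel X => phi (xi k) * \1_(B k) x).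
  by apply: rintZ; exact: iind.
have is_ : rintegrable m s.
  exact: (@rint_sum _ _ _ m _ _ (fun (k : 'I_N) (x : borel X) => phi (xi k) * \1_(B k) x)).
have -> : \sum_(k < N) phi (xi k) * fine (m (B k)) = \int[m]_x s x.
  rewrite (@Rintegral_sum _ _ _ m _ _ (fun (k : 'I_N) (x : borel X) => phi (xi k) * \1_(B k) x))//.
  by apply: eq_bigr => k _; rewrite RintegralZl ?Rintegral_indic//; exact: iind.
rewrite -RintegralB// (le_trans (le_normr_Rintegral _ _))//; first exact: rintB.
have icst : rintegrable m (fun _ : borel X => M * r).
  apply: (@finite_bounded_integrable _ _ _ _ _ (M * r)) => // x.
  by rewrite ger0_norm// mulr_ge0.
rewrite -Rintegral_cst// -RintegralD//; last exact: iind.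
apply: le_Rintegral => //.
- by apply: rint_abs; exact: rintB.
- by apply: rintD => //; exact: iind.
move=> x _; rewrite /s; have [[k kN Bkx]|nB] := pselect ((\bigcup_(k < N) B k) x).
  rewrite (bigD1 (Ordinal kN))//= big1 ?addr0; last first.
    move=> l lk; rewrite indicE memNset ?mulr0// => Blx.
    have := tB l k Logic.I Logic.I (ex_intro _ x (conj Blx Bkx)) => e.
    by move: lk; rewrite -val_eqE/= e eqxx.
  rewrite indicE mem_set// mulr1; apply: ler_wpDr.
    by rewrite indicE; case: (_ \in _).
  apply: le_trans (pL _ _) _; rewrite ler_wpM2l//; exact: Br Bkx (xiB _ _ Bkx).
rewrite big1 ?subr0; last first.
  by move=> k _; rewrite indicE memNset ?mulr0// => Bkx; apply: nB; exists k => //=.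
rewrite ler_wpDl ?mulr_ge0//; have [Ox|nOx] := pselect (O x).
  by rewrite indicE mem_set.
by rewrite (Lipc_notin phiO nOx) normr0 indicE; case: (_ \in _).
Qed.

End SmallPartition.

Section FieldVariation.
Context (K : realType) (X : completeNormedModType K) (ip : inner_product X).
Context (sepX : separable_space X) (O : set X) (oO : open O).

(** A test field is almost constant on the pieces of a partition of [O] into
small sets, so its integral is almost a sum of inner products with the values
of the vector measure on these pieces. *)
Lemma field_integral_le_variation (mu : borel_vmeasure X O) m (e : 'I_m -> X)
    (phi : 'I_m -> X -> K) :
  (forall i j, ip (e i) (e j) = (i == j)%:R) -> (forall j, Lipc O (phi j)) ->
  (forall x, \sum_j phi j x ^+ 2 <= 1) ->
  ((\sum_j charge_integral (coord_charge ip mu (e j) (open_borel oO)) O (phi j))%:E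
   <= vm_variation mu O)%E.
Proof.
move=> eo phiO phi1.
pose I z psi := charge_integral (coord_charge ip mu z (open_borel oO)) O psi.
have /choice[ab hab] := fun j => @coord_measures _ _ ip O oO I mu (e j) (fun _ _ => erefl).
pose a j := (ab j).1; pose b j := (ab j).2.
have IE j : I (e j) (phi j) = \int[a j]_x phi j x - \int[b j]_x phi j x.
  by have [h _] := hab j; exact: h.
have muE j B : measurable (B : set (borel X)) -> B `<=` O ->
    ip (mu B) (e j) = fine (a j B) - fine (b j B) by have [_] := hab j; exact.
have /choice[L hL] : forall j, exists L, 0 < L /\ blip L L (phi j).
  by move=> j; have [L L0 bL] := Lipc_blip (phiO j); exists L.
pose M := \sum_j L j.
have M0 : 0 <= M by apply: sumr_ge0 => j _; have [/ltW] := hL j.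
have bM j : blip 1 M (phi j).
  split=> x.
    rewrite -(@ler_pXn2r _ 2)// ?nnegrE// expr1n real_normK ?num_real//.
    by apply: le_trans (phi1 x); rewrite (bigD1 j)//= lerDl sumr_ge0// => i _; rewrite sqr_ge0.
  move=> y; have [_ [_ h]] := hL j; apply: le_trans (h x y) _; rewrite ler_wpM2r//.
  by rewrite /M (bigD1 j)//= lerDl sumr_ge0// => i _; have [/ltW] := hL i.
apply/lee_addgt0Pr => eps eps0.
pose C := \sum_j (fine (a j setT) + fine (b j setT)).
have C0 : 0 <= C by apply: sumr_ge0 => j _; rewrite addr_ge0// fine_ge0.
pose D := 2 * (M * C + 1); have D0 : 0 < D by rewrite mulr_gt0// ltr_wpDl// mulr_ge0.
pose r := eps / D; have r0 : 0 < r by rewrite divr_gt0.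
have [B [BO Br]] := small_partition oO sepX r0; have [mB tB UB] := BO.
have BkO k : B k `<=` O by rewrite -UB; exact: bigcup_sup.
have /choice[xi hxi] : forall k, exists x, forall y, B k y -> B k x.
  move=> k; have [[y By]|nB] := pselect (exists y, B k y); first by exists y.
  by exists 0 => y By; case: nB; exists y.
pose rest N : set (borel X) := O `\` \bigcup_(k < N) B k.
have mrest N : measurable (rest N).
  by apply: measurableD; [exact: open_borel|exact: bigcup_measurable].
have rest0 (m' : {finite_measure set (borel X) -> \bar K}) :
    (fun N => \int[m']_x \1_(rest N) x) @ \oo --> (0 : K).
  apply: (@Rintegral_dct0 _ _ _ m' _ (fun=> 1)).
  - by move=> N; exact: measurable_indic.
  - move=> x; apply: cvg_near_cst; have [Ox|nOx] := pselect (O x).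
      have [k _ Bkx] : (\bigcup_k B k) x by rewrite UB.
      exists k.+1 => // N /= kN; rewrite indicE memNset// => -[_]; apply; by exists k.
    by apply: nearW => N; rewrite indicE memNset// => -[].
  - by move=> N x; rewrite indicE; case: (_ \in _); rewrite ?normr1 ?normr0.
  - by apply: (@finite_bounded_integrable _ _ _ _ _ 1) => // x; rewrite normr1.
have e2 : 0 < eps / 2 by rewrite divr_gt0.
have : (fun N => \sum_j (\int[a j]_x \1_(rest N) x + \int[b j]_x \1_(rest N) x))
    @ \oo --> \sum_(j < m) (0 : K).
  apply: cvg_finsum => j; rewrite -(addr0 (0 : K)).
  by apply: cvgD; exact: rest0.
rewrite [X in _ --> X]big1// => /cvgrPdist_le/(_ _ e2)[N _ hN].
have {hN} := hN N (leqnn N); rewrite sub0r normrN => /(le_trans (ler_norm _)) hN.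
pose S := \sum_(k < N) `|mu (B k)|.
have SE : (S%:E <= vm_variation mu O)%E.
  apply: (@le_trans _ _ (\sum_(0 <= k <oo) `|mu (B k)|%:E)%E).
    by rewrite /S -(big_mkord xpredT (fun k => `|mu (B k)|)) -sumEFin; exact: nneseries_lim_ge.
  by apply: ereal_sup_ubound; exists B.
apply: le_trans (leeD2r _ SE); rewrite -EFinD lee_fin.
pose Sj (n' : 'I_m -> {finite_measure set (borel X) -> \bar K}) j :=
  \sum_(k < N) phi j (xi k) * fine (n' j (B k)).
have sumS : \sum_j (Sj a j - Sj b j) <= S.
  rewrite /S /Sj; under eq_bigr do rewrite -sumrB; rewrite exchange_big/=.
  apply: ler_sum => k _.
  apply: (@le_trans _ _ (ip (mu (B k)) (\sum_j phi j (xi k) *: e j))).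
    rewrite ip_sumr; apply: ler_sum => j _.
    by rewrite ip_scaler muE// mulrBr.
  apply: le_trans (ler_norm _) _; apply: le_trans (ip_bound _ _ _) _.
  rewrite ler_piMr// -(@ler_pXn2r _ 2)// ?nnegrE// (norm_orthonormal (ip := ip) _ eo).
  by rewrite expr1n.
have err (n' : 'I_m -> {finite_measure set (borel X) -> \bar K}) j :
  `|\int[n' j]_x phi j x - Sj n' j| <=
   M * r * fine (n' j setT) + \int[n' j]_x \1_(rest N) x.
  exact: riemann_sum_le BO Br hxi M0 (ltW r0) (phiO j) (bM j).
have tot : \sum_j I (e j) (phi j) - \sum_j (Sj a j - Sj b j) <= eps.
  rewrite -sumrB; apply: (@le_trans _ _ (M * r * C +
    \sum_j (\int[a j]_x \1_(rest N) x + \int[b j]_x \1_(rest N) x))).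
    rewrite /C mulr_sumr -big_split/=; apply: ler_sum => j _; rewrite IE.
    have /ler_normlP[_ h1] := err a j; have /ler_normlP[h2 _] := err b j.
    by move: h1 h2; clear; lra.
  rewrite (splitr eps); apply: lerD hN.
  rewrite /r /D; set P := M * C; have -> : M * (eps / (2 * (P + 1))) * C = eps / 2 * (P / (P + 1)).
    rewrite /P; field; rewrite gt_eqF//.
    by rewrite ltr_wpDl// mulr_ge0.
  have P1 : 0 < P + 1 by rewrite ltr_wpDl// mulr_ge0.
  by apply: ler_piMr; [exact: ltW|rewrite ler_pdivrMr// mul1r lerDl].
by move: tot sumS; rewrite -/(I _ _); clear; rewrite lerBlDr => h1 h2; lra.
Qed.

End FieldVariation.

(** * Functions of bounded variation *)

Lemma Lipc_ip (K : realType) (X : completeNormedModType K) (ip : inner_product X)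
    (O : set X) (phi : X -> X) w : Lipc O phi -> Lipc O (fun x => ip (phi x) w).
Proof.
move=> pO; have [M M0 [pM pL]] := Lipc_blip pO.
have b : blip (M * `|w|) (M * `|w|) (fun x => ip (phi x) w).
  split=> [x|x y]; first by rewrite (le_trans (ip_bound _ _ _))// ler_wpM2r.
  by rewrite -ipBl (le_trans (ip_bound _ _ _))// mulrAC ler_wpM2r.
by apply: (Lipc_dom pO b) => x ->; exact: ip0l.
Qed.

Section BVFunctional.
Context (K : realType) (X : completeNormedModType K) (ip : inner_product X).
Context (sepX : separable_space X) (nu : probability (borel X) K).
Hypothesis lip_gateaux : forall phi : X -> K, [lipschitz phi x | x in setT] ->
  {ae nu, forall x, gateaux_differentiable ip phi x}.
Context (R : {linear X -> X}) (adj : X -> X) (v : X -> X -> K).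
Hypothesis adjP : forall x z, ip (R x) z = ip x (adj z).
Hypothesis vi : forall z, rintegrable nu (v z : borel X -> K).
Hypothesis v_parts : forall (z : X) (phi : X -> K), C1b ip phi ->
  \int[nu]_x ip (R (frechet_grad ip phi x)) z = \int[nu]_x (phi x * v z x).
Context (O : set X) (oO : open O) (f : X -> K).
Hypothesis fi : rintegrable nu (f \_ O : borel X -> K).
Hypothesis fvi : forall z, rintegrable nu (fun x : borel X => (f \_ O) x * v z x).

Local Notation T := (div_functional nu adj v (f \_ O)).
Local Notation V := (nu_variation ip nu R v O f).

Let T_lin z (a : K) (phi psi : X -> K) : Lipc O phi -> Lipc O psi ->
  T z (fun x => a * phi x + psi x) = a * T z phi + T z psi.
Proof.
move=> /Lipc_blip[M _ bp] /Lipc_blip[N _ bq].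
exact: (div_functional_lin lip_gateaux adj fi fvi a z bp bq).
Qed.

Let T_scale z (a : K) (phi : X -> K) : Lipc O phi -> T z (fun x => a * phi x) = a * T z phi.
Proof.
move=> pO; have := T_lin z a pO (Lipc0 _ _); rewrite (T0 T_lin) addr0 => <-.
by congr (T z); apply/funext => x; rewrite addr0.
Qed.

Let T_dir (a : K) z z' (phi : X -> K) : Lipc O phi ->
  T (a *: z + z') phi = a * T z phi + T z' phi.
Proof.
move=> /Lipc_blip[M _ bp].
exact: (div_functional_dirlin sepX lip_gateaux adjP vi v_parts fi fvi a z z' bp).
Qed.

Let restrict_int (G : X -> K) :
  \int[nu]_(x in O) (f x * G x) = \int[nu]_x ((f \_ O) x * G x).
Proof.
rewrite Rintegral_mkcond; apply: eq_Rintegral => x _.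
by rewrite !patchE; case: ifP => //; rewrite mul0r.
Qed.

(** Under the integral the gradient may be replaced by its Borel version, so [T]
determines the derivatives of [f]. *)
Lemma is_BV_derivativeP (mu : borel_vmeasure X O) :
  is_BV_derivative ip nu R v oO f mu <-> forall (phi : X -> K) z, Lipc O phi ->
    charge_integral (coord_charge ip mu z (open_borel oO)) O phi = T z phi.
Proof.
have E (phi : X -> K) z : Lipc O phi ->
    \int[nu]_(x in O) (f x * (ip (R (gateaux_grad ip phi x)) z - phi x * v z x)) = - T z phi.
  move=> /Lipc_blip[M _ bp].
  have := sum_div_functional lip_gateaux adjP fi fvi (fun _ : 'I_1 => z)
    (fun _ => ex_intro _ M bp).
  rewrite restrict_int big_ord1 => <-; apply: eq_Rintegral => x _.
  by rewrite big_ord1.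
split=> h phi z pO; last by rewrite E// h.
by apply: oppr_inj; rewrite -E// h.
Qed.

Let Mstar_int m (e : 'I_m -> X) (phi : X -> X) : Lipc O phi ->
  \int[nu]_(x in O) (f x * Mstar ip R v e phi x) =
  \sum_j T (e j) (fun x => - ip (phi x) (e j)).
Proof.
move=> pO; have cO j := Lipc_ip ip (e j) pO.
rewrite restrict_int (sum_div_functional lip_gateaux adjP fi fvi e (phi := fun j y => ip (phi y) (e j))).
  rewrite -sumrN; apply: eq_bigr => j _; rewrite -mulN1r -T_scale//.
  by congr (T _); apply/funext => x; rewrite mulN1r.
by move=> j; have [M _ bM] := Lipc_blip (cO j); exists M.
Qed.

Lemma sum_le_nu_variation m (e : 'I_m -> X) (phi : 'I_m -> X -> K) :
  (forall i j, ip (e i) (e j) = (i == j)%:R) -> (forall j, Lipc O (phi j)) ->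
  (forall x, \sum_j phi j x ^+ 2 <= 1) -> ((\sum_j T (e j) (phi j))%:E <= V)%E.
Proof.
move=> eo phiO phi1; apply: ereal_sup_ubound.
(* The sign cancels the one in the definition of the functional. *)
pose Phi x := \sum_j (- 1 * phi j x) *: e j.
have PhiO : Lipc O Phi.
  apply: Lipc_sum => j; have NO := LipcMl (- 1) (phiO j).
  have [M M0 bp] := Lipc_blip NO.
  have bq := blip_max (blipZ bp (blip_cst _ (e j))).
  apply: (Lipc_dom NO bq).
  by move=> x /= ->; rewrite scale0r.
exists [set \sum_i c i *: e i | c in [set: 'I_m -> K]], m, e, Phi; split=> //.
- move=> x; rewrite -(@expr_le1 _ 2)// (norm_orthonormal (ip := ip) _ eo).
  by under eq_bigr do rewrite mulN1r sqrrN.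
congr EFin; rewrite Mstar_int//; apply: eq_bigr => j _; congr (T _).
apply/funext => x; rewrite /Phi ip_suml' (bigD1 j)//= big1 => [|i ij].
  by rewrite ipZl eo eqxx mulr1 addr0 mulN1r opprK.
by rewrite ipZl eo (negbTE ij) mulr0.
Qed.

Lemma nu_variation_le (C : \bar K) :
  (forall m (e : 'I_m -> X) (phi : 'I_m -> X -> K),
    (forall i j, ip (e i) (e j) = (i == j)%:R) -> (forall j, Lipc O (phi j)) ->
    (forall x, \sum_j phi j x ^+ 2 <= 1) -> ((\sum_j T (e j) (phi j))%:E <= C)%E) ->
  (V <= C)%E.
Proof.
move=> H; apply: ge_ereal_sup => _ [F [m [e [phi [[eo FE] pO pF p1 ->]]]]].
rewrite Mstar_int//; apply: H => //.
  move=> j; have := LipcMl (- 1) (Lipc_ip ip (e j) pO).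
  by under eq_fun do rewrite mulN1r.
move=> x; have := pF x; rewrite FE => -[c _ cE].
have -> : \sum_j (- ip (phi x) (e j)) ^+ 2 = `|phi x| ^+ 2.
  rewrite -cE (norm_orthonormal (ip := ip) _ eo); apply: eq_bigr => j _.
  rewrite sqrrN ip_suml' (bigD1 j)//= big1 => [|i ij].
    by rewrite ipZl eo eqxx mulr1 addr0.
  by rewrite ipZl eo (negbTE ij) mulr0.
by rewrite expr_le1// p1.
Qed.

Section FiniteVariation.
Hypothesis Voo : (V < +oo)%E.

Lemma nu_variation_ge0 : (0 <= V)%E.
Proof.
pose e0 (_ : 'I_0) : X := 0; pose p0 (_ : 'I_0) (_ : X) : K := 0.
have E : 0 = \sum_j T (e0 j) (p0 j) by rewrite big_ord0.
rewrite -[0%E]/((0 : K)%:E) E; apply: sum_le_nu_variation.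
- by case.
- by case.
- by move=> x; rewrite big_ord0 ler01.
Qed.

Let W := fine V.

Let VE : V = W%:E.
Proof. by rewrite /W fineK// ge0_fin_numE// nu_variation_ge0. Qed.

Let T_le m (e : 'I_m -> X) (phi : 'I_m -> X -> K) :
  (forall i j, ip (e i) (e j) = (i == j)%:R) -> (forall j, Lipc O (phi j)) ->
  (forall x, \sum_j phi j x ^+ 2 <= 1) -> \sum_j T (e j) (phi j) <= W.
Proof. by move=> *; rewrite -lee_fin -VE; exact: sum_le_nu_variation. Qed.

Let T_zero (phi : X -> K) : Lipc O phi -> T 0 phi = 0.
Proof.
by move=> pO; have := T_dir (-1) 0 0 pO; rewrite scaler0 addr0 mulN1r addNr.
Qed.

Let T_dirZ (a : K) z (phi : X -> K) : Lipc O phi -> T (a *: z) phi = a * T z phi.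
Proof. by move=> pO; have := T_dir a z 0 pO; rewrite T_zero// !addr0. Qed.

(** The field with the single component [phi] in the direction [z] is an admissible
test field. *)
Let T_bound z (phi : X -> K) : Lipc O phi -> (forall x, 0 <= phi x <= 1) ->
  T z phi <= `|z| * W.
Proof.
move=> pO p01; have [->|z0] := eqVneq z 0.
  by rewrite T_zero// normr0 mul0r.
have nz : `|z| != 0 by rewrite normr_eq0.
have -> : T z phi = `|z| * T (`|z|^-1 *: z) phi.
  by rewrite -T_dirZ// scalerA divff// scale1r.
rewrite ler_wpM2l//.
have := @T_le 1 (fun=> `|z|^-1 *: z) (fun=> phi); rewrite big_ord1; apply=> //.
  move=> i j; rewrite !ord1 eqxx -(ip_normE ip) normrZ normfV normr_id mulVf//.
  by rewrite expr1n.
move=> x; rewrite big_ord1; have /andP[? ?] := p01 x.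
by rewrite expr_le1.
Qed.

Let T_lip z : lip_functional O (T z) (`|z| * W).
Proof.
split=> [phi psi pO qO|a phi pO|phi pO p01|L phi pO bL p0].
- have := T_lin z 1 pO qO; rewrite mul1r => <-.
  by congr (T z); apply/funext => x; rewrite mul1r.
- exact: T_scale.
- exact: T_bound.
- exact: (div_functional_cvg sepX lip_gateaux adjP vi v_parts fi fvi z bL p0).
Qed.

Let T_repr z : exists mp mn : {finite_measure set (borel X) -> \bar K},
  [/\ mp (~` O) = 0%E, mn (~` O) = 0%E & forall phi, Lipc O phi ->
    T z phi = \int[mp]_x phi x - \int[mn]_x phi x].
Proof.
apply: (lip_functional_repr sepX oO (T_lip z) (C' := `|- z| * W)).
have [_ _ _ cT] := T_lip z; have [aN zN bN _] := T_lip (- z).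
have TN (phi : X -> K) : Lipc O phi -> T (- z) phi = - T z phi.
  by move=> pO; rewrite -scaleN1r T_dirZ// mulN1r.
split=> [phi psi pO qO|a phi pO|phi pO p01|L phi pO bL p0].
- by rewrite -!TN// ?aN//; exact: LipcD.
- by rewrite -!TN// ?zN//; exact: LipcMl.
- by rewrite -TN//; exact: bN.
- by rewrite -(oppr0 K); apply: cvgN; exact: cT bL p0.
Qed.

Lemma BV_derivative_exists : exists mu, is_BV_derivative ip nu R v oO f mu.
Proof.
have [mu hmu] := vmeasure_repr sepX oO T_lin T_le T_dir T_repr.
by exists mu; apply/is_BV_derivativeP.
Qed.

Lemma variation_le_nu_variation (mu : borel_vmeasure X O) :
  is_BV_derivative ip nu R v oO f mu -> (vm_variation mu O <= V)%E.
Proof.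
move=> /is_BV_derivativeP hmu.
have /choice[ab hab] := fun z => @coord_measures _ _ ip O oO
  (fun z phi => T z phi) mu z (fun phi pO => hmu phi z pO).
apply: ge_ereal_sup => _ [A [mA tA AO] <-]; rewrite VE.
have AkO k : A k `<=` O by rewrite -AO; exact: bigcup_sup.
apply: lime_le; first exact: is_cvg_nneseries.
apply: nearW => n; rewrite sumEFin lee_fin big_mkord.
apply: (@vector_sum_norm_le _ _ ip sepX O oO (fun z phi => T z phi) W T_lin T_le mu
  (fun z => (ab z).1) (fun z => (ab z).2)) => //.
- by move=> z phi pO; have [+ _] := hab z; exact.
- by move=> z B mB BO; have [_ +] := hab z; exact.
Qed.

End FiniteVariation.

Lemma nu_variation_le_variation (mu : borel_vmeasure X O) :
  is_BV_derivative ip nu R v oO f mu -> (V <= vm_variation mu O)%E.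
Proof.
move=> /is_BV_derivativeP hmu; apply: nu_variation_le => m e phi eo pO p1.
have := field_integral_le_variation sepX oO mu eo pO p1.
by under eq_bigr do rewrite hmu//.
Qed.

Theorem BV_iff_nu_variation_finite :
  (BV ip nu R v oO f <-> (V < +oo)%E) /\
  (forall mu : borel_vmeasure X O, is_BV_derivative ip nu R v oO f mu ->
     vm_variation mu O = V).
Proof.
have eqV (mu : borel_vmeasure X O) : is_BV_derivative ip nu R v oO f mu ->
    vm_variation mu O = V.
  move=> hmu; have Vle := nu_variation_le_variation hmu.
  apply/eqP; rewrite eq_le Vle andbT; apply: variation_le_nu_variation => //.
  exact: le_lt_trans Vle (vmeasure_finite_variation mu).
split=> //; split=> [[_ _ [mu hmu]]|Voo].
  by rewrite -(eqV mu hmu); exact: vmeasure_finite_variation.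
have mO := open_borel oO.
split; last exact: BV_derivative_exists.
  apply/(integrable_mkcond _ mO).2; move: fi; congr (integrable _ _ _).
  by apply/funext => x; rewrite /= !patchE; case: ifP.
move=> z; apply/(integrable_mkcond _ mO).2; move: (fvi z); congr (integrable _ _ _).
by apply/funext => x; rewrite /= !patchE; case: ifP => //; rewrite mul0r.
Qed.

End BVFunctional.

(** * Conjugate exponents and the characterization *)

Section ConjugateExponents.
Context d (S : measurableType d) (K : realType) (nu : probability S K).

Lemma Lfun_probability_le (p q : \bar K) : (1 <= p)%E -> (p <= q)%E ->
  {subset Lfun nu q <= Lfun nu p}.
Proof.
move=> p1 pq; apply: Lfun_subset => //; first exact: le_trans pq.
exact: fin_num_measure.
Qed.

(** Hoelder's inequality with the exponent conjugate to [p], after [p] is replaced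
by a finite exponent. *)
Lemma integrable_mul_all_Lfun (p : \bar K) (f g : S -> K) : (1 < p)%E ->
  f \in Lfun nu p -> (forall q : K, 1 <= q -> g \in Lfun nu q%:E) ->
  nu.-integrable setT (EFin \o (fun x => f x * g x)).
Proof.
move=> p1 fp gq.
have [r r1 fr] : exists2 r : K, 1 < r & f \in Lfun nu r%:E.
  case: p p1 fp => [r| |]//; first by rewrite lte_fin => r1 fr; exists r.
  move=> _ foo; exists 2; first by rewrite ltr1n.
  by apply: Lfun_probability_le foo; rewrite ?leey// lee_fin ler1n.
have r0 : 0 < r by exact: lt_trans r1.
have s0 : 0 < r - 1 by rewrite subr_gt0.
pose q := r / (r - 1); have q1 : 1 <= q by rewrite ler_pdivlMr// mul1r gerBl.
have := gq q q1; move: fr; rewrite !inE => /andP[/[!inE]/= mf nf] /andP[/[!inE]/= mg ng].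
apply/Lfun1_integrable; rewrite inE; apply/andP; split; rewrite inE/=.
  exact: measurable_funM.
apply: le_lt_trans (hoelder _ mf mg r0 (lt_le_trans ltr01 q1) _) _.
  by rewrite /q; field; rewrite !gt_eqF.
by rewrite lte_mul_pinfty// ?ge0_fin_numE ?Lnorm_ge0.
Qed.

End ConjugateExponents.

Theorem theorem5p10 (K : realType) (X : completeNormedModType K)
    (ip : inner_product X) (sepX : separable_space X)
    (nu : probability (borel X) K)
    (R : {linear X -> X}) (contR : continuous R)
    (v : X -> X -> K)
    (v_Lp : forall (z : X) (q : K), 1 <= q -> (v z : borel X -> K) \in Lfun nu q%:E)
    (v_parts : forall (z : X) (phi : X -> K), C1b ip phi ->
      \int[nu]_x ip (R (frechet_grad ip phi x)) z = \int[nu]_x (phi x * v z x))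
    (lip_gateaux : forall phi : X -> K, [lipschitz phi x | x in setT] ->
      {ae nu, forall x, gateaux_differentiable ip phi x})
    (O : set X) (oO : open O) (p : \bar K) (p1 : (1 < p)%E)
    (f : X -> K) (fLp : (f \_ O : borel X -> K) \in Lfun nu p) :
  (BV ip nu R v oO f <-> (nu_variation ip nu R v O f < +oo)%E) /\
  (forall mu : borel_vmeasure X O, is_BV_derivative ip nu R v oO f mu ->
     vm_variation mu O = nu_variation ip nu R v O f).
Proof.
have /choice[adj adjE] := fun z => adjoint ip sepX z contR.
apply: (BV_iff_nu_variation_finite sepX lip_gateaux (fun x z => adjE z x)) => //.
- by move=> z; apply/Lfun1_integrable; exact: v_Lp.
- by apply/Lfun1_integrable; apply: Lfun_probability_le fLp => //; exact: ltW.
- by move=> z; apply: integrable_mul_all_Lfun p1 fLp (v_Lp z).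
Qed.
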